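(* Let $0<\alpha<1$. Let $(\mathbf{u},\Theta)$ be a weak solution (in the sense specified in the context) of the Oberbeck--Boussinesq system with non-local boundary condition on $[0,\infty)\times\Omega$. Then $$|\Theta(t,x)|\le\operatorname*{ess\,sup}_{\Omega}|\Theta(0,\cdot)|+\frac{2}{1-\alpha^2}\max_{\partial\Omega}|\vartheta_B|\qquad\text{for a.a. }(t,x)\in(0,\infty)\times\Omega.$$
   Context: Setting: $\Omega\subset\mathbb{R}^d$, $d=2,3$, is a bounded domain with sufficiently regular boundary; $\mu,\kappa>0$ are constants; $G\in W^{1,\infty}(\Omega)$ with $\Delta_x G=0$ in $\Omega$ and $\int_\Omega G\,dx=0$. $\vartheta_B$ denotes the boundary datum on $\partial\Omega$ and also its unique harmonic extension to $\Omega$, assumed of class $C^2(\overline\Omega)$. Write $\langle f\rangle=\frac{1}{|\Omega|}\int_\Omega f\,dx$. Initial data: $\mathbf{u}(0,\cdot)=\mathbf{u}_0\in L^2(\Omega;\mathbb{R}^d)$, $\operatorname{div}_x\mathbf{u}_0=0$; $\Theta(0,\cdot)=\Theta_0\in W^{2,q}(\Omega)\cap L^\infty(\Omega)$ for a certain $q>1$, with $\Theta_0|_{\partial\Omega}=\vartheta_B-\alpha\langle\Theta_0\rangle$. Weak solution (here): $\mathbf{u}\in L^\infty_{\rm loc}([0,\infty);L^2(\Omega;\mathbb{R}^d))\cap L^2_{\rm loc}([0,\infty);W^{1,2}_0(\Omega;\mathbb{R}^d))$, $\operatorname{div}_x\mathbf{u}=0$ a.e., and $$\left[\int_\Omega\mathbf{u}\cdot\boldsymbol\varphi\,dx\right]_{t=0}^{t=\tau}=\int_0^\tau\!\int_\Omega\big(\mathbf{u}\cdot\partial_t\boldsymbol\varphi+(\mathbf{u}\otimes\mathbf{u}):\nabla_x\boldsymbol\varphi-\mu\nabla_x\mathbf{u}:\nabla_x\boldsymbol\varphi-\Theta\nabla_xG\cdot\boldsymbol\varphi\big)\,dx\,dt$$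 for all $\tau>0$ and $\boldsymbol\varphi\in C^1_c([0,\infty)\times\Omega;\mathbb{R}^d)$ with $\operatorname{div}_x\boldsymbol\varphi=0$; and $\Theta\in L^2_{\rm loc}([0,\infty);W^{1,2}(\Omega))\cap L^\infty_{\rm loc}([0,\infty)\times\overline\Omega)$, $\Theta+\alpha\langle\Theta\rangle-\vartheta_B\in L^2_{\rm loc}([0,\infty);W^{1,2}_0(\Omega))$, and $$\left[\int_\Omega\Theta\varphi\,dx\right]_{t=0}^{t=\tau}=\int_0^\tau\!\int_\Omega\big(\Theta\,\partial_t\varphi+\Theta\,\mathbf{u}\cdot\nabla_x\varphi-\kappa\nabla_x\Theta\cdot\nabla_x\varphi\big)\,dx\,dt$$ for all $\tau>0$ and $\varphi\in C^1_c([0,\infty)\times\Omega)$. Both $\mathbf u$ and $\Theta$ are identified with their weakly continuous in time representatives. *)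

(* Defs.v *)
From HB Require Import structures.
From mathcomp Require Import all_boot all_order all_algebra.
From mathcomp Require Import all_classical all_reals all_analysis.
From mathcomp Require Import ess_sup_inf.

Set Implicit Arguments.
Unset Strict Implicit.
Unset Printing Implicit Defensive.

Import Order.TTheory GRing.Theory Num.Theory.
Import numFieldNormedType.Exports.

Local Open Scope classical_set_scope.
Local Open Scope ring_scope.

(* Row vectors get the sigma-algebra generated by the coordinates, exactly as
   the library does for n.-tuple T. *)
Section rV_measurable.
Context {d} {T : sigmaRingType d} (n : nat).

Let coors : 'I_n -> 'rV[T]_n -> T := fun i x => x ord0 i.

Let rV_set0 : g_sigma_preimage coors set0.
Proof. exact: sigma_algebra0. Qed.

Let rV_setC A : g_sigma_preimage coors A -> g_sigma_preimage coors (~` A).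
Proof. exact: sigma_algebraC. Qed.

Let rV_bigcup (F : (set 'rV[T]_n)^nat) :
  (forall i, g_sigma_preimage coors (F i)) ->
  g_sigma_preimage coors (\bigcup_i (F i)).
Proof. exact: sigma_algebra_bigcup. Qed.

HB.instance Definition _ := @isMeasurable.Build (measure_tuple_display d)
  'rV[T]_n (g_sigma_preimage coors) rV_set0 rV_setC rV_bigcup.

End rV_measurable.

Section measurable_rV.
Context {d} {T : measurableType d}.

Lemma measurable_coord n (i : 'I_n) :
  measurable_fun [set: 'rV[T]_n] (fun x : 'rV[T]_n => x ord0 i).
Proof.
move=> _ Y mY; rewrite setTI; apply: sub_sigma_algebra => /=.
rewrite -bigcup_seq/=; exists i => /=; first by rewrite mem_index_enum.
by exists Y => //; rewrite setTI.
Qed.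

Lemma measurable_fun_rV d' (S : measurableType d') n (f : S -> 'rV[T]_n) :
  (forall i, measurable_fun [set: S] (fun s => f s ord0 i)) ->
  measurable_fun [set: S] f.
Proof.
move=> mf _ A mA.
pose C := image_set_system [set: S] f (@measurable _ S).
suff : C A by [].
move: A mA; apply: smallest_sub.
  exact: sigma_algebra_image (@sigma_algebra_measurable _ S).
move=> B; rewrite -bigcup_seq/= => -[i _ [Y mY <-]].
by rewrite /C /image_set_system/= setTI; exact: mf.
Qed.

Definition row_cons n (x : T * 'rV[T]_n) : 'rV[T]_n.+1 :=
  \row_i oapp (x.2 ord0) x.1 (unlift ord0 i).

Definition row_uncons n (x : 'rV[T]_n.+1) : T * 'rV[T]_n :=
  (x ord0 ord0, \row_j x ord0 (lift ord0 j)).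

Lemma row_consK n : cancel (@row_cons n) (@row_uncons n).
Proof.
case=> a x; rewrite /row_uncons /row_cons; congr pair.
  by rewrite mxE unlift_none.
by apply/rowP => j; rewrite !mxE liftK.
Qed.

Lemma measurable_row_cons n : measurable_fun setT (@row_cons n).
Proof.
apply: measurable_fun_rV => i; under eq_fun do rewrite mxE.
case: unlift => [j|]/=; last exact: measurable_fst.
exact: (measurableT_comp (measurable_coord j)) measurable_snd.
Qed.

Lemma measurable_row_uncons n : measurable_fun setT (@row_uncons n).
Proof.
apply: measurable_fun_pair; first exact: measurable_coord.
apply: measurable_fun_rV => i; under eq_fun do rewrite mxE.
exact: measurable_coord.
Qed.

End measurable_rV.

Section lebesgue_rV_step.
Context (R : realType) (n : nat).
Variable m : {sigma_finite_measure set 'rV[R]_n -> \bar R}.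

Definition lebesgue_rV_step : set 'rV[R]_n.+1 -> \bar R :=
  pushforward (lebesgue_measure \x m)%E (@row_cons _ R n).

Let mpre A : measurable A -> measurable
  (@row_cons _ R n @^-1` A : set (measurableTypeR R * 'rV[R]_n)).
Proof. by move=> mA; rewrite -[X in measurable X]setTI; exact: measurable_row_cons. Qed.

Let step0 : lebesgue_rV_step set0 = 0%E.
Proof. by rewrite /lebesgue_rV_step /pushforward preimage_set0 measure0. Qed.

Let step_ge0 A : (0 <= lebesgue_rV_step A)%E.
Proof. by rewrite /lebesgue_rV_step /pushforward; exact: measure_ge0. Qed.

Let step_sigma_additive : semi_sigma_additive lebesgue_rV_step.
Proof.
move=> F mF tF mUF; rewrite /lebesgue_rV_step /pushforward preimage_bigcup.
apply: measure_semi_sigma_additive.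
- by move=> k; exact: mpre.
- apply/trivIsetP => i j _ _ ij; rewrite -preimage_setI.
  by move/trivIsetP : tF => /(_ _ _ _ _ ij) ->//; rewrite preimage_set0.
- by rewrite -preimage_bigcup; exact: mpre.
Qed.

HB.instance Definition _ := isMeasure.Build _ _ _
  lebesgue_rV_step step0 step_ge0 step_sigma_additive.

Let step_sigma_finite : sigma_finite setT lebesgue_rV_step.
Proof.
have /sigma_finiteP[F [FT ndF Foo]] := sigma_finiteT (@lebesgue_measure R).
have /sigma_finiteP[G [GT ndG Goo]] := sigma_finiteT m.
exists (fun k => @row_uncons _ R n @^-1` (F k `*` G k)).
  apply/esym; rewrite -subTset => x _.
  have [i _ Fi] : (\bigcup_i F i) (row_uncons x).1 by rewrite -FT.
  have [j _ Gj] : (\bigcup_i G i) (row_uncons x).2 by rewrite -GT.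
  exists (maxn i j) => //; split.
    by move: Fi; exact/subsetPset/ndF/leq_maxl.
  by move: Gj; exact/subsetPset/ndG/leq_maxr.
move=> k; have [mF Fk] := Foo k; have [mG Gk] := Goo k; split.
  rewrite -[X in measurable X]setTI.
  by apply: measurable_row_uncons => //; exact: measurableX.
rewrite /lebesgue_rV_step /pushforward -comp_preimage.
rewrite (_ : _ \o _ = id); last by apply/funext => x; exact: row_consK.
rewrite preimage_id product_measure1E//.
by rewrite lte_mul_pinfty// ge0_fin_numE.
Qed.

HB.instance Definition _ := Measure_isSigmaFinite.Build _ _ _
  lebesgue_rV_step step_sigma_finite.

End lebesgue_rV_step.

Fixpoint lebesgue_rV (R : realType) n :
    {sigma_finite_measure set 'rV[R]_n -> \bar R} :=
  if n is k.+1 then lebesgue_rV_step (lebesgue_rV R k) else \d_(0 : 'rV[R]_0).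

Lemma lebesgue_rV_box (R : realType) n (A : 'I_n -> set R) :
  (forall i, measurable (A i)) ->
  lebesgue_rV R n [set x | forall i, A i (x ord0 i)] =
  (\prod_(i < n) lebesgue_measure (A i))%E.
Proof.
elim: n A => [|n IHn] A mA.
  by rewrite big_ord0 /= diracE mem_set// => -[].
pose B (i : 'I_n) := A (lift ord0 i).
have mB : measurable [set x : 'rV[R]_n | forall i, B i (x ord0 i)].
  rewrite (_ : [set x | _] = \big[setI/setT]_(i < n)
      ((fun x : 'rV[R]_n => x ord0 i) @^-1` B i)).
    apply: bigsetI_measurable => i _; rewrite -[X in measurable X]setTI.
    by apply: measurable_coord => //; exact: mA.
  by apply/seteqP; split=> x; rewrite -bigcap_seq/= => h i;
    [move=> _; exact: h|apply: h => /=; rewrite mem_index_enum].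
rewrite big_ord_recl -(IHn B) => [|i]; last exact: mA.
rewrite /= /lebesgue_rV_step /pushforward.
rewrite (_ : _ @^-1` _ =
    A ord0 `*` [set x : 'rV[R]_n | forall i, B i (x ord0 i)]).
  by rewrite product_measure1E//; exact: mA.
apply/seteqP; split => -[a x] /=.
  move=> h; split => [|i].
    by have := h ord0; rewrite mxE unlift_none.
  by have := h (lift ord0 i); rewrite mxE liftK.
move=> [Aa Bx] i; rewrite mxE; case: unliftP => [j|] ->//=.
exact: Bx.
Qed.

Definition lebesgue_time_rV (R : realType) d :
    {measure set (measurableTypeR R * 'rV[R]_d) -> \bar R} :=
  (lebesgue_measure \x lebesgue_rV R d)%E.

Definition Lp_on d (T : measurableType d) (R : realType)
    (mu : {measure set T -> \bar R}) (p : \bar R) (A : set T) (f : T -> R) :=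
  measurable_fun A f /\ finite_norm mu p (f \_ A).

(* ess sup over A of |f|; extending f by zero outside A does not change it. *)
Definition ess_sup_norm d (T : measurableType d) (R : realType)
    (mu : {measure set T -> \bar R}) (A : set T) (f : T -> R) : \bar R :=
  ess_sup mu (fun x => `|(f \_ A) x|%:E).

Section function_spaces.
Context (R : realType) (d : nat).
Local Notation E := 'rV[R]_d.
Local Notation dx := (lebesgue_rV R d).
Local Notation dtdx := (lebesgue_time_rV R d).
Local Notation "''e_' i" := (delta_mx ord0 i : E).
Implicit Types (Om : set E) (p : \bar R).

Definition partial (i : 'I_d) (f : E -> R) : E -> R := fun x => 'D_('e_i) f x.

Definition laplacian (f : E -> R) : E -> R :=
  fun x => \sum_i partial i (partial i f) x.

(* C^k(U), U open *)
Fixpoint Ck_on (k : nat) (U : set E) (f : E -> R) : Prop :=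
  (forall x, U x -> {for x, continuous f}) /\
  (if k is k'.+1 then
     forall i, (forall x, U x -> derivable f x 'e_i) /\
               Ck_on k' U (partial i f)
   else True).

(* f is of class C^k on the open set U, and f and its partial derivatives up
   to order k extend continuously to the closure of U.  The extension is
   existentially quantified because 'D_v f has no meaning on the boundary. *)
Fixpoint Ck_upto_boundary (k : nat) (U : set E) (f : E -> R) : Prop :=
  (exists g : E -> R, {within closure U, continuous g} /\ {in U, f =1 g}) /\
  (if k is k'.+1 then
     forall i, (forall x, U x -> derivable f x 'e_i) /\
               Ck_upto_boundary k' U (partial i f)
   else True).

(* C^k(closure U); here the values of f on the boundary are relevant *)
Definition Ck_closure (k : nat) (U : set E) (f : E -> R) : Prop :=
  {within closure U, continuous f} /\ Ck_upto_boundary k U f.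

Definition boundary (U : set E) : set E := closure U `\` interior U.

(* Near every boundary point, in suitable orthonormal coordinates y *m Q, the
   set U is the strict epigraph of a Lipschitz function of d - 1 variables. *)
Definition lipschitz_boundary (U : set E) : Prop :=
  forall x, boundary U x ->
  exists (Q : 'M[R]_d) (i : 'I_d) (gamma : 'rV[R]_d.-1 -> R),
    [/\ Q *m Q^T = 1%:M, lipschitz gamma &
        \forall y \near x, U y <-> gamma (col' i (y *m Q)) < (y *m Q) ord0 i].

Definition bounded_lipschitz_domain (U : set E) : Prop :=
  [/\ open U, connected U, U !=set0, bounded_set U & lipschitz_boundary U].

(* C^oo_c(Om), extended by zero *)
Definition test_fun Om (phi : E -> R) : Prop :=
  (forall k, Ck_on k [set: E] phi) /\
  exists K, [/\ compact K, K `<=` Om & forall x, ~ K x -> phi x = 0].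

Definition time_derivative (phi : R -> E -> R) : R -> E -> R :=
  fun t x => derive1 (fun s => phi s x) t.

(* C^1_c([0,oo) x Om), described as the restrictions to t >= 0 of the functions
   of C^1_c(R x Om): a C^1 function on [0,oo) x Om with compact support
   extends by reflection. *)
Definition test_fun_time Om (phi : R -> E -> R) : Prop :=
  [/\ continuous (fun z : R * E => phi z.1 z.2),
      (forall t x, derivable (fun s => phi s x) t 1) /\
        continuous (fun z : R * E => time_derivative phi z.1 z.2),
      (forall i, (forall t x, derivable (phi t) x 'e_i) /\
        continuous (fun z : R * E => partial i (phi z.1) z.2)) &
      exists K : set (R * E), [/\ compact K, K `<=` [set z | Om z.2] &
        forall t x, ~ K (t, x) -> phi t x = 0]].

Definition weak_partial Om (i : 'I_d) (f g : E -> R) : Prop :=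
  forall phi, test_fun Om phi ->
    \int[dx]_(x in Om) (f x * partial i phi x) =
    - \int[dx]_(x in Om) (g x * phi x).

Definition sobolev1 p Om (f : E -> R) (Df : E -> E) : Prop :=
  [/\ Lp_on dx p Om f,
      forall i, Lp_on dx p Om (fun x => Df x ord0 i) &
      forall i, weak_partial Om i f (fun x => Df x ord0 i)].

(* closure of C^oo_c(Om) in W^{1,p}(Om) *)
Definition sobolev1_0 p Om (f : E -> R) (Df : E -> E) : Prop :=
  sobolev1 p Om f Df /\
  exists phi : nat -> E -> R,
    [/\ forall n, test_fun Om (phi n),
        Lnorm dx p (EFin \o ((fun x => f x - phi n x) \_ Om))
          @[n --> \oo] --> 0%E &
        forall i,
        Lnorm dx p (EFin \o
          ((fun x => Df x ord0 i - partial i (phi n) x) \_ Om))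
          @[n --> \oo] --> 0%E].

Definition sobolev2 p Om (f : E -> R) : Prop :=
  exists (Df : E -> E) (D2f : E -> 'M[R]_d), sobolev1 p Om f Df /\
    forall i, sobolev1 p Om (fun x => Df x ord0 i) (fun x => row i (D2f x)).

Definition cylinder (T : R) Om : set (measurableTypeR R * E) :=
  `]0, T[ `*` Om.

Definition Lp_loc_cylinder p Om (f : R -> E -> R) : Prop :=
  forall T : R, 0 < T -> Lp_on dtdx p (cylinder T Om) (fun z => f z.1 z.2).

Definition Linfty_loc_L2 Om (f : R -> E -> R) : Prop :=
  forall T : R, 0 < T -> exists C : R,
    {ae (@lebesgue_measure R), forall t, 0 < t < T ->
      (Lnorm dx 2%:E (EFin \o (f t \_ Om)) <= C%:E)%E}.

(* L^2_loc([0,oo); W^{1,2}(Om)): Bochner measurability is rendered by joint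
   measurability of f and Df in (t, x). *)
Definition L2_loc_sobolev1 Om (f : R -> E -> R) (Df : R -> E -> E) : Prop :=
  [/\ Lp_loc_cylinder 2%:E Om f,
      forall i, Lp_loc_cylinder 2%:E Om (fun t x => Df t x ord0 i) &
      {ae (@lebesgue_measure R), forall t, 0 < t ->
        sobolev1 2%:E Om (f t) (Df t)}].

Definition L2_loc_sobolev1_0 Om (f : R -> E -> R) (Df : R -> E -> E) : Prop :=
  L2_loc_sobolev1 Om f Df /\
  {ae (@lebesgue_measure R), forall t, 0 < t ->
    sobolev1_0 2%:E Om (f t) (Df t)}.

Definition weakly_continuous_L2 Om (f : R -> E -> R) : Prop :=
  (forall t, 0 <= t -> Lp_on dx 2%:E Om (f t)) /\
  forall g, Lp_on dx 2%:E Om g ->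
    {within `[0, +oo[, continuous
      (fun t : R => \int[dx]_(x in Om) (f t x * g x))}.

Definition mean Om (f : E -> R) : R :=
  (fine (dx Om))^-1 * \int[dx]_(x in Om) f x.

Definition distributionally_harmonic Om (f : E -> R) : Prop :=
  forall phi, test_fun Om phi ->
    \int[dx]_(x in Om) (f x * laplacian phi x) = 0.

Definition distributionally_solenoidal Om (v : E -> E) : Prop :=
  forall phi, test_fun Om phi ->
    \int[dx]_(x in Om) (\sum_i v x ord0 i * partial i phi x) = 0.

End function_spaces.

Section oberbeck_boussinesq.
Context (R : realType) (d : nat).
Local Notation E := 'rV[R]_d.
Local Notation dx := (lebesgue_rV R d).
Local Notation dtdx := (lebesgue_time_rV R d).

Definition momentum_equation (Om : set E) (mu : R) (DG : E -> E)
    (u : R -> E -> E) (Du : R -> E -> 'M[R]_d) (Theta : R -> E -> R) : Prop :=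
  forall (tau : R) (phi : R -> E -> E), 0 < tau ->
  (forall i, test_fun_time Om (fun t x => phi t x ord0 i)) ->
  (forall t x, \sum_i partial i (fun y => phi t y ord0 i) x = 0) ->
  \int[dx]_(x in Om) (\sum_i u tau x ord0 i * phi tau x ord0 i)
  - \int[dx]_(x in Om) (\sum_i u 0 x ord0 i * phi 0 x ord0 i) =
  \int[dtdx]_(z in cylinder tau Om)
    (let: (t, x) := z in
     \sum_i u t x ord0 i * time_derivative (fun s y => phi s y ord0 i) t x
     + \sum_i \sum_j u t x ord0 i * u t x ord0 j
                     * partial j (fun y => phi t y ord0 i) x
     - mu * \sum_i \sum_j Du t x i j * partial j (fun y => phi t y ord0 i) x
     - Theta t x * \sum_i DG x ord0 i * phi t x ord0 i).

Definition heat_equation (Om : set E) (kappa : R)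
    (u : R -> E -> E) (Theta : R -> E -> R) (DTheta : R -> E -> E) : Prop :=
  forall (tau : R) (phi : R -> E -> R), 0 < tau ->
  test_fun_time Om phi ->
  \int[dx]_(x in Om) (Theta tau x * phi tau x)
  - \int[dx]_(x in Om) (Theta 0 x * phi 0 x) =
  \int[dtdx]_(z in cylinder tau Om)
    (let: (t, x) := z in
     Theta t x * time_derivative phi t x
     + Theta t x * \sum_i u t x ord0 i * partial i (phi t) x
     - kappa * \sum_i DTheta t x ord0 i * partial i (phi t) x).

(* Du t x i j stands for the derivative of the i-th component of u with respect
   to x_j. *)
Definition weak_solution (Om : set E) (mu kappa alpha : R) (DG : E -> E)
    (thetaB : E -> R) (u : R -> E -> E) (Theta : R -> E -> R) : Prop :=
  exists (Du : R -> E -> 'M[R]_d) (DTheta : R -> E -> E),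
  [/\ [/\ forall i, weakly_continuous_L2 Om (fun t x => u t x ord0 i),
          forall i, Linfty_loc_L2 Om (fun t x => u t x ord0 i),
          forall i, L2_loc_sobolev1_0 Om (fun t x => u t x ord0 i)
                      (fun t x => row i (Du t x)),
          {ae dtdx, forall z, 0 < z.1 -> Om z.2 -> \tr (Du z.1 z.2) = 0} &
          momentum_equation Om mu DG u Du Theta] &
      [/\ weakly_continuous_L2 Om Theta,
          Lp_loc_cylinder +oo%E Om Theta,
          L2_loc_sobolev1 Om Theta DTheta,
          exists Dv : R -> E -> E, L2_loc_sobolev1_0 Om
            (fun t x => Theta t x + alpha * mean Om (Theta t) - thetaB x) Dv &
          heat_equation Om kappa u Theta DTheta]].

(* The trace condition on Theta0 is expressed, as the boundary condition of a
   weak solution, by membership in a Sobolev space with zero trace. *)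
Definition initial_data (Om : set E) (alpha : R) (thetaB : E -> R)
    (u0 : E -> E) (Theta0 : E -> R) : Prop :=
  [/\ forall i, Lp_on dx 2%:E Om (fun x => u0 x ord0 i),
      distributionally_solenoidal Om u0,
      Lp_on dx +oo%E Om Theta0 &
      exists q : R, [/\ 1 < q, sobolev2 q%:E Om Theta0 &
        exists Dv : E -> E, sobolev1_0 q%:E Om
          (fun x => Theta0 x + alpha * mean Om Theta0 - thetaB x) Dv]].

End oberbeck_boussinesq.

(* Main.v *)
Require Import Defs.
From HB Require Import structures.
From mathcomp Require Import all_boot all_order all_algebra.
From mathcomp Require Import all_classical all_reals all_analysis.
From mathcomp Require Import measurable_realfun ess_sup_inf.
From mathcomp Require Import ring lra.

(** Let [M] be the essential supremum of [Theta 0], let [B] be the maximum of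
[thetaB] in modulus on the boundary, and suppose that [Theta] is at most [S] in
modulus on a cylinder. On the boundary [Theta] equals [thetaB] minus [alpha] times
the mean of [Theta], hence is at most [B + alpha * S]. If [K] is at least
[B + alpha * S] and [M], then [Theta - K] is non-positive at the initial time
and on the boundary, and the maximum principle for the advection-diffusion equation
yields [Theta <= K] ([comparison_principle]); the same holds for [- Theta]. The
number [C = M + 2 / (1 - alpha ^+ 2) * B] is at least [M] and at least
[B + alpha * C], so a bound [C + r] improves to [C + alpha * r]; starting from any
bound and iterating, only [C] remains ([a_priori_bound]).

The comparison is an energy estimate. Let [ramp] be a convex function of class C^2
that is positive exactly on the positive half-line, and let [E t] be the integral of
[ramp (Theta t - K)]. Formally, the derivative of [E] is the integral of [F] times
the gradient of [ramp1 (Theta - K)], where [F = Theta u - kappa grad Theta]. The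
diffusive part is non-positive. The transport part is the integral of [u] times
[Theta * ramp2 (Theta - K) * grad Theta], the gradient of a function of [Theta] with
zero trace, and it vanishes because [u] is solenoidal ([transport_term_eq0]). So [E],
which is zero initially, remains zero.

The time derivative of [Theta] is not a function, and this computation has to be
carried out with increments. The function [ramp1 (Theta t - K)], frozen at a time [t],
is a limit of admissible test functions ([truncation_limit]) and can be used in the
equation between [t - h] and [t]. As [ramp] is convex, [E t - E (t - h)] is at most
the integral of [F s] times [V t = ramp2 (Theta t - K) grad (Theta t)] over the times
[s] of the window from [t - h] to [t]. This is multiplied by the positive part of
[T - t], which turns [V] into a field [W], and integrated in [t]. The product
[2 F(s) W(t)] is [F(s)^2 + W(t)^2 - (F(s) - W(t))^2], a combination of non-negative
terms to which Tonelli's theorem applies. After division by [h], Fatou's lemma and Lebesgue's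
differentiation theorem, used for almost every fixed point of space, show that the last
term tends to [(F(t) - W(t))^2] at least, and the integral of [E] is at most that of
[F W], which is non-positive ([time_averaging]).

The remaining work is classical. Weak gradients are unique ([fundamental_lemma]), so
the gradient of [Theta] is obtained from that of the zero trace part, and [Theta - K] is
a limit of functions that are non-positive near the boundary
([boundary_condition_trace]). The harmonic extension of [thetaB] is bounded by its
boundary values ([weak_maximum_principle]). *)

Set Implicit Arguments.
Unset Strict Implicit.
Unset Printing Implicit Defensive.

Import Order.TTheory GRing.Theory Num.Theory.
Import numFieldNormedType.Exports.

Local Open Scope classical_set_scope.
Local Open Scope ring_scope.

Local Notation "''e_' i" := (delta_mx ord0 i : 'rV[_]_ _) (at level 8, i at level 2).

(** * Differentiation along a direction and the function [ramp] *)

Section pointwise_derivatives.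
Context {R : realType} {V : normedModType R}.
Implicit Types (f g : V -> R) (x v : V) (a b c : R).

Lemma is_derive_funD f g x v a b : is_derive x v f a -> is_derive x v g b ->
  is_derive x v (fun y => f y + g y) (a + b).
Proof. exact: is_deriveD. Qed.

Lemma is_derive_funB f g x v a b : is_derive x v f a -> is_derive x v g b ->
  is_derive x v (fun y => f y - g y) (a - b).
Proof. exact: is_deriveB. Qed.

Lemma is_derive_funM f g x v a b : is_derive x v f a -> is_derive x v g b ->
  is_derive x v (fun y => f y * g y) (f x * b + g x * a).
Proof. exact: is_deriveM. Qed.

Lemma is_derive_funZ f x v a c : is_derive x v f a ->
  is_derive x v (fun y => c * f y) (c * a).
Proof. exact: is_deriveZ. Qed.

Lemma is_derive_funX f x v a n : is_derive x v f a ->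
  is_derive x v (fun y => f y ^+ n) (n%:R * f x ^+ n.-1 * a).
Proof. by move=> fa; have := is_deriveX n fa; rewrite exprfctE. Qed.

Lemma is_derive_funV f x v a : f x != 0 -> is_derive x v f a ->
  is_derive x v (fun y => (f y)^-1) (- (f x) ^- 2 * a).
Proof.
by move=> f0 [df <-]; split; [exact: derivableV|rewrite deriveV].
Qed.

Lemma is_derive_fun_cst x v c : is_derive x v (fun _ : V => c) 0.
Proof. exact: is_derive_cst. Qed.

(** A derivative in the direction [v] is that of a function of one variable, the
restriction to a line. *)
Lemma is_derive_lineE f x v s a :
  is_derive (s *: v + x) v f a <-> is_derive s 1 (fun t => f (t *: v + x)) a.
Proof.
suff e : (fun h : R => h^-1 *: ((f \o shift (s *: v + x)) (h *: v)
                                - f (s *: v + x))) =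
         (fun h : R => h^-1 *: (((fun t => f (t *: v + x)) \o shift s)
                                (h *: (1 : R)) - f (s *: v + x))).
  by split => -[]; rewrite /derivable /derive => fl fa; split;
    rewrite /derivable /derive ?e// -e.
by apply/funext => h; rewrite /= [h *: 1]mulr1 scalerDl addrA.
Qed.

Lemma is_derive_line0E f x v a :
  is_derive x v f a <-> is_derive (0 : R) 1 (fun t => f (t *: v + x)) a.
Proof. by have := is_derive_lineE f x v 0 a; rewrite scale0r add0r. Qed.

Lemma is_derive_comp1 (k : R -> R) f x v a b :
  is_derive (f x) 1 k b -> is_derive x v f a ->
  is_derive x v (fun y => k (f y)) (b * a).
Proof.
have e y : y = (0 : R) *: v + y by rewrite scale0r add0r.
rewrite [in X in _ -> X -> _](e x) => dk /is_derive_lineE df.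
rewrite (e x); apply/is_derive_lineE.
by apply: (@is_derive1_comp _ k) => //; rewrite -e.
Qed.

End pointwise_derivatives.

Section real_functions.
Context {R : realType}.
Implicit Types (k f g : R -> R) (s t c : R).

(** Makes it possible to glue a function to zero at a point where it is [O((y - x)^2)]. *)
Lemma is_derive0_quadratic f x C : f x = 0 ->
  (forall y, `|f y| <= C * (y - x) ^+ 2) -> is_derive x 1 f 0.
Proof.
move=> fx0 fC; apply/is_derive1_caratheodory.
exists (fun z => f z / (z - x)); split.
- move=> z; rewrite fx0 subr0.
  have [->|zx] := eqVneq z x; first by rewrite fx0 mul0r mul0r.
  by rewrite divfK// subr_eq0.
- rewrite /prop_for /continuous_at fx0 mul0r.
  apply/cvgrPdist_le => /= e e0.
  have C1 : 0 < `|C| + 1 by rewrite ltr_wpDl.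
  near=> z.
  have [->|zx] := eqVneq z x; first by rewrite fx0 mul0r subrr normr0 ltW.
  rewrite sub0r normrN normrM normfV ler_pdivrMr ?normr_gt0 ?subr_eq0//.
  apply: (le_trans (fC z)); rewrite -[X in X <= _]ger0_norm; last first.
    exact: le_trans (normr_ge0 _) (fC z).
  rewrite normrM normrX expr2 mulrA ler_wpM2r//.
  apply: (@le_trans _ _ ((`|C| + 1) * `|z - x|)).
    by rewrite ler_wpM2r// lerDl.
  rewrite mulrC -ler_pdivlMr// distrC; near: z.
  by apply: cvgr_dist_le; [exact: cvg_id|exact: divr_gt0].
- by rewrite fx0 mul0r.
Unshelve. all: by end_near. Qed.

(** The quadratic bound at the origin makes the extension by zero to negative
arguments differentiable there. *)
Lemma is_derive_right_extension k k' C : k 0 = 0 -> k' 0 = 0 ->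
  (forall r : R, 0 < r -> is_derive r 1 k (k' r)) ->
  (forall r : R, 0 <= r -> `|k r| <= C * r ^+ 2) ->
  forall s : R, is_derive s 1 (fun t => k (Num.max 0 t)) (k' (Num.max 0 s)).
Proof.
move=> k0 k'0 dk kC s; have [s0|s0|->] := ltgtP s 0.
- apply: (@near_eq_is_derive _ _ _ (cst 0)) => //.
    near=> t; rewrite /cst/= max_l ?k0//.
    by apply/ltW; near: t; exact: lt_nbhsl.
  by rewrite k'0; exact: is_derive_cst.
- apply: (@near_eq_is_derive _ _ _ k); last exact: dk.
  near=> t; rewrite max_r//.
  by apply/ltW; near: t; exact: (cvgr_gt _ cvg_id).
- rewrite k'0; apply: (@is_derive0_quadratic _ _ C); first by rewrite maxxx k0.
  move=> y; rewrite subr0; have [y0|y0] := leP 0 y; first exact: kC.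
  rewrite k0 normr0 mulr_ge0 ?sqr_ge0//.
  by have := kC 1 ler01; rewrite expr1n mulr1; apply: le_trans.
Unshelve. all: by end_near. Qed.

(** Up to the coefficients, this quotient is [ramp] or [ramp1] on the positive half-line. *)
Lemma is_derive_rat3 (r a b c : R) (m : nat) : 0 < r + 1 ->
  is_derive r 1 (fun t => (a * t ^+ 3 + b * t ^+ 2 + c * t) / (1 + t) ^+ m.+1)
   (((a * 3%:R * r ^+ 2 + b * 2%:R * r + c) * (1 + r)
     - m.+1%:R * (a * r ^+ 3 + b * r ^+ 2 + c * r)) / (1 + r) ^+ m.+2).
Proof.
move=> r1; have rn0 : 1 + r != 0 by rewrite addrC gt_eqF.
have dX n : is_derive r 1 (fun t : R => t ^+ n) (n%:R * r ^+ n.-1 * 1).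
  exact: is_derive_funX (is_derive_id r (1:R)).
have d1 : is_derive r 1 (fun t : R => 1 + t) (0 + 1).
  exact: is_derive_funD (is_derive_fun_cst r 1 1) (is_derive_id r (1:R)).
have dV := @is_derive_funV _ _ (fun t : R => (1 + t) ^+ m.+1) r 1 _
  (expf_neq0 m.+1 rn0) (is_derive_funX m.+1 d1).
have dN := is_derive_funD (is_derive_funD (is_derive_funZ a (dX 3%N))
  (is_derive_funZ b (dX 2%N))) (is_derive_funZ c (dX 1%N)).
apply: is_derive_eq (is_derive_funM dN dV) _ => /=.
rewrite !exprS.
have En := expf_neq0 m rn0.
by field; rewrite En rn0.
Qed.

(** A twice continuously differentiable substitute for the positive part, convex and
positive exactly on the positive half-line. It grows linearly and [s * ramp2 s] is
bounded, so that neither [ramp] nor the transport term requires integrability beyond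
the square. *)
Definition ramp s := let r := Num.max 0 s in r ^+ 3 / (1 + r) ^+ 2.
Definition ramp1 s := let r := Num.max 0 s in r ^+ 2 * (r + 3) / (1 + r) ^+ 3.
Definition ramp2 s := let r := Num.max 0 s in 6 * r / (1 + r) ^+ 4.

Let max0_ge0 s : 0 <= Num.max 0 s.
Proof. by rewrite le_max lexx. Qed.

Lemma is_derive_ramp (s : R) : is_derive s 1 ramp (ramp1 s).
Proof.
pose k (r : R) := r ^+ 3 / (1 + r) ^+ 2.
pose k' (r : R) := r ^+ 2 * (r + 3) / (1 + r) ^+ 3.
apply: (@is_derive_right_extension k k' 1); rewrite /k /k' ?expr0n ?mul0r//.
- move=> r r0.
  have -> : (fun t : R => t ^+ 3 / (1 + t) ^+ 2) =
    (fun t => (1 * t ^+ 3 + 0 * t ^+ 2 + 0 * t) / (1 + t) ^+ 2).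
    by apply/funext => t; rewrite mul1r !mul0r !addr0.
  apply: is_derive_eq (is_derive_rat3 _ _ _ _ _) _; first lra.
  by congr (_ / _); ring.
- move=> r r0; rewrite ger0_norm ?divr_ge0 ?exprn_ge0 ?addr_ge0//.
  rewrite mul1r ler_pdivrMr ?exprn_gt0//; last lra.
  rewrite exprSr ler_wpM2l ?sqr_ge0//; nra.
Qed.

Lemma is_derive_ramp1 (s : R) : is_derive s 1 ramp1 (ramp2 s).
Proof.
pose k (r : R) := r ^+ 2 * (r + 3) / (1 + r) ^+ 3.
pose k' (r : R) := 6 * r / (1 + r) ^+ 4.
apply: (@is_derive_right_extension k k' 3);
  rewrite /k /k' ?expr0n ?mulr0 ?mul0r//.
- move=> r r0.
  have -> : (fun t : R => t ^+ 2 * (t + 3) / (1 + t) ^+ 3) =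
    (fun t => (1 * t ^+ 3 + 3 * t ^+ 2 + 0 * t) / (1 + t) ^+ 3).
    by apply/funext => t; congr (_ / _); ring.
  apply: is_derive_eq (is_derive_rat3 _ _ _ _ _) _; first lra.
  by congr (_ / _); ring.
- move=> r r0; rewrite ger0_norm ?divr_ge0 ?mulr_ge0 ?exprn_ge0 ?addr_ge0//.
  rewrite ler_pdivrMr ?exprn_gt0//; last lra.
  rewrite [leRHS]mulrAC mulrC ler_wpM2r ?sqr_ge0//; nra.
Qed.

Lemma is_derive_continuous (f : R -> R) (a s : R) :
  is_derive s 1 f a -> {for s, continuous f}.
Proof.
by move=> [df _]; apply/differentiable_continuous/derivable1_diffP.
Qed.

Lemma continuous_ramp2 : continuous ramp2.
Proof.
move=> s; rewrite /ramp2.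
have cm : Num.max 0 t @[t --> s] --> Num.max 0 s.
  apply: (@continuous_max _ _ (cst 0) id s); first exact: cvg_cst.
  exact: cvg_id.
apply: cvgM; first by apply: cvgM cm; exact: cvg_cst.
apply: cvgV; last first.
  apply: (@cvg_comp _ _ _ _ (fun t => t ^+ 4) _ (nbhs (1 + Num.max 0 s))).
    by apply: cvgD cm; exact: cvg_cst.
  exact: exprn_continuous.
by rewrite expf_neq0// gt_eqF// ltr_wpDr.
Qed.

Lemma ramp_le0 s : s <= 0 -> ramp s = 0.
Proof. by move=> s0; rewrite /ramp max_l// expr0n mul0r. Qed.

Lemma ramp1_le0 s : s <= 0 -> ramp1 s = 0.
Proof. by move=> s0; rewrite /ramp1 max_l// expr0n !mul0r. Qed.

Lemma ramp_ge0 s : 0 <= ramp s.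
Proof. by rewrite divr_ge0 ?exprn_ge0 ?addr_ge0. Qed.

Lemma ramp_eq0 s : ramp s = 0 -> s <= 0.
Proof.
rewrite leNgt => r0; apply/negP => s0; move: r0; apply/eqP.
by rewrite /ramp max_r 1?ltW// gt_eqF// divr_gt0 ?exprn_gt0// addr_gt0.
Qed.

Lemma ramp_le s : ramp s <= `|s|.
Proof.
rewrite /ramp; have := max0_ge0 s; set r := Num.max 0 s => r0.
have rs : r <= `|s| by rewrite ge_max normr_ge0 ler_norm.
apply: le_trans rs; rewrite ler_pdivrMr ?exprn_gt0//; last lra.
nra.
Qed.

Lemma ramp2_ge0 s : 0 <= ramp2 s.
Proof. by rewrite divr_ge0 ?mulr_ge0 ?exprn_ge0 ?addr_ge0. Qed.

Lemma ramp2_le s : `|ramp2 s| <= 6.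
Proof.
rewrite ger0_norm ?ramp2_ge0// /ramp2; have := max0_ge0 s.
set r := Num.max 0 s => r0; rewrite ler_pdivrMr ?exprn_gt0//; last lra.
rewrite ler_wpM2l//; have : 1 + r <= (1 + r) ^+ 4; last lra.
by rewrite -[X in X <= _]expr1 ler_weXn2l//; lra.
Qed.

Lemma mul_ramp2_le s : `|s * ramp2 s| <= 6.
Proof.
have -> : s * ramp2 s = Num.max 0 s * ramp2 s.
  have [//|s0] := leP 0 s.
  by rewrite /ramp2 (max_l (ltW s0)) mulr0 !mul0r mulr0.
rewrite ger0_norm; last by rewrite mulr_ge0 ?ramp2_ge0.
rewrite /ramp2; have := max0_ge0 s.
set r := Num.max 0 s => r0; rewrite mulrA ler_pdivrMr ?exprn_gt0//; last lra.
rewrite mulrCA ler_wpM2l//; have : (1 + r) ^+ 2 <= (1 + r) ^+ 4; last nra.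
by rewrite ler_weXn2l//; lra.
Qed.

Lemma MVT_line (f f' : R -> R) (a b : R) : (forall s : R, is_derive s 1 f (f' s)) ->
  exists2 c, (a <= c <= b) || (b <= c <= a) & f b - f a = f' c * (b - a).
Proof.
move=> df; have cf : continuous f by move=> s; exact: is_derive_continuous.
have H x y : x <= y -> exists2 c, (x <= c <= y) & f y - f x = f' c * (y - x).
  move=> xy; have [//|c] := MVT_segment xy (fun x _ => df x).
    exact: continuous_subspaceT.
  by rewrite in_itv/= => cxy e; exists c.
have [/H[c cab e]|/ltW/H[c cab e]] := leP a b; exists c; rewrite ?cab ?orbT//.
by rewrite -[LHS]opprB e -mulrN opprB.
Qed.

Lemma ramp1_nondecreasing : {homo ramp1 : x y / x <= y}.
Proof.
move=> x y xy; have [c _ e] := MVT_line x y is_derive_ramp1.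
by rewrite -subr_ge0 e mulr_ge0 ?ramp2_ge0// subr_ge0.
Qed.

Lemma ramp1_lipschitz x y : `|ramp1 x - ramp1 y| <= 6 * `|x - y|.
Proof.
have [c _ ->] := MVT_line y x is_derive_ramp1.
by rewrite normrM ler_wpM2r// ramp2_le.
Qed.

(** The graph of [ramp] lies above its tangents; this turns the increments of
[Theta] into increments of the energy. *)
Lemma ramp_convex x y : ramp x - ramp y <= ramp1 x * (x - y).
Proof.
have [c + ->] := MVT_line y x is_derive_ramp.
case/orP => /andP[c1 c2].
  by rewrite ler_wpM2r ?subr_ge0 ?ramp1_nondecreasing// (le_trans c1).
by rewrite ler_wnM2r ?subr_le0 ?ramp1_nondecreasing// (le_trans c1).
Qed.

(** The primitive of [s |-> (s + K) * ramp2 s] that vanishes on the negative half-line,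
found by an integration by parts. *)
Definition ramp_flux K s := (s + K) * ramp1 s - ramp s.

Lemma is_derive_ramp_flux (K s : R) :
  is_derive s 1 (ramp_flux K) ((s + K) * ramp2 s).
Proof.
have d1 : is_derive s 1 (fun t : R => t + K) (1 + 0).
  exact: is_derive_funD (is_derive_id s (1:R)) (is_derive_fun_cst _ _ _).
apply: is_derive_eq
  (is_derive_funB (is_derive_funM d1 (is_derive_ramp1 s)) (is_derive_ramp s)) _.
by rewrite addr0 mulr1 addrK.
Qed.

Lemma ramp_flux_le0 K s : s <= 0 -> ramp_flux K s = 0.
Proof. by move=> s0; rewrite /ramp_flux ramp_le0// ramp1_le0// mulr0 subrr. Qed.

Lemma ramp_flux_bound K s : `|(s + K) * ramp2 s| <= 6 + `|K| * 6.
Proof.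
rewrite mulrDl (le_trans (ler_normD _ _))// lerD ?mul_ramp2_le//.
by rewrite normrM ler_wpM2l ?ramp2_le.
Qed.

End real_functions.

(** * Flat functions at the origin *)

Section flat_functions.
Context {R : realType}.
Implicit Types (p q : {poly R}) (c s t y : R).

(** With [p] an arbitrary polynomial, this family is stable under differentiation; it is
therefore made of smooth functions, without a formula for their higher derivatives. *)
Definition flat c p s := if 0 < s then p.[s^-1] * expR (- c * s^-1) else 0.

Let pow_expRN_bound c n : 0 < c ->
  exists C : R, 0 <= C /\ forall y, 0 <= y -> y ^+ n * expR (- c * y) <= C.
Proof.
move=> c0; case: n => [|n].
  exists 1; split=> // y y0; rewrite expr0 mul1r expR_le1 mulNr oppr_le0.
  by rewrite mulr_ge0// ltW.
exists (n.+1`!%:R / c ^+ n.+1); split.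
  by rewrite divr_ge0// exprn_ge0// ltW.
move=> y y0; have cy0 : 0 <= c * y by rewrite mulr_ge0// ltW.
have f0 : 0 < n.+1`!%:R :> R by rewrite ltr0n fact_gt0.
have := expR_ge1Dxn n cy0; rewrite mulNr expRN => h.
rewrite ler_pdivlMr ?exprn_gt0// mulrAC ler_pdivrMr ?expR_gt0//.
rewrite -exprMn -ler_pdivrMl// [y * c]mulrC [X in X <= _]mulrC.
by apply: le_trans h; rewrite lerDr.
Qed.

(** In the variable [y = 1 / s], exponential decay beats the polynomial. The induction on
[p] carries a power of [y], since Horner's scheme multiplies by the variable. *)
Lemma flat_bound c p : 0 < c ->
  exists C : R, 0 <= C /\ forall s, `|flat c p s| <= C.
Proof.
move=> c0; suff [C [C0 HC]] : exists C : R, 0 <= C /\ forall y, 0 <= y ->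
    `|y ^+ 0 * p.[y] * expR (- c * y)| <= C.
  exists C; split=> // s; rewrite /flat; case: ifPn => s0; last by rewrite normr0.
  by have := HC s^-1; rewrite mul1r; apply; rewrite invr_ge0 ltW.
move: {1}0%N; elim/poly_ind: p => [|p a IH] n.
  by exists 0; split=> // y _; rewrite horner0 mulr0 mul0r normr0.
have [C1 [C10 H1]] := IH n.+1; have [C2 [C20 H2]] := pow_expRN_bound n c0.
exists (C1 + `|a| * C2); split; first by rewrite addr_ge0 ?mulr_ge0.
move=> y y0; rewrite hornerMXaddC mulrDr mulrDl.
apply: (le_trans (ler_normD _ _)); apply: lerD.
  by apply: le_trans (H1 _ y0); rewrite [p.[y] * y]mulrC exprSr !mulrA.
rewrite mulrAC mulrC normrM ler_wpM2l// ger0_norm ?H2//.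
by rewrite mulr_ge0 ?exprn_ge0 ?expR_ge0.
Qed.

Definition flat_poly c p : {poly R} := (c *: p - p^`()) * 'X^2.

(** At the origin, [flat c p s / s ^+ 2] is [flat c (p * 'X^2) s], which is bounded. *)
Lemma is_derive_flat c p s : 0 < c ->
  is_derive s 1 (flat c p) (flat c (flat_poly c p) s).
Proof.
move=> c0; have [s0|s0|->] := ltgtP s 0.
- rewrite /flat [0 < s]ltNge (ltW s0) /=.
  apply: (@near_eq_is_derive _ _ _ (cst 0)) => //.
    near=> t; rewrite /cst/= ifN// -leNgt.
    by apply/ltW; near: t; exact: lt_nbhsl.
- apply: (@near_eq_is_derive _ _ _ (fun t => p.[t^-1] * expR (- c * t^-1))).
    near=> t; rewrite /flat ifT//.
    by near: t; exact: (cvgr_gt _ cvg_id).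
  rewrite /flat s0 /flat_poly.
  have dV := @is_derive_funV _ _ _ s 1 _ (lt0r_neq0 s0) (is_derive_id s (1:R)).
  have dp := is_derive_comp1 (is_derive_poly p s^-1) dV.
  have de := @is_derive_comp1 _ _ _ (fun t : R => - c * t^-1) s 1 _ _
    (is_derive_expR (- c * s^-1)) (is_derive_funZ (- c) dV).
  apply: is_derive_eq (is_derive_funM dp de) _ => /=.
  rewrite hornerM hornerXn hornerD hornerN hornerZ.
  by field; rewrite gt_eqF.
- have [C [C0 HC]] := flat_bound (p * 'X^2) c0.
  rewrite {2}/flat ltxx; apply: (@is_derive0_quadratic _ _ _ C).
    by rewrite /flat ltxx.
  move=> y; rewrite subr0; have [y0|y0] := leP y 0.
    by rewrite /flat ltNge y0 /= normr0 mulr_ge0// sqr_ge0.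
  have := HC y; rewrite /flat y0 hornerM hornerXn => h.
  rewrite -ler_pdivrMr ?exprn_gt0//; apply: le_trans h.
  rewrite -[X in _ / X]ger0_norm ?sqr_ge0// -normfV -normrM.
  by rewrite mulrAC -exprVn.
Unshelve. all: by end_near. Qed.

Lemma flat1_gt0 c s : 0 < s -> flat c 1 s = expR (- c * s^-1).
Proof. by move=> s0; rewrite /flat s0 hornerC mul1r. Qed.

Lemma flat1_le0 c s : s <= 0 -> flat c 1 s = 0.
Proof. by move=> s0; rewrite /flat ltNge s0. Qed.

Lemma flat1_itv c s : 0 < c -> 0 <= flat c 1 s <= 1.
Proof.
move=> c0; have [s0|s0] := leP s 0; first by rewrite flat1_le0// lexx ler01.
rewrite flat1_gt0// expR_ge0 expR_le1 mulNr oppr_le0.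
by rewrite mulr_ge0 ?invr_ge0 ?ltW.
Qed.

Lemma cvg_flat1 s :
  flat n.+1%:R^-1 1 s @[n --> \oo] --> (if 0 < s then 1 else 0 : R).
Proof.
case: ifPn => s0; last first.
  under eq_fun do rewrite /flat (negPf s0); exact: cvg_cst.
under eq_fun do rewrite flat1_gt0//.
have h0 : - n.+1%:R^-1 * s^-1 @[n --> \oo] --> (0 : R).
  rewrite -(mul0r s^-1) -[X in X * s^-1]oppr0; apply: cvgMr_tmp.
  by apply: cvgN; exact: cvg_harmonic.
have := @continuous_cvg _ _ _ _ _ _ (@expR R) _ (@continuous_expR R 0) h0.
by rewrite expR0; apply.
Qed.

End flat_functions.

(** * Boxes and Borel sets of row vectors *)

Section boxes.
Context {R : realType} {n : nat}.
Implicit Types (a b x : 'rV[R]_n) (U : set 'rV[R]_n).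

Definition obox a b := [set x : 'rV[R]_n | forall i, a ord0 i < x ord0 i < b ord0 i].
Definition cbox a b := [set x : 'rV[R]_n | forall i, a ord0 i <= x ord0 i <= b ord0 i].

Lemma measurable_obox a b : measurable (obox a b).
Proof.
rewrite (_ : obox a b = \big[setI/setT]_(i < n)
    ((fun x : 'rV[R]_n => x ord0 i) @^-1` `]a ord0 i, b ord0 i[)).
  apply: bigsetI_measurable => i _; rewrite -[X in measurable X]setTI.
  exact: measurable_coord.
apply/seteqP; split=> x; rewrite -bigcap_seq/=.
  by move=> h i _; rewrite /= in_itv/=; exact: h.
by move=> h i; have /= := h i (mem_index_enum _); rewrite in_itv.
Qed.

Lemma compact_cbox a b : compact (cbox a b).
Proof.
rewrite (_ : cbox a b = [set x : 'rV[R]_n | forall i,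
    `[a ord0 i, b ord0 i]%classic (x ord0 i)]).
  apply: (@rV_compact R n (fun i => `[a ord0 i, b ord0 i]%classic)) => i.
  exact: segment_compact.
by apply/seteqP; split => x /= h i; have := h i; rewrite in_itv.
Qed.

Lemma obox_sub_cbox a b : obox a b `<=` cbox a b.
Proof. by move=> x h i; have /andP[/ltW -> /ltW ->] := h i. Qed.

Definition cube_lo (i : 'rV[rat]_n * nat) : 'rV[R]_n :=
  \row_j (ratr (i.1 ord0 j) - i.2.+1%:R^-1).
Definition cube_hi (i : 'rV[rat]_n * nat) : 'rV[R]_n :=
  \row_j (ratr (i.1 ord0 j) + i.2.+1%:R^-1).
Definition cube i := obox (cube_lo i) (cube_hi i).

(** Cubes with rational centers and radii [1 / k] are countably many. The closed cube is
asked to lie in [U] in order that the open one carry test functions of [U]. *)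
Lemma open_cube U x : open U -> U x ->
  exists i, cube i x /\ cbox (cube_lo i) (cube_hi i) `<=` U.
Proof.
rewrite openE => /[apply]; rewrite /interior => /nbhs_ballP[e/= e0 eU].
have [k ke] : exists k : nat, k.+1%:R^-1 < e / 2.
  have e2 : 0 < e / 2 by rewrite divr_gt0.
  by have [k] := ltr_add_invr e2; rewrite add0r; exists k.
set d : R := k.+1%:R^-1 in ke; have d0 : 0 < d by rewrite invr_gt0.
have q_ j : {q : rat | `|x ord0 j - ratr q| < d}.
  apply: cid; have [|q] := @rat_in_itvoo R (x ord0 j - d) (x ord0 j + d).
    by rewrite ltrD2l gtrN.
  rewrite in_itv/= => /andP[q1 q2]; exists q.
  by rewrite ltr_norml; apply/andP; split; lra.
exists (\row_j sval (q_ j), k); split.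
  move=> j; rewrite !mxE /= -/d; have := svalP (q_ j).
  by rewrite ltr_norml => /andP[? ?]; apply/andP; split; lra.
move=> y yc; apply: eU; split=> // i j; rewrite (ord1 i).
have := yc j; rewrite !mxE /= -/d => /andP[y1 y2].
have := svalP (q_ j); rewrite ltr_norml => /andP[? ?].
rewrite /ball/= ltr_norml; apply/andP; split; lra.
Qed.

Lemma open_eq_bigcup_cube U : open U ->
  U = \bigcup_i (if `[< cbox (cube_lo i) (cube_hi i) `<=` U >]
                 then cube i else set0).
Proof.
move=> oU; apply/seteqP; split=> x.
  move=> /(open_cube oU)[i [xi iU]]; exists i => //.
  by rewrite ifT//; exact/asboolP.
move=> [i _]; case: ifPn => // /asboolP iU xi.
by apply/iU/obox_sub_cbox.
Qed.

Lemma countable_cube_index : countable [set: 'rV[rat]_n * nat].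
Proof. exact: countableP. Qed.

Lemma open_measurable_rV U : open U -> measurable U.
Proof.
move=> /open_eq_bigcup_cube ->.
apply: countable_bigcupT_measurable; first exact: countable_cube_index.
by move=> i; case: ifPn => // _; exact: measurable_obox.
Qed.

Lemma closed_measurable_rV U : closed U -> measurable U.
Proof.
move=> cU; rewrite -[U]setCK; apply: measurableC; apply: open_measurable_rV.
exact: closed_openC.
Qed.

Lemma compact_measurable_rV U : compact U -> measurable U.
Proof.
by move=> cU; apply: closed_measurable_rV; exact: compact_closed.
Qed.

Definition oboxes := [set A : set 'rV[R]_n | exists a b, A = obox a b].

Lemma obox_setI a b a' b' : obox a b `&` obox a' b' =
  obox (\row_j Num.max (a ord0 j) (a' ord0 j)) (\row_j Num.min (b ord0 j) (b' ord0 j)).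
Proof.
apply/seteqP; split=> x /=.
  move=> [h h'] j; rewrite !mxE gt_max lt_min.
  have /andP[h1 h2] := h j; have /andP[h3 h4] := h' j.
  by rewrite h1 h2 h3 h4.
by move=> h; split=> j; have := h j; rewrite !mxE gt_max lt_min
  => /andP[/andP[h1 h2] /andP[h3 h4]]; rewrite ?h1 ?h2 ?h3 ?h4.
Qed.

Lemma oboxes_setI : setI_closed oboxes.
Proof. by move=> _ _ [a [b ->]] [a' [b' ->]]; rewrite obox_setI; do 2 eexists. Qed.

(** Boxes form a pi-system, so an identity between integrals need only be checked on them. *)
Lemma measurable_rV_oboxes : @measurable _ 'rV[R]_n = <<s oboxes >>.
Proof.
apply/seteqP; split; last first.
  apply: smallest_sub; first exact: sigma_algebra_measurable.
  by move=> _ [a [b ->]]; exact: measurable_obox.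
have so : sigma_algebra [set: 'rV[R]_n] <<s oboxes>>.
  exact: smallest_sigma_algebra.
have openS U : open U -> <<s oboxes >> U.
  move=> /open_eq_bigcup_cube ->.
  apply: (@countable_bigcupT_measurable _ (g_sigma_algebraType oboxes)).
    exact: countable_cube_index.
  move=> i; case: ifPn => _; first by apply: sub_sigma_algebra; do 2 eexists.
  by case: so.
apply: smallest_sub => // A; rewrite -bigcup_seq/= => -[i _ [Y mY <-]].
rewrite setTI.
suff : @measurable_fun _ _ (g_sigma_algebraType oboxes) (measurableTypeR R)
  setT (fun x : 'rV[R]_n => x ord0 i).
  by move=> /(_ measurableT _ mY); rewrite setTI.
apply: (@measurability _ _ (g_sigma_algebraType oboxes) (measurableTypeR R)
  setT _ _ (measurable_realfun.RGenOpens.measurableE R)).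
move=> _ [_ [a [b ->] <-]]; rewrite setTI.
apply: openS; apply: open_comp; last exact: interval_open.
by move=> x _; exact: coord_continuous.
Qed.

End boxes.

(** * Square integrable functions *)

Section square_integrable.
Context d (T : measurableType d) (R : realType).
Variables (mu : {measure set T -> \bar R}) (D : set T) (mD : measurable D).
Implicit Types (f g h a : T -> R) (c C : R).

Definition sqint f := measurable_fun D f /\
  (\int[mu]_(x in D) (f x ^+ 2)%:E < +oo)%E.

Lemma sqint_integrable2 f : sqint f -> mu.-integrable D (EFin \o (fun x => f x ^+ 2)).
Proof.
move=> [mf foo]; apply/integrableP; split.
  by apply/measurable_EFinP; exact: measurable_funX.
move: foo; congr (_ < _)%E; apply: eq_integral => x _ /=.
by rewrite ger0_norm ?sqr_ge0.
Qed.

Lemma integrable2_sqint f : measurable_fun D f ->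
  mu.-integrable D (EFin \o (fun x => f x ^+ 2)) -> sqint f.
Proof.
move=> mf /integrableP[_ foo]; split=> //.
move: foo; congr (_ < _)%E; apply: eq_integral => x _ /=.
by rewrite ger0_norm ?sqr_ge0.
Qed.

Lemma sqintD f g : sqint f -> sqint g -> sqint (fun x => f x + g x).
Proof.
move=> hf hg; have [mf _] := hf; have [mg _] := hg.
apply: integrable2_sqint; first exact: measurable_funD.
have := integrableD mD (integrableZl mD 2 (sqint_integrable2 hf))
  (integrableZl mD 2 (sqint_integrable2 hg)).
apply: le_integrable => //.
  by apply/measurable_EFinP; apply: measurable_funX; exact: measurable_funD.
move=> x _ /=; rewrite lee_fin !ger0_norm ?sqr_ge0//.
  by have := sqr_ge0 (f x - g x); lra.
by rewrite addr_ge0// mulr_ge0// sqr_ge0.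
Qed.

Lemma sqintM_bounded a f C : measurable_fun D a -> (forall x, D x -> `|a x| <= C) ->
  sqint f -> sqint (fun x => a x * f x).
Proof.
move=> ma aC hf; have [mf _] := hf.
apply: integrable2_sqint; first exact: measurable_funM.
have := integrableZl mD (C ^+ 2) (sqint_integrable2 hf).
apply: le_integrable => //.
  by apply/measurable_EFinP; apply: measurable_funX; exact: measurable_funM.
move=> x Dx /=; rewrite lee_fin normrX [leRHS]ger0_norm; last first.
  by rewrite mulr_ge0// sqr_ge0.
rewrite normrM exprMn [`|f x| ^+ 2]real_normK ?num_real//.
rewrite ler_wpM2r ?sqr_ge0// ler_sqr ?nnegrE ?aC//.
by apply: le_trans (aC _ Dx).
Qed.

Lemma sqintZ c f : sqint f -> sqint (fun x => c * f x).
Proof. by apply: (@sqintM_bounded (cst c) f `|c|); [exact: measurable_cst|]. Qed.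

Lemma sqintB f g : sqint f -> sqint g -> sqint (fun x => f x - g x).
Proof.
move=> hf hg; have := sqintD hf (sqintZ (-1) hg).
by under [X in sqint X -> _]eq_fun do rewrite mulN1r.
Qed.

Lemma sqint_bounded f C : (mu D < +oo)%E -> measurable_fun D f ->
  (forall x, D x -> `|f x| <= C) -> sqint f.
Proof.
move=> Doo mf fC; apply: integrable2_sqint => //.
apply: measurable_bounded_integrable => //; first exact: measurable_funX.
exists (C ^+ 2); split; first exact: num_real.
move=> M CM x Dx; rewrite /= normrX; apply: le_trans (ltW CM).
by rewrite ler_sqr ?nnegrE ?fC//; apply: le_trans (fC _ Dx).
Qed.

Lemma integrableM_sqint f g : sqint f -> sqint g ->
  mu.-integrable D (EFin \o (fun x => f x * g x)).
Proof.
move=> hf hg; have [mf _] := hf; have [mg _] := hg.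
have := integrableD mD (sqint_integrable2 hf) (sqint_integrable2 hg).
apply: le_integrable => //.
  by apply/measurable_EFinP; exact: measurable_funM.
move=> x _ /=; rewrite lee_fin [leRHS]ger0_norm ?addr_ge0 ?sqr_ge0//.
rewrite ler_norml; apply/andP; split.
  by have := sqr_ge0 (f x + g x); have := sqr_ge0 (f x); have := sqr_ge0 (g x); lra.
by have := sqr_ge0 (f x - g x); have := sqr_ge0 (f x); have := sqr_ge0 (g x); lra.
Qed.

Lemma sqint_integrable f : (mu D < +oo)%E -> sqint f -> mu.-integrable D (EFin \o f).
Proof.
move=> Doo hf; have h1 : sqint (cst 1).
  by apply: (@sqint_bounded _ 1) => // x _; rewrite normr1.
by have := integrableM_sqint hf h1; under eq_fun do rewrite mulr1.
Qed.

(** The integral of [(f + s / 2 * g) ^+ 2] is a quadratic polynomial in [s] without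
sign change. *)
Lemma cauchy_schwarz f g : sqint f -> sqint g ->
  (\int[mu]_(x in D) (f x * g x)) ^+ 2 <=
  \int[mu]_(x in D) (f x ^+ 2) * \int[mu]_(x in D) (g x ^+ 2).
Proof.
move=> hf hg; have fg := integrableM_sqint hf hg.
have f2 := sqint_integrable2 hf; have g2 := sqint_integrable2 hg.
set A := \int[mu]_(x in D) (f x ^+ 2); set B := \int[mu]_(x in D) (g x ^+ 2).
set C := \int[mu]_(x in D) (f x * g x).
have A0 : 0 <= A by apply: Rintegral_ge0 => x _; exact: sqr_ge0.
have B0 : 0 <= B by apply: Rintegral_ge0 => x _; exact: sqr_ge0.
have H s : 0 <= A + s * C + s ^+ 2 / 4 * B.
  have : 0 <= \int[mu]_(x in D) (f x ^+ 2 + s * (f x * g x) + s ^+ 2 / 4 * g x ^+ 2).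
    apply: Rintegral_ge0 => x _.
    by have := sqr_ge0 (f x + s / 2 * g x); lra.
  have sfg : mu.-integrable D (EFin \o (fun x => s * (f x * g x))).
    exact: (integrableZl mD s fg).
  have sg2 : mu.-integrable D (EFin \o (fun x => s ^+ 2 / 4 * g x ^+ 2)).
    exact: (integrableZl mD (s ^+ 2 / 4) g2).
  have fs : mu.-integrable D (EFin \o (fun x => f x ^+ 2 + s * (f x * g x))).
    exact: (integrableD mD f2 sfg).
  by rewrite RintegralD// RintegralD// !RintegralZl.
move: B0; rewrite le_eqVlt => /predU1P[B0|B0].
  rewrite -B0 mulr0; have [->|C0] := eqVneq C 0; first by rewrite expr0n.
  (* When [B = 0] the polynomial is affine in [s], so [C] vanishes too. *)
  have := H (- (A + 1) / C); rewrite -B0 mulr0 addr0 mulfVK//; lra.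
have := H (- 2 * C / B).
have -> : A + - 2 * C / B * C + (- 2 * C / B) ^+ 2 / 4 * B = A - C ^+ 2 / B.
  by field; rewrite gt_eqF.
by rewrite subr_ge0 ler_pdivrMr.
Qed.

Definition cvg2 (u : nat -> T -> R) f :=
  \int[mu]_(x in D) ((u n x - f x) ^+ 2) @[n --> \oo] --> (0 : R).

Lemma cvg2_pairing (u : nat -> T -> R) f g :
  (forall n, sqint (u n)) -> sqint f -> sqint g -> cvg2 u f ->
  \int[mu]_(x in D) (u n x * g x) @[n --> \oo] --> \int[mu]_(x in D) (f x * g x).
Proof.
move=> hu hf hg uf; apply/cvgrPdist_le => e e0.
set B := \int[mu]_(x in D) (g x ^+ 2).
have B0 : 0 <= B by apply: Rintegral_ge0 => x _; exact: sqr_ge0.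
have B1 : 0 < B + 1 by rewrite ltr_wpDl.
move/cvgrPdist_le : uf => /(_ (e ^+ 2 / (B + 1))).
rewrite divr_gt0 ?exprn_gt0// => /(_ isT); apply: filterS => n.
rewrite sub0r normrN ger0_norm; last by apply: Rintegral_ge0 => x _; exact: sqr_ge0.
rewrite ler_pdivlMr// => h.
rewrite distrC -RintegralB//; [|exact: integrableM_sqint..].
under eq_Rintegral do rewrite -mulrBl.
have := cauchy_schwarz (sqintB (hu n) hf) hg; rewrite -/B.
set X := \int[mu]_(x in D) _; set Y := \int[mu]_(x in D) _ in h *.
move=> CS; rewrite -ler_sqr ?nnegrE ?(ltW e0)// real_normK ?num_real//.
apply: le_trans CS (le_trans _ h).
have : 0 <= Y by apply: Rintegral_ge0 => x _; exact: sqr_ge0.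
by move=> Y0; rewrite mulrDr mulr1 lerDl.
Qed.

End square_integrable.

(** * Convergence in mean square *)

Lemma cvg_sqr0 (R : realType) (u : nat -> R) :
  u n @[n --> \oo] --> (0 : R) -> u n ^+ 2 @[n --> \oo] --> (0 : R).
Proof.
move=> u0; rewrite -(mul0r 0); under eq_fun do rewrite expr2.
exact: cvgM.
Qed.

Lemma sqrD_le2 (R : realFieldType) (x y : R) :
  (x + y) ^+ 2 <= 2 * x ^+ 2 + 2 * y ^+ 2.
Proof. by have := sqr_ge0 (x - y); lra. Qed.

Section square_mean_convergence.
Context d (T : measurableType d) (R : realType).
Variables (mu : {measure set T -> \bar R}) (D : set T) (mD : measurable D).
Implicit Types (f g h a : T -> R) (c C : R).

Lemma poweR2_Lnorm f :
  (Lnorm mu 2%:E (EFin \o (f \_ D)) `^ 2 = \int[mu]_(x in D) (f x ^+ 2)%:E)%E.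
Proof.
rewrite poweR_Lnorm ?pnatr_eq0// [RHS]integral_mkcond; apply: eq_integral => x _.
rewrite /= !patchE; case: ifPn => _ /=.
  by rewrite powR_mulrn// real_normK// num_real.
by rewrite normr0 powR_mulrn// expr0n.
Qed.

Lemma Lp_on_sqint f : Lp_on mu 2%:E D f -> sqint mu D f.
Proof.
move=> [mf]; rewrite /finite_norm => foo; split=> //.
by rewrite -poweR2_Lnorm poweR_lty.
Qed.

Lemma Lnorm_cvg2 (u : nat -> T -> R) f :
  Lnorm mu 2%:E (EFin \o ((fun x => f x - u n x) \_ D)) @[n --> \oo] --> 0%E ->
  cvg2 mu D u f.
Proof.
move=> /fine_cvgP[ufin u0]; rewrite /cvg2.
have : (fine (Lnorm mu 2%:E (EFin \o ((fun x => f x - u n x) \_ D)))) ^+ 2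
   @[n --> \oo] --> (0 : R).
  exact: cvg_sqr0 u0.
apply: cvg_trans; apply: near_eq_cvg; near=> n.
rewrite /Rintegral; under eq_integral do rewrite -sqrrN opprB.
rewrite -poweR2_Lnorm.
have : Lnorm mu 2%:E (EFin \o ((fun x => f x - u n x) \_ D)) \is a fin_num.
  by near: n.
case: (Lnorm _ _ _) (Lnorm_ge0 mu 2%:E (EFin \o ((fun x => f x - u n x) \_ D))) => //.
by move=> r; rewrite lee_fin => r0 _; rewrite poweR_EFin /= powR_mulrn.
Unshelve. all: by end_near. Qed.

Lemma cvg2_reindex (u : nat -> T -> R) f (k : nat -> nat) :
  (forall n, (n <= k n)%N) -> cvg2 mu D u f -> cvg2 mu D (u \o k) f.
Proof.
move=> nk; rewrite /cvg2 => uf.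
have koo : k n @[n --> \oo] --> \oo.
  move=> A [N _ NA]; exists N => // n /= Nn; apply: NA => /=.
  exact: leq_trans (nk n).
exact: (cvg_comp _ _ koo uf).
Unshelve. all: by end_near. Qed.

(** Along a fast enough subsequence the squared errors are summable in the mean, hence
summable almost everywhere. *)
Lemma cvg2_subseq_ae (u : nat -> T -> R) f :
  (forall n, sqint mu D (u n)) -> sqint mu D f -> cvg2 mu D u f ->
  exists k : nat -> nat, (forall n, (n <= k n)%N) /\
    {ae mu, forall x, D x -> u (k n) x @[n --> \oo] --> f x}.
Proof.
move=> hu hf uf.
have hk n : {k : nat | (n <= k)%N &
    \int[mu]_(x in D) ((u k x - f x) ^+ 2) <= 1 / (2 ^ n.+1)%:R}.
  apply: cid2; move/cvgrPdist_le : uf => /(_ (1 / (2 ^ n.+1)%:R)).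
  rewrite divr_gt0 ?ltr0n ?expn_gt0// => /(_ isT)[N _ HN].
  exists (maxn n N); first exact: leq_maxl.
  have := HN (maxn n N) (leq_maxr _ _); apply: le_trans.
  by rewrite sub0r normrN ler_norm.
pose k n := s2val (hk n); exists k; split; first by move=> n; exact: s2valP (hk n).
pose e n x := (u (k n) x - f x) ^+ 2.
have se n : sqint mu D (fun x => u (k n) x - f x) by exact: sqintB.
have ie n := sqint_integrable2 (se n).
have me n : measurable_fun D (EFin \o e n) by case/integrableP : (ie n).
have e0 n x : D x -> (0 <= (EFin \o e n) x)%E by move=> _; rewrite lee_fin sqr_ge0.
have soo : (\int[mu]_(x in D) (\sum_(n <oo) (e n x)%:E) < +oo)%E.
  rewrite integral_nneseries//.
  apply: (@le_lt_trans _ _ (\sum_(n <oo) (1 / (2 ^ n.+1)%:R : R)%:E)%E).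
    apply: lee_nneseries => [n _ _|n _].
      by apply: integral_ge0 => x Dx; exact: e0.
    rewrite -[leLHS]fineK; last by exact: (integrable_fin_num mD (ie n)).
    by rewrite lee_fin; exact: s2valP' (hk n).
  apply: (@le_lt_trans _ _ 1%:E); last exact: ltry.
  exact: (@epsilon_trick0 R 1 xpredT).
have isum : mu.-integrable D (fun x => \sum_(n <oo) (e n x)%:E)%E.
  apply/integrableP; split.
    apply: (@ge0_emeasurable_sum _ _ _ _ (fun n => EFin \o e n) xpredT).
      by move=> n x Dx _; exact: e0.
    by move=> n _; exact: me.
  rewrite (eq_integral (fun x => \sum_(n <oo) (e n x)%:E)%E)// => x xD.
  by rewrite gee0_abs// nneseries_ge0// => n _ _; apply: e0; rewrite inE in xD.
have := integrable_ae mD isum; apply: filterS => x /[apply].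
move=> sfin; suff e_cvg : e n x @[n --> \oo] --> (0 : R).
  apply/cvgrPdist_le => eps eps0.
  move/cvgrPdist_le : e_cvg => /(_ (eps ^+ 2)); rewrite exprn_gt0// => /(_ isT).
  apply: filterS => n; rewrite sub0r normrN ger0_norm ?sqr_ge0// => h.
  by rewrite distrC -ler_sqr ?nnegrE ?(ltW eps0)// real_normK ?num_real.
apply: cvg_series_cvg_0; apply: nondecreasing_is_cvgn.
  by apply: nondecreasing_series => n _ _; exact: sqr_ge0.
exists (fine (\sum_(n <oo) (e n x)%:E)%E) => _ [n _ <-].
rewrite -lee_fin fineK// /series/= -sumEFin.
by apply: nneseries_lim_ge => m _ _; rewrite lee_fin sqr_ge0.
Qed.

Lemma cvg2_lipschitz (u : nat -> T -> R) f (k : R -> R) C :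
  measurable_fun setT k -> 0 <= C -> (forall x y, `|k x - k y| <= C * `|x - y|) ->
  (forall n, sqint mu D (u n)) -> sqint mu D f ->
  cvg2 mu D u f -> cvg2 mu D (fun n x => k (u n x)) (fun x => k (f x)).
Proof.
move=> mk C0 kC hu hf uf; rewrite /cvg2.
apply: (@squeeze_cvgr _ _ _ _ (cst 0)
  (fun n => C ^+ 2 * \int[mu]_(x in D) ((u n x - f x) ^+ 2))).
- near=> n; apply/andP; split; first by apply: Rintegral_ge0 => x _; exact: sqr_ge0.
  have hd := sqintB mD (hu n) hf.
  rewrite -RintegralZl//; last exact: sqint_integrable2.
  have id : mu.-integrable D
      (EFin \o (fun x => C ^+ 2 * (u n x - f x) ^+ 2)).
    exact: integrableZl (sqint_integrable2 hd).
  have H x : (k (u n x) - k (f x)) ^+ 2 <= C ^+ 2 * (u n x - f x) ^+ 2.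
    rewrite -exprMn -real_normK ?num_real// -[leRHS]real_normK ?num_real//.
    by rewrite ler_sqr ?nnegrE// normrM (ger0_norm C0).
  apply: le_Rintegral => //.
  apply: le_integrable id => //.
    apply/measurable_EFinP; apply: measurable_funX; apply: measurable_funB.
      by apply: measurableT_comp => //; case: (hu n).
    by apply: measurableT_comp => //; case: hf.
  move=> x _ /=; rewrite lee_fin ger0_norm ?sqr_ge0// (le_trans (H x))//.
  exact: ler_norm.
- exact: cvg_cst.
- by rewrite -(mulr0 (C ^+ 2)); apply: cvgM; [exact: cvg_cst|exact: uf].
Unshelve. all: by end_near. Qed.

(** Write [a n * v n - a0 * v0 = a n * (v n - v0) + (a n - a0) * v0]: the first term is
small because [a n] is bounded, the second by dominated convergence. *)
Lemma cvg2_bounded_mul (a : nat -> T -> R) a0 (v : nat -> T -> R) v0 C :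
  (forall n, measurable_fun D (a n)) -> measurable_fun D a0 ->
  (forall n x, `|a n x| <= C) -> (forall x, `|a0 x| <= C) ->
  {ae mu, forall x, D x -> a n x @[n --> \oo] --> a0 x} ->
  (forall n, sqint mu D (v n)) -> sqint mu D v0 -> cvg2 mu D v v0 ->
  cvg2 mu D (fun n x => a n x * v n x) (fun x => a0 x * v0 x).
Proof.
move=> ma ma0 aC a0C aa hv hv0 vv; rewrite /cvg2.
have C0 x : 0 <= C := le_trans (normr_ge0 _) (a0C x).
pose p n x := (v n x - v0 x) ^+ 2; pose q n x := ((a n x - a0 x) * v0 x) ^+ 2.
have hp n := sqintB mD (hv n) hv0.
have ip n : mu.-integrable D (EFin \o (p n)) := sqint_integrable2 (hp n).
have sq n : sqint mu D (fun x => (a n x - a0 x) * v0 x).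
  apply: (@sqintM_bounded _ _ _ _ _ mD _ _ (C + C)) => //.
    exact: measurable_funB.
  by move=> x _; apply: le_trans (ler_normB _ _) _; exact: lerD.
have iq n : mu.-integrable D (EFin \o (q n)) := sqint_integrable2 (sq n).
have q0 : \int[mu]_(x in D) (q n x) @[n --> \oo] --> (0 : R).
  have ig : mu.-integrable D (EFin \o (fun x => (C + C) ^+ 2 * v0 x ^+ 2)).
    exact: integrableZl (sqint_integrable2 hv0).
  have [] := @dominated_convergence _ _ _ mu D mD (fun n => EFin \o q n)
    (cst 0%E) _ _ (measurable_cst _) _ ig _.
  - by move=> n; case/integrableP : (iq n).
  - apply: filterS aa => x /[apply] ax; apply: cvg_EFin; first by near=> n.
    apply: cvg_sqr0.
    rewrite -(mul0r (v0 x)) -(subrr (a0 x)); apply: cvgM; last exact: cvg_cst.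
    by apply: cvgB => //; exact: cvg_cst.
  - apply: nearW => x n Dx /=; rewrite lee_fin ger0_norm ?sqr_ge0// /q exprMn.
    rewrite ler_wpM2r ?sqr_ge0// -real_normK ?num_real// ler_sqr ?nnegrE//.
      by apply: le_trans (ler_normB _ _) _; exact: lerD.
    by rewrite addr_ge0 ?(C0 x).
  - move=> _ _; rewrite integral0; exact: fine_cvg.
apply: (@squeeze_cvgr _ _ _ _ (cst 0)
  (fun n => 2 * C ^+ 2 * \int[mu]_(x in D) (p n x)
            + 2 * \int[mu]_(x in D) (q n x))).
- near=> n; apply/andP; split; first by apply: Rintegral_ge0 => x _; exact: sqr_ge0.
  have i1 : mu.-integrable D (EFin \o (fun x => 2 * C ^+ 2 * p n x)).
    exact: (integrableZl mD (2 * C ^+ 2) (ip n)).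
  have i2 : mu.-integrable D (EFin \o (fun x => 2 * q n x)).
    exact: (integrableZl mD 2 (iq n)).
  have i3 : mu.-integrable D (EFin \o (fun x => 2 * C ^+ 2 * p n x + 2 * q n x)).
    exact: (integrableD mD i1 i2).
  rewrite -!RintegralZl// -RintegralD//.
  have H x : (a n x * v n x - a0 x * v0 x) ^+ 2 <= 2 * C ^+ 2 * p n x + 2 * q n x.
    have -> : a n x * v n x - a0 x * v0 x =
      a n x * (v n x - v0 x) + (a n x - a0 x) * v0 x by ring.
    apply: (@le_trans _ _ (2 * (a n x * (v n x - v0 x)) ^+ 2 + 2 * q n x)).
      exact: sqrD_le2.
    rewrite lerD2r exprMn mulrA ler_wpM2r ?sqr_ge0// ler_wpM2l//.
    by rewrite -real_normK ?num_real// ler_sqr ?nnegrE// (C0 x).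
  apply: le_Rintegral => //.
  apply: le_integrable i3 => //.
    apply/measurable_EFinP; apply: measurable_funX; apply: measurable_funB.
      by apply: measurable_funM => //; case: (hv n).
    by apply: measurable_funM => //; case: hv0.
  move=> x _ /=; rewrite lee_fin ger0_norm ?sqr_ge0// (le_trans (H x))//.
  exact: ler_norm.
- exact: cvg_cst.
- rewrite -[X in _ --> X](addr0 0); apply: cvgD.
    by rewrite -(mulr0 (2 * C ^+ 2)); apply: cvgM; [exact: cvg_cst|exact: vv].
  by rewrite -(mulr0 2); apply: cvgM; [exact: cvg_cst|exact: q0].
Unshelve. all: by end_near. Qed.

End square_mean_convergence.

(** * The integral of a derivative with bounded support *)

Section euclidean_calculus.
Context {R : realType}.

Section measurability.
Context {n : nat}.
Implicit Types (U A : set 'rV[R]_n) (f g : 'rV[R]_n -> R).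

Lemma continuous_measurable_rV U f : open U ->
  (forall x, U x -> {for x, continuous f}) -> measurable_fun U f.
Proof.
move=> oU cf; apply: (@measurability _ _ 'rV[R]_n (measurableTypeR R) U f _
  (measurable_realfun.RGenOpens.measurableE R)).
move=> _ [_ [a [b ->] <-]].
apply: open_measurable_rV; rewrite openE => x [Ux fx].
apply: filterI; first by move: oU; rewrite openE => /(_ _ Ux).
by apply: (cf _ Ux); apply: open_nbhs_nbhs; split => //; exact: interval_open.
Qed.

Lemma lebesgue_cbox_lty (a b : 'rV[R]_n) : (lebesgue_rV R n (cbox a b) < +oo)%E.
Proof.
have -> : cbox a b = [set x : 'rV[R]_n | forall i,
    `[a ord0 i, b ord0 i]%classic (x ord0 i)].
  by apply/seteqP; split => x /= h i; have := h i; rewrite in_itv.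
rewrite (@lebesgue_rV_box R n (fun i => `[a ord0 i, b ord0 i]%classic))//.
rewrite -ge0_fin_numE; last by apply: prode_ge0 => i _; exact: measure_ge0.
elim/big_ind : _ => //; first by move=> x y; exact: fin_numM.
by move=> i _; rewrite ge0_fin_numE//; 
  exact: (compact_finite_measure (@segment_compact _ _ _)).
Qed.

Lemma integrable_continuous_box (a b : 'rV[R]_n) f : continuous f ->
  (forall x, ~ cbox a b x -> f x = 0) ->
  (lebesgue_rV R n).-integrable setT (EFin \o f).
Proof.
move=> cf f0; have mc := compact_measurable_rV (@compact_cbox R n a b).
have -> : f = f \_ (cbox a b).
  apply/funext => x; rewrite patchE; case: ifPn => // /negP xab.
  by apply: f0 => h; apply: xab; rewrite inE.
rewrite -restrict_EFin; apply/(integrable_mkcond _ mc).1.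
apply: measurable_bounded_integrable => //.
- exact: lebesgue_cbox_lty.
- apply: measurable_funTS; apply: continuous_measurable_rV; first exact: openT.
  by move=> x _; exact: cf.
- have : bounded_set (f @` cbox a b).
    apply: compact_bounded; apply: continuous_compact; last exact: compact_cbox.
    exact: continuous_subspaceT.
  move=> [M [Mr HM]]; exists M; split=> // N MN x xab.
  by apply: (HM N MN); exists x.
Qed.

End measurability.

Lemma integral_derive1_eq0 (f df : R -> R) M :
  (forall x : R, is_derive x 1 f (df x)) -> continuous df ->
  (forall x, M < `|x| -> f x = 0 /\ df x = 0) ->
  (\int[lebesgue_measure]_x (df x)%:E = 0)%E.
Proof.
move=> fdf cdf f0; pose N := `|M| + 1.
have MN : M < `|N| by rewrite ger0_norm ?addr_ge0// ltr_pwDr// ler_norm.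
have N0 : 0 < N by rewrite ltr_wpDl.
have -> : (fun x => (df x)%:E) = (EFin \o df) \_ `[- N, N].
  apply/funext => x; rewrite patchE; case: ifPn => //= /negP xN.
  rewrite (proj2 (f0 x _))//; rewrite ltNge; apply/negP => xM; apply: xN.
  rewrite inE/= in_itv/= -ler_norml (le_trans xM)// (le_trans (ler_norm _))//.
  by rewrite lerDl.
rewrite -integral_mkcond.
rewrite (@continuous_FTC2 _ df f)//.
- rewrite (proj1 (f0 N MN)) (proj1 (f0 (- N) _)) ?normrN// sube0//.
- by rewrite gtrN.
- exact: continuous_subspaceT.
- have cf x : {for x, continuous f} by exact: is_derive_continuous (fdf x).
  split; first by move=> x _; have [] := fdf x.
    by apply: cvg_at_right_filter; exact: cf.
  by apply: cvg_at_left_filter; exact: cf.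
- by move=> x _; rewrite derive1E; have [] := fdf x.
Qed.

Lemma row_consE n (a : R) (x : 'rV[R]_n) :
  row_cons (a, x) = a *: 'e_ord0 + row_cons ((0 : R), x).
Proof.
apply/rowP => i; rewrite !mxE; case: unliftP => [j ->|->] /=.
  by rewrite mulr0 add0r.
by rewrite ?eqxx mulr1 addr0.
Qed.

Lemma row_consDr n (a h : R) j (x : 'rV[R]_n) :
  row_cons (a, h *: 'e_j + x) = h *: 'e_(lift ord0 j) + row_cons (a, x).
Proof.
apply/rowP => i; rewrite !mxE; case: unliftP => [k ->|->] /=.
  by rewrite !mxE ?eqxx /= (inj_eq (@lift_inj _ _)).
by rewrite mulr0 add0r.
Qed.

Lemma row_cons_continuousl n (x : 'rV[R]_n) :
  continuous (fun a : R => row_cons (a, x)).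
Proof.
move=> a; under eq_fun do rewrite row_consE; rewrite row_consE.
by apply: cvgD; [apply: cvgZr_tmp; exact: cvg_id|exact: cvg_cst].
Qed.

Lemma row_cons_continuousr n (a : R) : continuous (fun x : 'rV[R]_n => row_cons (a, x)).
Proof.
move=> x A /nbhs_ballP[e /= e0 eA]; apply/nbhs_ballP; exists e => //= y [_ xy].
apply: eA; split => // i j; rewrite !mxE; case: unliftP => [k _|_] /=.
  exact: xy.
exact: ballxx.
Qed.

(** By Fubini's theorem the integral in the direction of the derivative can be done first.
The recursion on the dimension mirrors that of Lebesgue measure: the first coordinate is
handled by the fundamental theorem of calculus, the others by induction. *)
Lemma integral_derive_eq0 n (i : 'I_n) (f df : 'rV[R]_n -> R) M :
  (forall x, is_derive x 'e_i f (df x)) -> continuous df ->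
  (forall (x : 'rV[R]_n) j, M < `|x ord0 j| -> f x = 0 /\ df x = 0) ->
  (\int[lebesgue_rV R n]_x (df x)%:E = 0)%E.
Proof.
elim: n i f df => [[]//|n IH] i f df fdf cdf f0.
have idf : (lebesgue_rV R n.+1).-integrable setT (EFin \o df).
  apply: (@integrable_continuous_box _ (const_mx (- M)) (const_mx M)) => // x.
  move=> /existsNP[j]; rewrite !mxE -ler_norml => /negP.
  by rewrite -ltNge => /f0[].
have mdf : measurable_fun setT (EFin \o df) by case/integrableP : idf.
have ipdf : (lebesgue_measure \x lebesgue_rV R n)%E.-integrable setT
    (EFin \o df \o @row_cons _ R n).
  have /integrableP[_ doo] := idf; apply/integrableP; split.
    by apply: measurableT_comp => //; exact: measurable_row_cons.
  move: doo; rewrite /= /lebesgue_rV_step ge0_integral_pushforward//.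
  - exact: measurable_row_cons.
  - apply/measurable_EFinP; apply: measurableT_comp => //.
    exact/measurable_EFinP.
transitivity (\int[lebesgue_measure \x lebesgue_rV R n]_z
    (EFin \o df \o @row_cons _ R n) z)%E.
  rewrite /= /lebesgue_rV_step integral_pushforward//.
  exact: measurable_row_cons.
have [j ij|i0] := unliftP ord0 i.
  rewrite -integral12_prod_meas1//; apply: integral0_eq => a _.
  apply: (IH j (fun x => f (row_cons (a, x))) (fun x => df (row_cons (a, x)))).
  - move=> x; apply/is_derive_line0E.
    have -> : (fun t : R => f (row_cons (a, t *: 'e_j + x))) =
              (fun t : R => f (t *: 'e_(lift ord0 j) + row_cons (a, x))).
      by apply/funext => t; exact: (congr1 f (row_consDr a t j x)).
    by apply: (is_derive_line0E f _ _ _).1; rewrite -ij.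
  - move=> x; apply: (@continuous_comp _ _ _ (fun y => row_cons (a, y)) df x).
      exact: row_cons_continuousr.
    exact: cdf.
  - move=> x k Mx; apply: (f0 _ (lift ord0 k)).
    by rewrite mxE liftK.
rewrite -integral21_prod_meas1//; apply: integral0_eq => x _.
apply: (@integral_derive1_eq0 (fun a => f (row_cons (a, x)))
  (fun a => df (row_cons (a, x))) M).
- move=> a; have := fdf (row_cons (a, x)); rewrite i0 row_consE.
  move=> /is_derive_lineE; under eq_fun do rewrite -row_consE.
  by rewrite -row_consE.
- move=> a; apply: (@continuous_comp _ _ _ (fun b : R => row_cons (b, x)) df a).
    exact: row_cons_continuousl.
  exact: cdf.
- by move=> a Ma; apply: (f0 _ ord0); rewrite mxE unlift_none.
Qed.
End euclidean_calculus.

(** * Integration by parts *)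

Lemma near_eq_continuous_at (X : topologicalType) (R : realType) (f g : X -> R) x :
  (\forall y \near x, f y = g y) -> {for x, continuous f} ->
  {for x, continuous g}.
Proof.
move=> fg; have fgx : f x = g x by exact: nbhs_singleton fg.
rewrite /prop_for /continuous_at -fgx => /cvgrPdist_le cf.
apply/cvgrPdist_le => e e0.
by apply: filterS2 fg (cf e e0) => y ->.
Qed.

Section continuity_at_a_point.
Context {X : topologicalType} {R : realType}.
Implicit Types (f g : X -> R) (x : X).

Lemma continuous_at_funM f g x : {for x, continuous f} -> {for x, continuous g} ->
  {for x, continuous (fun y => f y * g y)}.
Proof. by move=> cf cg; exact: cvgM. Qed.

Lemma continuous_at_funD f g x : {for x, continuous f} -> {for x, continuous g} ->
  {for x, continuous (fun y => f y + g y)}.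
Proof. by move=> cf cg; exact: cvgD. Qed.

Lemma continuous_at_funB f g x : {for x, continuous f} -> {for x, continuous g} ->
  {for x, continuous (fun y => f y - g y)}.
Proof. by move=> cf cg; exact: cvgB. Qed.

Lemma continuous_at_cst c x : {for x, continuous (fun _ : X => c : R)}.
Proof. exact: cvg_cst. Qed.

Lemma continuous_at_sqr f x : {for x, continuous f} ->
  {for x, continuous (fun y => f y ^+ 2)}.
Proof.
move=> cf; under [X in {for _, continuous X}]eq_fun do rewrite expr2.
exact: continuous_at_funM.
Qed.

End continuity_at_a_point.

Section compactly_supported.
Context {R : realType} {n : nat}.
Local Notation E := 'rV[R]_n.
Local Notation dx := (lebesgue_rV R n).
Implicit Types (U Om K : set E) (f g h : E -> R).

Lemma coord_norm_le (x : E) i : `|x ord0 i| <= `|x|.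
Proof.
rewrite [leRHS]mx_normrE.
exact: (le_bigmax_cond _ (fun ij : 'I_1 * 'I_n => `|x ij.1 ij.2|)
  (j := (ord0, i))).
Qed.

Definition C1_on U f :=
  (forall x, U x -> {for x, continuous f}) /\
  forall i x, U x -> derivable f x 'e_i /\ {for x, continuous (partial i f)}.

Definition supported_in K f := forall x, ~ K x -> f x = 0.

Definition C1c Om f := C1_on [set: E] f /\
  exists K, [/\ compact K, K `<=` Om & supported_in K f].

Lemma derivable_is_derive f x v : derivable f x v -> is_derive x v f ('D_v f x).
Proof. by move=> df; split. Qed.

Lemma C1_on_derive U f i x : C1_on U f -> U x -> is_derive x 'e_i f (partial i f x).
Proof. by move=> [_ df] Ux; apply: derivable_is_derive; have [] := df i x Ux. Qed.

Lemma near_open U x : open U -> U x -> \forall y \near x, U y.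
Proof. by rewrite openE => /[apply]. Qed.

Lemma C1_on_intro U f (df : 'I_n -> E -> R) : open U ->
  (forall x, U x -> {for x, continuous f}) ->
  (forall i x, U x -> is_derive x 'e_i f (df i x)) ->
  (forall i x, U x -> {for x, continuous (df i)}) -> C1_on U f.
Proof.
move=> oU cf fdf cdf; split=> // i x Ux; split; first by have [] := fdf i x Ux.
have nU := near_open oU Ux.
have e : \forall y \near x, df i y = partial i f y.
  by apply: filterS nU => y Uy; rewrite /partial; have [_ ->] := fdf i y Uy.
exact: near_eq_continuous_at e (cdf i x Ux).
Qed.

Lemma C1_onM U f g : open U -> C1_on U f -> C1_on U g ->
  C1_on U (fun x => f x * g x).
Proof.
move=> oU Uf Ug; have [cf df] := Uf; have [cg dg] := Ug.
apply: (@C1_on_intro _ _ (fun i x => f x * partial i g x + g x * partial i f x)).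
- exact: oU.
- by move=> x Ux; apply: continuous_at_funM; [exact: cf|exact: cg].
- by move=> i x Ux; apply: is_derive_funM; exact: (@C1_on_derive U).
- move=> i x Ux; have [_ cdf] := df i x Ux; have [_ cdg] := dg i x Ux.
  apply: continuous_at_funD; apply: continuous_at_funM => //; [exact: cf|exact: cg].
Qed.

Lemma C1_onB U f g : open U -> C1_on U f -> C1_on U g ->
  C1_on U (fun x => f x - g x).
Proof.
move=> oU Uf Ug; have [cf df] := Uf; have [cg dg] := Ug.
apply: (@C1_on_intro _ _ (fun i x => partial i f x - partial i g x)).
- exact: oU.
- by move=> x Ux; apply: continuous_at_funB; [exact: cf|exact: cg].
- by move=> i x Ux; apply: is_derive_funB; exact: (@C1_on_derive U).
- move=> i x Ux; have [_ cdf] := df i x Ux; have [_ cdg] := dg i x Ux.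
  exact: continuous_at_funB.
Qed.

Lemma C1_onZ U c f : open U -> C1_on U f -> C1_on U (fun x => c * f x).
Proof.
move=> oU Uf; have [cf df] := Uf.
apply: (@C1_on_intro _ _ (fun i x => c * partial i f x)).
- exact: oU.
- by move=> x Ux; apply: continuous_at_funM; [exact: continuous_at_cst|exact: cf].
- by move=> i x Ux; apply: is_derive_funZ; exact: (@C1_on_derive U).
- move=> i x Ux; have [_ cdf] := df i x Ux.
  by apply: continuous_at_funM => //; exact: continuous_at_cst.
Qed.

Lemma C1_on_cst U c : open U -> C1_on U (fun _ => c).
Proof.
move=> oU; apply: (@C1_on_intro _ _ (fun _ _ => 0)) => //.
- by move=> x _; exact: continuous_at_cst.
- by move=> i x _; exact: continuous_at_cst.
Qed.

Lemma partialM U f g i x : C1_on U f -> C1_on U g -> U x ->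
  partial i (fun x => f x * g x) x = f x * partial i g x + g x * partial i f x.
Proof.
move=> Uf Ug Ux.
by have [_] := is_derive_funM (C1_on_derive i Uf Ux) (C1_on_derive i Ug Ux).
Qed.

Lemma partialB U f g i x : C1_on U f -> C1_on U g -> U x ->
  partial i (fun x => f x - g x) x = partial i f x - partial i g x.
Proof.
move=> Uf Ug Ux.
by have [_] := is_derive_funB (C1_on_derive i Uf Ux) (C1_on_derive i Ug Ux).
Qed.

Lemma C1_onS U V f : V `<=` U -> C1_on U f -> C1_on V f.
Proof.
by move=> VU [cf df]; split=> [x /VU /cf|i x /VU]//; exact: df.
Qed.

Lemma supported_in_near K f x : compact K -> supported_in K f -> ~ K x ->
  \forall y \near x, f y = 0.
Proof.
move=> cK fK Kx; have oK : open (~` K).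
  by apply: closed_openC; exact: compact_closed.
by have := near_open oK Kx; apply: filterS => y; exact: fK.
Qed.

Lemma supported_in_partial K f i : compact K -> supported_in K f ->
  supported_in K (partial i f).
Proof.
move=> cK fK x Kx; have f0 := supported_in_near cK fK Kx.
rewrite /partial (@near_eq_derive _ _ _ f (cst 0))//.
exact: derive_cst.
Qed.

Lemma supported_in_continuous Om K f : compact K -> K `<=` Om ->
  supported_in K f -> (forall x, Om x -> {for x, continuous f}) -> continuous f.
Proof.
move=> cK KOm fK cf x; have [/KOm/cf//|Kx] := pselect (K x).
apply: (@near_eq_continuous_at _ _ (cst 0)); last exact: continuous_at_cst.
by apply: filterS (supported_in_near cK fK Kx) => y ->.
Qed.

(** Near a point outside [K] the function is zero, so its regularity in [Om] is regularity on
the whole space. *)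
Lemma C1c_intro Om K f : open Om -> compact K -> K `<=` Om -> supported_in K f ->
  C1_on Om f -> C1c Om f.
Proof.
move=> oOm cK KOm fK [cf df]; split; last by exists K.
split=> [x _|i x _]; first exact: (supported_in_continuous cK KOm fK cf).
split; last first.
  have pK := supported_in_partial i cK fK.
  suff cp : continuous (partial i f) by exact: cp.
  apply: (supported_in_continuous cK KOm pK).
  by move=> y Oy; have [] := df i y Oy.
have [Kx|Kx] := pselect (K x); first by have [] := df i x (KOm _ Kx).
apply: (@near_eq_derivable _ _ _ (cst 0)); last exact: derivable_cst.
by apply: filterS (supported_in_near cK fK Kx) => y ->.
Qed.

Lemma C1cM Om f g : open Om -> C1_on Om f -> C1c Om g ->
  C1c Om (fun x => f x * g x).
Proof.
move=> oOm Of [Tg [K [cK KOm gK]]]; apply: (@C1c_intro Om K) => //.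
  by move=> x /gK ->; rewrite mulr0.
by apply: C1_onM => //; apply: C1_onS Tg.
Qed.

Lemma test_fun_C1c Om f : test_fun Om f -> C1c Om f.
Proof.
move=> [Cf Kf]; split=> //; have [cf df] := Cf 1%N; split=> // i x _.
by have [dfi [cfi _]] := df i; split; [exact: dfi|exact: cfi].
Qed.

Lemma compact_supported_integrable Om K f : open Om -> compact K -> K `<=` Om ->
  supported_in K f -> (forall x, Om x -> {for x, continuous f}) ->
  dx.-integrable Om (EFin \o f).
Proof.
move=> oOm cK KOm fK cf.
have [M [Mr HM]] := compact_bounded cK.
apply: (@integrableS _ _ _ _ setT) => //; first exact: open_measurable_rV.
apply: (@integrable_continuous_box _ _ (const_mx (- (M + 1))) (const_mx (M + 1))).
  exact: (supported_in_continuous cK KOm fK cf).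
move=> x xb; apply: fK => Kx; apply: xb => i; rewrite !mxE -ler_norml.
by apply: le_trans (coord_norm_le x i) (HM (M + 1) _ _ Kx); rewrite ltrDl.
Qed.

Lemma C1c_sqint Om f : open Om -> C1c Om f -> sqint dx Om f.
Proof.
move=> oOm [[cf df] [K [cK KOm fK]]]; apply: integrable2_sqint.
  by apply: continuous_measurable_rV => // x _; exact: cf.
apply: (@compact_supported_integrable Om K) => //.
  by move=> x /fK ->; rewrite expr0n.
by move=> x _; apply: continuous_at_sqr; exact: cf.
Qed.

Lemma C1c_partial_sqint Om f i : open Om -> C1c Om f -> sqint dx Om (partial i f).
Proof.
move=> oOm [[cf df] [K [cK KOm fK]]].
have cp x : {for x, continuous (partial i f)} by have [] := df i x Logic.I.
apply: integrable2_sqint.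
  by apply: continuous_measurable_rV => // x _; exact: cp.
apply: (@compact_supported_integrable Om K) => //.
  by move=> x /(supported_in_partial i cK fK) ->; rewrite expr0n.
by move=> x _; apply: continuous_at_sqr; exact: cp.
Qed.

Lemma integral_partial_eq0 Om f i : open Om -> C1c Om f ->
  \int[dx]_(x in Om) partial i f x = 0.
Proof.
move=> oOm [Cf [K [cK KOm fK]]]; have [M [Mr HM]] := compact_bounded cK.
have pK := supported_in_partial i cK fK.
rewrite Rintegral_mkcond.
have -> : (partial i f) \_ Om = partial i f.
  apply/funext => x; rewrite patchE; case: ifPn => // /negP xO.
  by rewrite pK// => /KOm Ox; apply: xO; rewrite inE.
suff h : (\int[dx]_x (partial i f x)%:E = 0)%E by rewrite /Rintegral h.
apply: (@integral_derive_eq0 R n i f (partial i f) (M + 1)).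
- by move=> x; apply: (@C1_on_derive setT).
- by move=> x; have [_ /(_ i x Logic.I)[]] := Cf.
- move=> x j Mx; suff Kx : ~ K x by split; [exact: fK|exact: pK].
  move=> Kx; move: Mx; rewrite ltNge => /negP; apply.
  by apply: le_trans (coord_norm_le x j) (HM (M + 1) _ _ Kx); rewrite ltrDl.
Qed.

(** The product [f * g] has compact support in [Om], so the integral of its partial
derivative is zero. *)
Lemma integration_by_parts_C1c Om f g i : open Om -> C1_on Om f -> C1c Om g ->
  \int[dx]_(x in Om) (f x * partial i g x) =
  - \int[dx]_(x in Om) (partial i f x * g x).
Proof.
move=> oOm Of Cg; have [Tg [K [cK KOm gK]]] := Cg.
have := integral_partial_eq0 i oOm (C1cM oOm Of Cg).
have Og : C1_on Om g by apply: C1_onS Tg.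
have cf x : Om x -> {for x, continuous f} by case: Of => + _; apply.
have cg x : Om x -> {for x, continuous g} by case: Og => + _; apply.
have cpf x : Om x -> {for x, continuous (partial i f)}.
  by move=> Ox; case: Of => _ /(_ i x Ox)[].
have cpg x : Om x -> {for x, continuous (partial i g)}.
  by move=> Ox; case: Og => _ /(_ i x Ox)[].
have i1 : dx.-integrable Om (EFin \o (fun x => f x * partial i g x)).
  apply: (@compact_supported_integrable Om K) => //.
    by move=> x /(supported_in_partial i cK gK) ->; rewrite mulr0.
  by move=> x Ox; apply: continuous_at_funM; [exact: cf|exact: cpg].
have i2 : dx.-integrable Om (EFin \o (fun x => partial i f x * g x)).
  apply: (@compact_supported_integrable Om K) => //.
    by move=> x /gK ->; rewrite mulr0.
  by move=> x Ox; apply: continuous_at_funM; [exact: cpf|exact: cg].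
under [in X in X -> _]eq_Rintegral => x xO.
  rewrite (partialM _ Of Og); last by rewrite inE in xO.
  rewrite [g x * _]mulrC.
  over.
rewrite RintegralD//; last exact: open_measurable_rV.
by move=> /eqP; rewrite addr_eq0 => /eqP.
Qed.

End compactly_supported.

(** * The fundamental lemma of the calculus of variations *)

Section bump_functions.
Context {R : realType} {n : nat}.
Local Notation E := 'rV[R]_n.
Local Notation dx := (lebesgue_rV R n).
Implicit Types (Om : set E) (f g : E -> R) (a b : E).

(** The algebra generated by flat functions of one coordinate. It is stable under partial
derivatives, and so consists of smooth functions. *)
Inductive flat_algebra : (E -> R) -> Prop :=
| flat_algebra_flat c p s t i : 0 < c ->
    flat_algebra (fun x => flat c p (s * x ord0 i + t))
| flat_algebra_cst c : flat_algebra (fun _ => c)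
| flat_algebraD f g : flat_algebra f -> flat_algebra g ->
    flat_algebra (fun x => f x + g x)
| flat_algebraM f g : flat_algebra f -> flat_algebra g ->
    flat_algebra (fun x => f x * g x).

Lemma flat_algebra_continuous f : flat_algebra f ->
  forall x, {for x, continuous f}.
Proof.
elim=> {f} [c p s t i c0 x|c x|f g _ cf _ cg x|f g _ cf _ cg x].
- apply: (@continuous_comp _ _ _ (fun x : E => s * x ord0 i + t) (flat c p) x).
    apply: continuous_at_funD; last exact: continuous_at_cst.
    apply: continuous_at_funM; first exact: continuous_at_cst.
    exact: coord_continuous.
  exact: is_derive_continuous (is_derive_flat _ _ c0).
- exact: continuous_at_cst.
- exact: continuous_at_funD.
- exact: continuous_at_funM.
Qed.

Lemma is_derive_coord i j (x : E) :
  is_derive x 'e_j (fun y : E => y ord0 i) (i == j)%:R.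
Proof.
apply: (is_derive_line0E _ _ _ _).2.
have -> : (fun t : R => (t *: 'e_j + x) ord0 i) =
          (fun t : R => (i == j)%:R * t + x ord0 i).
  by apply/funext => t; rewrite !mxE eqxx /= mulrC.
apply: is_derive_eq (is_derive_funD (is_derive_funZ _ (is_derive_id (0:R) (1:R)))
  (is_derive_fun_cst _ _ _)) _.
by rewrite addr0 mulr1.
Qed.

Lemma flat_algebra_derive f : flat_algebra f ->
  forall j, exists df, flat_algebra df /\ forall x, is_derive x 'e_j f (df x).
Proof.
elim=> {f} [c p s t i c0 j|c j|f g Af IHf Ag IHg j|f g Af IHf Ag IHg j].
- exists (fun x => (s * (i == j)%:R) * flat c (flat_poly c p) (s * x ord0 i + t)).
  split; first by apply: flat_algebraM; constructor.
  move=> x; rewrite mulrC; apply: is_derive_comp1; first exact: is_derive_flat.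
  rewrite -[X in is_derive _ _ _ X]addr0; apply: is_derive_funD.
    by apply: is_derive_funZ; exact: is_derive_coord.
- by exists (fun _ => 0); split=> [|x]; [constructor|exact: is_derive_fun_cst].
- have [df [Adf Hf]] := IHf j; have [dg [Adg Hg]] := IHg j.
  exists (fun x => df x + dg x); split; first exact: flat_algebraD.
  by move=> x; exact: is_derive_funD.
- have [df [Adf Hf]] := IHf j; have [dg [Adg Hg]] := IHg j.
  exists (fun x => f x * dg x + g x * df x); split.
    by apply: flat_algebraD; exact: flat_algebraM.
  by move=> x; exact: is_derive_funM.
Qed.

Lemma flat_algebra_Ck k f : flat_algebra f -> Ck_on k [set: E] f.
Proof.
elim: k f => [|k IH] f Af /=.
  by split=> // x _; exact: flat_algebra_continuous.
split=> [x _|i]; first exact: flat_algebra_continuous.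
have [df [Adf Hf]] := flat_algebra_derive Af i.
split=> [x _|]; first by have [] := Hf x.
suff -> : partial i f = df by exact: IH.
by apply/funext => x; have [_] := Hf x.
Qed.

(** A smooth approximation of the indicator of [obox a b], converging to it pointwise
as [k] grows. *)
Definition bump k a b (x : E) : R :=
  \prod_(i < n) (flat k.+1%:R^-1 1 (x ord0 i - a ord0 i) *
                 flat k.+1%:R^-1 1 (b ord0 i - x ord0 i)).

Lemma flat_algebra_bump k a b : flat_algebra (bump k a b).
Proof.
rewrite /bump; elim: (index_enum _) => [|i s IH].
  by under eq_fun do rewrite big_nil; constructor.
under eq_fun do rewrite big_cons; apply: flat_algebraM => //.
have k0 : 0 < k.+1%:R^-1 :> R by rewrite invr_gt0.
apply: flat_algebraM.
  under eq_fun do rewrite -[_ ord0 i]mul1r.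
  exact: flat_algebra_flat.
under eq_fun do rewrite addrC -mulN1r.
exact: flat_algebra_flat.
Qed.

Lemma bump_itv k a b x : 0 <= bump k a b x <= 1.
Proof.
have k0 : 0 < k.+1%:R^-1 :> R by rewrite invr_gt0.
rewrite /bump; elim: (index_enum _) => [|i s IH].
  by rewrite big_nil ler01 lexx.
rewrite big_cons; have /andP[? ?] := IH.
have /andP[? ?] := flat1_itv (x ord0 i - a ord0 i) k0.
have /andP[? ?] := flat1_itv (b ord0 i - x ord0 i) k0.
by rewrite !mulr_ge0// !mulr_ile1// ?mulr_ge0.
Qed.

Lemma bump_eq0 k a b x : ~ obox a b x -> bump k a b x = 0.
Proof.
move=> /existsNP[i /negP]; rewrite negb_and -!leNgt => h.
rewrite /bump (bigD1 i)//=; case/orP : h => h.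
  by rewrite flat1_le0 ?subr_le0// !mul0r.
by rewrite [flat _ _ (b _ _ - _)]flat1_le0 ?subr_le0// mulr0 mul0r.
Qed.

Lemma cvg_bump a b x : bump k a b x @[k --> \oo] --> (\1_(obox a b) x : R).
Proof.
have [xab|xab] := pselect (obox a b x); last first.
  under eq_fun do rewrite bump_eq0//.
  by rewrite indicE memNset//; exact: cvg_cst.
have M1 (u v : nat -> R) : u k @[k --> \oo] --> (1 : R) ->
    v k @[k --> \oo] --> (1 : R) -> u k * v k @[k --> \oo] --> (1 : R).
  move=> hu hv; suff : u k * v k @[k --> \oo] --> (1 * 1 : R) by rewrite mulr1.
  exact: cvgM.
rewrite indicE mem_set//= /bump; elim: (index_enum _) => [|i s IH].
  by under eq_fun do rewrite big_nil; exact: cvg_cst.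
under eq_fun do rewrite big_cons.
have /andP[ax xb] := xab i; apply: (M1) => //; apply: (M1).
  by have := @cvg_flat1 R (x ord0 i - a ord0 i); rewrite subr_gt0 ax.
by have := @cvg_flat1 R (b ord0 i - x ord0 i); rewrite subr_gt0 xb.
Qed.

Lemma test_fun_bump Om k a b : cbox a b `<=` Om -> test_fun Om (bump k a b).
Proof.
move=> abOm; split=> [m|]; first exact/flat_algebra_Ck/flat_algebra_bump.
exists (cbox a b); split=> // [|x xab]; first exact: compact_cbox.
by apply: bump_eq0 => /obox_sub_cbox.
Qed.

Section fundamental_lemma.
Variables (Om : set E) (w : E -> R).
Hypotheses (oOm : open Om) (iw : dx.-integrable Om (EFin \o w)).
Hypothesis w_test : forall phi, test_fun Om phi ->
  \int[dx]_(x in Om) (w x * phi x) = 0.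

Let mOm : measurable Om := open_measurable_rV oOm.
Let mw : measurable_fun Om (EFin \o w) := measurable_int _ iw.

(** The indicator of the box is the pointwise limit of bumps, dominated by 1. *)
Let integral_obox a b : cbox a b `<=` Om ->
  (\int[dx]_(x in obox a b) (w x)%:E = 0)%E.
Proof.
move=> abOm.
have abO : obox a b `<=` Om by move=> x /obox_sub_cbox /abOm.
have mf k : measurable_fun Om (fun x => (w x * bump k a b x)%:E).
  apply/measurable_EFinP; apply: measurable_funM; first exact/measurable_EFinP.
  apply: continuous_measurable_rV => // x _.
  exact: flat_algebra_continuous (flat_algebra_bump k a b) x.
have m1 : measurable_fun Om (fun x => (w x * \1_(obox a b) x)%:E).
  apply/measurable_EFinP; apply: measurable_funM; first exact/measurable_EFinP.
  by apply: measurable_indic; exact: measurable_obox.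
have ig : dx.-integrable Om (fun x => `|w x|%:E) by exact: integrable_norm.
have [] := @dominated_convergence _ _ _ dx Om mOm
  (fun k x => (w x * bump k a b x)%:E) (fun x => (w x * \1_(obox a b) x)%:E) _
  mf m1 _ ig _.
- apply: nearW => x Ox; apply: cvg_EFin; first exact: nearW.
  by apply: cvgM; [exact: cvg_cst|exact: cvg_bump].
- apply: nearW => x k Ox; rewrite /= lee_fin normrM ler_piMr//.
  by have /andP[? ?] := bump_itv k a b x; rewrite ger0_norm.
move=> _ _ + .
have i0 k : (\int[dx]_(x in Om) (w x * bump k a b x)%:E = 0)%E.
  have ib : dx.-integrable Om (fun x => (w x * bump k a b x)%:E).
    apply: le_integrable ig => // x Ox; rewrite /= lee_fin normr_id normrM ler_piMr//.
    by have /andP[? ?] := bump_itv k a b x; rewrite ger0_norm.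
  rewrite -[LHS]fineK; last exact: integrable_fin_num.
  by have := w_test (test_fun_bump k abOm); rewrite /Rintegral => ->.
under eq_fun do rewrite i0.
move=> /(cvg_unique _ (cvg_cst _)) => /(_ _)/esym H.
rewrite -[RHS]H//; rewrite -{1}(setIidr abO) integral_mkcondr.
apply: eq_integral => x _; rewrite patchE indicE.
by case: (x \in _); rewrite ?mulr1 ?mulr0.
Qed.

Let integral_measurable a b A : cbox a b `<=` Om -> measurable A ->
  (\int[dx]_(x in obox a b `&` A) (w x)%:E = 0)%E.
Proof.
move=> abOm; pose H := [set A : set E | measurable A /\
  (\int[dx]_(x in obox a b `&` A) (w x)%:E = 0)%E].
have mab := @measurable_obox R n a b.
have abO : obox a b `<=` Om by move=> x /obox_sub_cbox /abOm.
have iab : dx.-integrable (obox a b) (EFin \o w) by exact: integrableS iw.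
suff HS : <<d @oboxes R n >> `<=` H.
  rewrite measurable_rV_oboxes -setI_closed_g_dynkin_g_sigma_algebra.
    by move=> /HS[].
  exact: oboxes_setI.
apply: smallest_sub; last first.
  move=> A0 [a' [b' ->]]; split; first exact: measurable_obox.
  rewrite obox_setI; apply: integral_obox => x h; apply: abOm => j.
  by have := h j; rewrite !mxE ge_max le_min => /andP[/andP[-> _] /andP[-> _]].
split.
- split; first exact: measurableT.
  by rewrite setIT; exact: integral_obox.
- move=> A0 [mA A0w]; split; first exact: measurableC.
  have := integral_obox abOm.
  rewrite -[in X in X -> _](setUIDK (obox a b) A0) integral_setU//.
  + by rewrite A0w add0r setDE.
  + exact: measurableI.
  + exact: measurableD.
  + by rewrite setUIDK; case/integrableP : iab.
  + by apply/disj_setPS => x [[_ ?] [_]].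
- move=> F tF HF; split; first by apply: bigcup_measurable => k _; case: (HF k).
  rewrite setI_bigcupr integral_bigcup.
  + by apply: eseries0 => k _ _; case: (HF k).
  + by apply: trivIset_setIl.
  + by move=> k; apply: measurableI => //; case: (HF k).
  + apply: integrableS iab => //.
      apply: bigcup_measurable => k _; apply: measurableI => //.
      by case: (HF k).
    by apply: bigcup_sub => k _ x [].
Qed.

(** Testing with bumps shows that the integral of [w] vanishes on boxes, hence on all
measurable parts of a box by the pi-lambda theorem; countably many cubes cover [Om]. *)
Lemma fundamental_lemma : {ae dx, forall x, Om x -> w x = 0}.
Proof.
(* The cubes are enumerated by [unpickle], to take a countable union of null sets. *)
pose P (k : nat) (x : E) := forall i, unpickle k = Some i ->
  cbox (cube_lo i) (cube_hi i) `<=` Om -> cube i x -> w x = 0.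
have : {ae dx, forall x, forall k, P k x}.
  apply: ae_foralln => k; rewrite /P.
  case E : (unpickle k) => [i|]; last exact: nearW.
  have [iO|iO] := pselect (cbox (cube_lo i) (cube_hi i) `<=` Om); last first.
    by apply: nearW => x j [<-].
  have mi := @measurable_obox R n (cube_lo i) (cube_hi i).
  have iOm : cube i `<=` Om by move=> x /obox_sub_cbox /iO.
  have iwi : dx.-integrable (cube i) (EFin \o w) by exact: integrableS iw.
  have := @integral_ae_eq _ _ _ dx (cube i) mi (cst 0%E) (EFin \o w) iwi
    (measurable_cst _) _.
  have h : forall A, A `<=` cube i -> measurable A ->
     (\int[dx]_(x in A) (EFin \o w) x = \int[dx]_(x in A) cst 0 x)%E.
    move=> A Ai mA; rewrite integral0 -(setIidr Ai).
    exact: integral_measurable.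
  move=> /(_ h); apply: filterS => x wx j [<-] _ xi.
  by have [] := wx xi.
apply: filterS => x Px Ox; have [i [xi iO]] := open_cube oOm Ox.
exact: (Px (pickle i) i (pickleK i) iO xi).
Qed.

End fundamental_lemma.

End bump_functions.

(** * The maximum principle for harmonic functions *)

Section maximum_principle.
Context {R : realType}.

(** Caratheodory's form of differentiability provides a slope function of [df] at 0. If [l] were
positive, [df] would keep its sign on the side of 0 selected by the sign of [df 0], and [f]
would exceed its maximum on that side. *)
Lemma second_derivative_at_max (f df : R -> R) (l : R) :
  (\forall s \near (0 : R), is_derive (s : R) 1 f (df s)) -> is_derive (0 : R) 1 df l ->
  (\forall s \near (0 : R), f s <= f 0) -> l <= 0.
Proof.
move=> fdf /is_derive1_caratheodory[g [gE cg gl]] fmax.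
rewrite leNgt; apply/negP => l0.
have g0 : \forall s \near (0 : R), 0 < g s.
  by apply: cvgr_gt cg _ _; rewrite gl.
have [e /= e0 He] : \forall s \near (0 : R),
  [/\ is_derive (s : R) 1 f (df s), f s <= f 0 & 0 < g s].
  by near=> s; split; near: s.
have e2 : 0 < e / 2 by rewrite divr_gt0.
have H (s : R) : `|s| <= e / 2 -> [/\ is_derive s 1 f (df s), f s <= f 0 & 0 < g s].
  by move=> se; apply: He; rewrite /= sub0r normrN; lra.
have cf a b : - (e / 2) <= a -> b <= e / 2 -> {within `[a, b], continuous f}.
  move=> ea be; apply: derivable_within_continuous => x.
  rewrite in_itv/= => /andP[ax xb].
  by have [|[]] := H x; rewrite ?ler_norml; first by apply/andP; split; lra.
have [d0|d0] := leP 0 (df 0).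
  have [||c] := @MVT R f df 0 (e / 2) e2.
  - move=> x; rewrite in_itv/= => /andP[x0 xe].
    by have [] := H x; rewrite // gtr0_norm// ltW.
  - by apply: cf; lra.
  rewrite in_itv/= => /andP[c0 ce] E.
  have [_ _ gc] := H c ltac:(by rewrite gtr0_norm// ltW).
  have [_ + _] := H (e / 2) ltac:(by rewrite gtr0_norm).
  rewrite leNgt => /negP; apply; rewrite -subr_gt0 E subr0 mulr_gt0//.
  by rewrite -(subrK (df 0) (df c)) ltr_pwDl// gE subr0 mulr_gt0.
have Ne2 : - (e / 2) < 0 by lra.
have [||c] := @MVT R f df (- (e / 2)) 0 Ne2.
- move=> x; rewrite in_itv/= => /andP[x0 xe].
  by have [] := H x; rewrite // ltr0_norm//; lra.
- by apply: cf; lra.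
rewrite in_itv/= => /andP[ce c0] E.
have [_ _ gc] := H c ltac:(by rewrite ltr0_norm//; lra).
have [_ + _] := H (- (e / 2)) ltac:(by rewrite normrN gtr0_norm).
rewrite leNgt => /negP; apply; rewrite -subr_lt0 E sub0r opprK pmulr_llt0//.
rewrite -(subrK (df 0) (df c)) gE subr0.
have : g c * c < 0 by rewrite pmulr_rlt0.
lra.
Unshelve. all: by end_near. Qed.

Context {n : nat}.
Local Notation E := 'rV[R]_n.
Implicit Types (Om : set E) (h : E -> R).

Lemma partial_partial_at_max Om h (dh : E -> R) i c l : open Om -> Om c ->
  (forall x, Om x -> is_derive x 'e_i h (dh x)) -> is_derive c 'e_i dh l ->
  (forall x, Om x -> h x <= h c) -> l <= 0.
Proof.
move=> oOm Oc hdh dhl hmax.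
pose lin (s : R) : E := s *: 'e_i + c.
have lin0 : lin 0 = c by rewrite /lin scale0r add0r.
have nO : \forall s \near (0 : R), Om (lin s).
  have cl : {for (0 : R), continuous lin}.
    by apply: cvgD; [apply: cvgZr_tmp; exact: cvg_id|exact: cvg_cst].
  by apply: cl; rewrite lin0; exact: near_open.
apply: (@second_derivative_at_max (fun s => h (lin s)) (fun s => dh (lin s)) l).
- apply: filterS nO => s Os; apply: (is_derive_lineE h c 'e_i s _).1.
  exact: hdh.
- exact: (is_derive_line0E dh c 'e_i l).1.
- by apply: filterS nO => s Os; rewrite lin0; exact: hmax.
Qed.

Lemma Ck_closure_C1_on k Om h : open Om -> Ck_closure k.+1 Om h -> C1_on Om h.
Proof.
move=> oOm [ch [_ dh]].
have ext_cont (f g : E -> R) x : Om x -> {within closure Om, continuous g} ->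
    {in Om, f =1 g} -> {for x, continuous f}.
  move=> Ox cg fg; apply: (@near_eq_continuous_at _ _ g).
    by apply: filterS (near_open oOm Ox) => y Oy; rewrite fg// inE.
  have : {within Om, continuous g}.
    by apply: continuous_subspaceW cg; exact: subset_closure.
  by rewrite continuous_open_subspace// => /(_ x); apply; rewrite inE.
split=> [x Ox|i x Ox]; first exact: ext_cont ch _.
have [di Ci] := dh i; split; first exact: di.
by case: k Ci {dh} => [|k] /= [[g [cg fg]] _]; exact: ext_cont cg fg.
Qed.

Lemma bounded_closure Om : bounded_set Om -> bounded_set (closure Om).
Proof.
move=> [M [Mr HM]]; exists (M + 1); split; first by rewrite realD.
move=> N MN x Cx.
have cB : closed [set y : E | `|y| <= M + 1].
  by apply: (closed_comp _ (@closed_le R (M + 1))) => y _; exact: norm_continuous.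
have xM : [set y : E | `|y| <= M + 1] x.
  move: Cx; rewrite closureE; apply; split=> // y Oy.
  by apply: HM => //; rewrite ltrDl.
exact: le_trans xM (ltW MN).
Qed.

Lemma bounded_on_closure Om (g : E -> R) : bounded_set Om ->
  {within closure Om, continuous g} -> exists M, forall x, closure Om x -> `|g x| <= M.
Proof.
move=> bOm cg.
have cC : compact (closure Om).
  apply: bounded_closed_compact; last exact: closed_closure.
  exact: bounded_closure.
have [M [Mr HM]] := compact_bounded (continuous_compact cg cC).
exists (M + 1) => x Cx; apply: HM; first by rewrite ltrDl.
by exists x.
Qed.

(** A small multiple of the square of a coordinate is added to make the Laplacian positive,
which excludes interior maxima. The values [1] and [-1] of [s] give the upper and the lower
bound. *)
Lemma weak_maximum_principle Om h s (i0 : 'I_n) : open Om -> bounded_set Om ->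
  Ck_closure 2 Om h -> (forall x, Om x -> laplacian h x = 0) ->
  forall x, Om x -> exists2 y, boundary Om y & s * h x <= s * h y.
Proof.
move=> oOm bOm Ch lap0 x0 Ox0; have [ch [_ dh]] := Ch.
have csh : {within closure Om, continuous (fun x => s * h x)}.
  by move=> x; apply: cvgM; [exact: cvg_cst|exact: ch].
have cC : compact (closure Om).
  apply: bounded_closed_compact; last exact: closed_closure.
  exact: bounded_closure.
have iO : interior Om = Om.
  apply/seteqP; split; first exact: interior_subset.
  by move: oOm; rewrite openE.
have C1h := Ck_closure_C1_on oOm Ch.
have [M [Mr HM]] := compact_bounded cC.
have HM1 x i : closure Om x -> (x ord0 i) ^+ 2 <= (M + 1) ^+ 2.
  move=> Cx; rewrite -real_normK ?num_real//.
  have xM : `|x ord0 i| <= M + 1.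
    by apply: le_trans (coord_norm_le x i) (HM (M + 1) _ _ Cx); rewrite ltrDl.
  by rewrite ler_sqr ?nnegrE// (le_trans _ xM).
have pert eps : 0 < eps -> exists2 y, boundary Om y &
    s * h x0 <= s * h y + eps * (M + 1) ^+ 2.
  move=> eps0; pose q (x : E) := eps * (x ord0 i0) ^+ 2.
  have cq : continuous q.
    move=> x; suff : {for x, continuous q} by [].
    apply: (@continuous_at_funM E R (fun=> eps) (fun x : E => x ord0 i0 ^+ 2)).
      exact: continuous_at_cst.
    by apply: continuous_at_sqr; exact: coord_continuous.
  have [||c Cc hc] := @EVT_max_rV R n (fun x => s * h x + q x) _ _ cC.
  - by exists x0; exact: subset_closure.
  - move=> x; apply: cvgD; first exact: csh.
    by apply: continuous_subspaceT; exact: cq.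
  rewrite inE in Cc.
  exists c; last first.
    have := hc x0; rewrite inE => /(_ (subset_closure Ox0)) h1.
    have : 0 <= q x0 by rewrite mulr_ge0 ?sqr_ge0// ltW.
    have : q c <= eps * (M + 1) ^+ 2 by rewrite ler_wpM2l ?HM1// ltW.
    lra.
  split=> //; rewrite iO => Oc.
  have dcoord i x : is_derive x 'e_i (fun y : E => y ord0 i0) (i0 == i)%:R.
    exact: is_derive_coord.
  have dq i x : is_derive x 'e_i q (eps * (2%:R * x ord0 i0 * (i0 == i)%:R)).
    apply: is_derive_funZ.
    exact: (@is_derive_funX _ _ _ x 'e_i _ 2 (dcoord i x)).
  have lap_le i : s * partial i (partial i h) c + eps * (2%:R * (i0 == i)%:R) <= 0.
    apply: (@partial_partial_at_max Om (fun x => s * h x + q x)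
      (fun x => s * partial i h x + eps * (2%:R * x ord0 i0 * (i0 == i)%:R)) i c) => //.
    - by move=> x Ox; apply: is_derive_funD => //; apply: is_derive_funZ; exact: C1_on_derive Ox.
    - apply: is_derive_funD.
        have [_ [_ /(_ i)[ddi _]]] := dh i.
        by apply: is_derive_funZ; apply: derivable_is_derive; exact: ddi.
      apply: is_derive_funZ.
      have -> : (fun y : E => 2%:R * y ord0 i0 * (i0 == i)%:R) =
                (fun y : E => (2%:R * (i0 == i)%:R) * y ord0 i0) :> (E -> R).
        by apply/funext => y; rewrite mulrAC.
      apply: is_derive_eq (is_derive_funZ _ (dcoord i c)) _.
      by rewrite -mulrA -natrM mulnb andbb.
    - by move=> x Ox; apply: hc; rewrite inE; exact: subset_closure.
  have : \sum_i (s * partial i (partial i h) c + eps * (2%:R * (i0 == i)%:R)) <= 0.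
    by apply: sumr_le0 => i _; exact: lap_le.
  rewrite big_split /= -mulr_sumr -/(laplacian h c) lap0// mulr0 add0r (bigD1 i0)//= eqxx mulr1.
  rewrite big1 => [|i /negbTE ii0]; last by rewrite eq_sym ii0 !mulr0.
  by rewrite addr0 leNgt mulr_gt0.
have [y1 By1 _] := pert 1 ltr01.
have cB : compact (boundary Om).
  apply: (subclosed_compact _ cC); last by move=> y [].
  rewrite /boundary setDE; apply: closedI; first exact: closed_closure.
  by apply: open_closedC; exact: open_interior.
have [||y By ymax] := @EVT_max_rV R n (fun x => s * h x) _ _ cB; first by exists y1.
  by apply: continuous_subspaceW csh => y [].
rewrite inE in By; exists y => //.
apply/ler_addgt0Pr => e e0.
have M1 : 0 < (M + 1) ^+ 2 + 1 by rewrite ltr_wpDl// sqr_ge0.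
have [z Bz hz] := pert (e / ((M + 1) ^+ 2 + 1)) ltac:(by rewrite divr_gt0).
apply: (le_trans hz); apply: lerD; first by apply: ymax; rewrite inE.
by rewrite mulrAC ler_pdivrMr// ler_wpM2l ?ltW// ltrDl.
Qed.

End maximum_principle.

(** * Zero trace and truncation *)

Lemma cvg2_ext d (T : measurableType d) (R : realType)
    (mu : {measure set T -> \bar R}) (D : set T) (u v : nat -> T -> R) (f g : T -> R) :
  (forall n x, D x -> u n x = v n x) -> (forall x, D x -> f x = g x) ->
  cvg2 mu D u f -> cvg2 mu D v g.
Proof.
move=> uv fg; rewrite /cvg2.
suff -> : (fun n => \int[mu]_(x in D) ((u n x - f x) ^+ 2)) =
          (fun n => \int[mu]_(x in D) ((v n x - g x) ^+ 2)) by [].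
apply/funext => n; apply: eq_Rintegral => x; rewrite inE => Dx.
by rewrite uv// fg.
Qed.

Lemma Rintegral_sum d (T : measurableType d) (R : realType)
    (mu : {measure set T -> \bar R}) (D : set T) n (f : 'I_n -> T -> R) :
  measurable D -> (forall i, mu.-integrable D (EFin \o f i)) ->
  \int[mu]_(x in D) (\sum_i f i x) = \sum_i \int[mu]_(x in D) f i x.
Proof.
move=> mD fi.
suff H (s : seq 'I_n) : mu.-integrable D (EFin \o (fun x => \sum_(i <- s) f i x)) /\
    \int[mu]_(x in D) (\sum_(i <- s) f i x) = \sum_(i <- s) \int[mu]_(x in D) f i x.
  exact: (H _).2.
elim: s => [|i s [IHi IHe]].
  split; first by under eq_fun do rewrite big_nil; exact: integrable0.
  rewrite big_nil; under eq_Rintegral do rewrite big_nil.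
  by rewrite Rintegral_cst// mul0r.
split.
  under eq_fun do rewrite big_cons.
  exact: (integrableD mD (fi i) IHi).
rewrite big_cons -IHe -RintegralD//.
by apply: eq_Rintegral => x _; rewrite big_cons.
Qed.

Lemma integrable_fun_sum d (T : measurableType d) (R : realType)
    (mu : {measure set T -> \bar R}) (D : set T) n (f : 'I_n -> T -> R) :
  measurable D -> (forall i, mu.-integrable D (EFin \o f i)) ->
  mu.-integrable D (EFin \o (fun x => \sum_i f i x)).
Proof.
move=> mD fi.
have -> : EFin \o (fun x => \sum_i f i x) = (fun x => \sum_i (f i x)%:E)%E.
  by apply/funext => x; rewrite /= sumEFin.
by apply: integrable_sum => // i _; exact: fi.
Qed.

Lemma cvg_fun_sum (R : realType) n (u : 'I_n -> nat -> R) (l : 'I_n -> R) :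
  (forall i, u i m @[m --> \oo] --> l i) ->
  \sum_i u i m @[m --> \oo] --> \sum_i l i.
Proof.
move=> ul; elim: (index_enum _) => [|i s IH].
  by rewrite big_nil; under eq_fun do rewrite big_nil; exact: cvg_cst.
rewrite big_cons; under eq_fun do rewrite big_cons.
exact: cvgD.
Qed.

Section slices.
Context {R : realType} {n : nat}.
Local Notation E := 'rV[R]_n.
Local Notation dx := (lebesgue_rV R n).
Variables (Om : set E) (oOm : open Om).
Implicit Types (f g h chi th : E -> R) (Df Dth : E -> E).

Let mOm : measurable Om := open_measurable_rV oOm.

(** The inequality [f <= 0] on the boundary for a function of W^(1,2), expressed through
approximations of [f] rather than through a trace operator. *)
Definition nonpos_trace f Df := exists w : nat -> E -> R,
  [/\ forall m, C1_on Om (w m),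
      forall m, exists K, [/\ compact K, K `<=` Om &
        forall x, Om x -> ~ K x -> w m x <= 0],
      forall m, sqint dx Om (w m) /\ forall i, sqint dx Om (partial i (w m)),
      cvg2 dx Om w f &
      forall i, cvg2 dx Om (fun m => partial i (w m)) (fun x => Df x ord0 i)].

(** Composition with a function that vanishes on the negative half-line cuts [f] off near the
boundary. *)
Lemma truncation_C1c f K (k dk : R -> R) : C1_on Om f ->
  compact K -> K `<=` Om -> (forall x, Om x -> ~ K x -> f x <= 0) ->
  (forall s : R, is_derive s 1 k (dk s)) -> continuous dk ->
  (forall s, s <= 0 -> k s = 0) ->
  C1c Om ((k \o f) \_ Om) /\
  forall i x, Om x -> partial i ((k \o f) \_ Om) x = dk (f x) * partial i f x.
Proof.
move=> Cf cK KOm fK kdk cdk k0.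
have eqO x : Om x -> \forall y \near x, k (f y) = ((k \o f) \_ Om) y.
  move=> Ox; apply: filterS (near_open oOm Ox) => y Oy.
  by rewrite patchE mem_set.
have dkf i x : Om x -> is_derive x (delta_mx ord0 i : E) ((k \o f) \_ Om)
    (dk (f x) * partial i f x).
  move=> Ox; apply: (near_eq_is_derive (eqO x Ox)).
  exact: is_derive_comp1 (kdk _) (C1_on_derive i Cf Ox).
split; last by move=> i x Ox; rewrite /partial; have [_] := dkf i x Ox.
apply: (@C1c_intro _ _ Om K) => //.
  move=> x Kx; rewrite patchE; case: ifPn => //; rewrite inE => Ox.
  by rewrite /= k0// fK.
have [cf df] := Cf.
apply: (@C1_on_intro _ _ _ _ (fun i x => dk (f x) * partial i f x)) => //.
- move=> x Ox; apply: near_eq_continuous_at (eqO x Ox) _.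
  apply: (@continuous_comp _ _ _ f k x); first exact: cf.
  exact: is_derive_continuous (kdk _).
- move=> i x Ox; apply: continuous_at_funM; last by have [] := df i x Ox.
  by apply: (@continuous_comp _ _ _ f dk x); [exact: cf|exact: cdk].
Qed.

(** The chain rule, obtained in the limit: along a subsequence the factors [dk (w m)] converge
almost everywhere and boundedly, while the gradients converge in mean square. *)
Lemma truncation_limit f Df (k dk : R -> R) C :
  (forall s : R, is_derive s 1 k (dk s)) -> continuous dk ->
  (forall s, s <= 0 -> k s = 0) -> (forall s, `|dk s| <= C) ->
  sqint dx Om f -> (forall i, sqint dx Om (fun x => Df x ord0 i)) ->
  nonpos_trace f Df ->
  exists psi : nat -> E -> R,
  [/\ forall m, C1c Om (psi m),
      cvg2 dx Om psi (fun x => k (f x)) &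
      forall i, cvg2 dx Om (fun m => partial i (psi m))
                  (fun x => dk (f x) * Df x ord0 i)].
Proof.
move=> kdk cdk k0 dkC sf sDf [w [Cw Kw sw wf Dwf]].
have C0 : 0 <= C := le_trans (normr_ge0 _) (dkC 0).
have [l [ml ae_l]] := cvg2_subseq_ae mOm (fun m => (sw m).1) sf wf.
have mdk : measurable_fun setT dk by exact: continuous_measurable_fun.
have ck : continuous k by move=> s; exact: is_derive_continuous (kdk s).
have mk : measurable_fun setT k by exact: continuous_measurable_fun.
have tr m : C1c Om ((k \o w (l m)) \_ Om) /\ forall i x, Om x ->
    partial i ((k \o w (l m)) \_ Om) x = dk (w (l m) x) * partial i (w (l m)) x.
  have [K [cK KOm wK]] := Kw (l m).
  exact: (truncation_C1c (Cw (l m)) cK KOm wK).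
exists (fun m => (k \o w (l m)) \_ Om); split.
- by move=> m; have [] := tr m.
- apply: (@cvg2_ext _ _ _ _ _ (fun m x => k (w (l m) x)) _ (fun x => k (f x))) => //.
    by move=> m x Ox; rewrite patchE mem_set.
  apply: (@cvg2_lipschitz _ _ _ _ _ mOm (fun m => w (l m)) f k C) => //.
  + move=> x y; have [c _ ->] := MVT_line y x kdk.
    by rewrite normrM ler_wpM2r.
  + by move=> m; exact: (sw _).1.
  + exact: cvg2_reindex ml wf.
- move=> i.
  apply: (@cvg2_ext _ _ _ _ _ (fun m x => dk (w (l m) x) * partial i (w (l m)) x)
    _ (fun x => dk (f x) * Df x ord0 i)) => //.
    by move=> m x Ox; rewrite (tr m).2.
  apply: (@cvg2_bounded_mul _ _ _ _ _ mOm (fun m x => dk (w (l m) x))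
    (fun x => dk (f x)) (fun m => partial i (w (l m))) (fun x => Df x ord0 i) C) => //.
  + move=> m; apply: measurableT_comp => //; exact: (sw _).1.1.
  + by apply: measurableT_comp => //; case: sf.
  + apply: filterS ae_l => x /[apply] wx.
    by apply: (@continuous_cvg _ _ _ _ _ _ dk _ (cdk (f x)) wx).
  + by move=> m; exact: (sw _).2.
  + exact: (cvg2_reindex ml (Dwf i)).
Qed.

(** A function with zero trace is a limit of test functions, which extends the definition
of its weak gradient from smooth to continuously differentiable [chi]. *)
Lemma sobolev1_0_by_parts f Df chi i : sobolev1_0 2%:E Om f Df -> C1c Om chi ->
  \int[dx]_(x in Om) (f x * partial i chi x) =
  - \int[dx]_(x in Om) (Df x ord0 i * chi x).
Proof.
move=> [[Lf LDf _] [phi [Tphi phif Dphif]]] Cchi.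
have sf := Lp_on_sqint Lf; have sDf := Lp_on_sqint (LDf i).
have Cphi m := test_fun_C1c (Tphi m).
have schi := C1c_sqint oOm Cchi; have sdchi := C1c_partial_sqint i oOm Cchi.
have h1 := cvg2_pairing mOm (fun m => C1c_sqint oOm (Cphi m)) sf sdchi
  (Lnorm_cvg2 phif).
have h2 := cvg2_pairing mOm (fun m => C1c_partial_sqint i oOm (Cphi m)) sDf schi
  (Lnorm_cvg2 (Dphif i)).
have e m : \int[dx]_(x in Om) (phi m x * partial i chi x) =
    - \int[dx]_(x in Om) (partial i (phi m) x * chi x).
  by apply: integration_by_parts_C1c => //; apply: C1_onS (Cphi m).1.
move: h1; under eq_fun do rewrite e; move=> h1.
by have := cvg_unique _ h1 (cvgN h2); apply.
Qed.

Lemma solenoidal_test (u : E -> E) (Du : E -> 'M[R]_n) chi :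
  (forall i, sobolev1_0 2%:E Om (fun x => u x ord0 i) (fun x => row i (Du x))) ->
  {ae dx, forall x, Om x -> \tr (Du x) = 0} -> C1c Om chi ->
  \sum_i \int[dx]_(x in Om) (u x ord0 i * partial i chi x) = 0.
Proof.
move=> su trD Cchi.
under eq_bigr do rewrite (sobolev1_0_by_parts _ (su _) Cchi).
have sDu i : sqint dx Om (fun x => row i (Du x) ord0 i).
  by have [[_ /(_ i) + _] _] := su i; exact: Lp_on_sqint.
have schi := C1c_sqint oOm Cchi.
have iD i := integrableM_sqint mOm (sDu i) schi.
rewrite sumrN -Rintegral_sum//; apply/eqP; rewrite oppr_eq0; apply/eqP.
have isum := integrable_fun_sum mOm iD.
suff h : (\int[dx]_(x in Om) (\sum_i row i (Du x) ord0 i * chi x)%:E = 0)%E.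
  by rewrite /Rintegral h.
transitivity (\int[dx]_(x in Om) (cst 0%E x))%E; last by rewrite integral0.
apply: ae_eq_integral => //; first by case/integrableP : isum.
apply: filterS trD => x trx Ox /=; rewrite -mulr_suml.
under eq_bigr do rewrite mxE.
by have := trx Ox; rewrite /mxtrace => ->; rewrite mul0r.
Qed.

(** [th * ramp2 (th - K)] times the gradient of [th] is the gradient of
[ramp_flux K (th - K)], a limit of gradients of functions that can be tested against the
solenoidal field [u]. *)
Lemma transport_term_eq0 (u : E -> E) (Du : E -> 'M[R]_n) th Dth K :
  (forall i, sobolev1_0 2%:E Om (fun x => u x ord0 i) (fun x => row i (Du x))) ->
  {ae dx, forall x, Om x -> \tr (Du x) = 0} ->
  sqint dx Om (fun x => th x - K) -> (forall i, sqint dx Om (fun x => Dth x ord0 i)) ->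
  nonpos_trace (fun x => th x - K) Dth ->
  \sum_i \int[dx]_(x in Om)
    (u x ord0 i * (th x * ramp2 (th x - K) * Dth x ord0 i)) = 0.
Proof.
move=> su trD sth sDth tr.
have cdk : continuous (fun s : R => (s + K) * ramp2 s).
  move=> s; apply: cvgM; last exact: continuous_ramp2.
  by apply: cvgD; [exact: cvg_id|exact: cvg_cst].
have [psi [Cpsi _ Dpsi]] := truncation_limit (is_derive_ramp_flux K) cdk
  (@ramp_flux_le0 R K) (ramp_flux_bound K) sth sDth tr.
have sui i : sqint dx Om (fun x => u x ord0 i).
  by have [[+ _ _] _] := su i; exact: Lp_on_sqint.
have mth : measurable_fun Om (fun x => th x - K) by case: sth.
have sV i : sqint dx Om (fun x => (th x - K + K) * ramp2 (th x - K) * Dth x ord0 i).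
  apply: (@sqintM_bounded _ _ _ _ _ mOm (fun x => (th x - K + K) * ramp2 (th x - K)) _
    (6 + `|K| * 6)) => //; last by move=> x _; exact: ramp_flux_bound.
  by apply: (measurableT_comp (continuous_measurable_fun cdk)).
have lim_i i : \int[dx]_(x in Om) (partial i (psi m) x * u x ord0 i) @[m --> \oo] -->
    \int[dx]_(x in Om) (u x ord0 i * (th x * ramp2 (th x - K) * Dth x ord0 i)).
  have := cvg2_pairing mOm (fun m => C1c_partial_sqint i oOm (Cpsi m)) (sV i) (sui i)
    (Dpsi i).
  under [in X in _ --> X -> _]eq_Rintegral do rewrite subrK mulrC.
  exact.
have lim_sum : \sum_i \int[dx]_(x in Om) (partial i (psi m) x * u x ord0 i)
  @[m --> \oo] --> \sum_i \int[dx]_(x in Om)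
    (u x ord0 i * (th x * ramp2 (th x - K) * Dth x ord0 i)).
  exact: cvg_fun_sum lim_i.
have e m : \sum_i \int[dx]_(x in Om) (partial i (psi m) x * u x ord0 i) = 0.
  rewrite -[RHS](solenoidal_test su trD (Cpsi m)).
  by apply: eq_bigr => i _; apply: eq_Rintegral => x _; rewrite mulrC.
move: lim_sum; under eq_fun do rewrite e; move=> lim_sum.
have c0 : (0 : R) @[_ --> \oo] --> (0 : R) by exact: cvg_cst.
by have := cvg_unique _ lim_sum c0; apply.
Qed.

End slices.

(** * Averages over time windows *)

Section almost_everywhere_connectives.
Context d (T : measurableType d) (R : realType) (mu : {measure set T -> \bar R}).
Implicit Types P Q S : T -> Prop.

Lemma ae_mono P Q : (forall x, P x -> Q x) ->
  {ae mu, forall x, P x} -> {ae mu, forall x, Q x}.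
Proof. exact: filterS. Qed.

Lemma ae_mono2 P Q S : (forall x, P x -> Q x -> S x) ->
  {ae mu, forall x, P x} -> {ae mu, forall x, Q x} -> {ae mu, forall x, S x}.
Proof. exact: filterS2. Qed.

End almost_everywhere_connectives.

Section real_line.
Context {R : realType}.
Local Notation lam := (@lebesgue_measure R).
Implicit Types (f : R -> R) (t h c : R).

Lemma ge0_integral_shift (f : R -> \bar R) h : measurable_fun setT f ->
  (forall t, 0 <= f t)%E -> (\int[lam]_t f (t - h)%R = \int[lam]_t f t)%E.
Proof.
move=> mf f0.
have ms : measurable_fun [set: measurableTypeR R]
    ((fun t => t - h) : _ -> measurableTypeR R) by exact: measurable_funB.
rewrite -[LHS]/(\int[lam]_(t in setT) (f \o (fun t => t - h)%R) t)%E.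
transitivity (\int[pushforward lam ((fun t => t - h)%R : _ -> measurableTypeR R)]_t
    f t)%E.
  by rewrite ge0_integral_pushforward// => t _; exact: f0.
apply: eq_measure_integral => // A mA _; apply/esym.
apply: lebesgue_measure_unique => //= _ [[a b]] _ <-.
rewrite /pushforward (_ : _ @^-1` _ = `]a + h, b + h]%classic); last first.
  by apply/seteqP; split=> t /=; rewrite !in_itv/= ltrBrDr lerBlDr.
rewrite !lebesgue_measure_itv/= !lte_fin ltrD2r.
by case: ifPn => // _; rewrite -!EFinD; congr (_%:E); rewrite opprD addrACA subrr addr0.
Qed.

(** Windows look backwards in time, as the increment of the energy at [t] is controlled by the
past of [t]. *)
Definition window h t : set R := `[t - h, t[.

Lemma measurable_window h t :
  measurable (window h t : set (measurableTypeR R)).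
Proof. exact: measurable_itv. Qed.

Lemma lebesgue_window h t : 0 < h -> lam (window h t) = h%:E.
Proof.
move=> h0; rewrite /window lebesgue_measure_itv/= lte_fin gtrBl h0.
by rewrite -EFinD opprB addrC subrK.
Qed.

Let step (k : nat) : R := k.+1%:R^-1.

Let step_gt0 k : 0 < step k. Proof. by rewrite invr_gt0. Qed.

Lemma locally_integrable_window_average f : locally_integrable setT f ->
  {ae lam, forall t, k.+1%:R * \int[lam]_(s in window k.+1%:R^-1 t) f s
     @[k --> \oo] --> f t}.
Proof.
move=> lf; have := lebesgue_differentiation lf; apply: ae_mono => t ft.
have sh x : nicely_shrinking x (fun k => window (step k) x).
  split; first by move=> k; exact: measurable_window.
  pose r k : {posnum R} := PosNum (mulr_gt0 (ltr0n R 2) (step_gt0 k)).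
  exists (4, r); split => //=.
  - rewrite -(mulr0 2); apply: cvgM; first exact: cvg_cst.
    exact: cvg_harmonic.
  - move=> k y; rewrite /window/= in_itv/= /ball/= => /andP[y1 y2].
    have := step_gt0 k => s0.
    by rewrite ltr_norml; apply/andP; split; lra.
  - move=> k; rewrite lebesgue_measure_ball; last by apply: ltW; rewrite /= mulr_gt0 ?step_gt0.
    rewrite lebesgue_window// -EFinM lee_fin -mulr_natr /=.
    by rewrite le_eqVlt; apply/orP; left; apply/eqP; ring.
have := @nice_lebesgue_differentiation R _ sh f lf t ft.
move=> /fine_cvgP[_]; apply: cvg_trans; apply: near_eq_cvg; apply: nearW => k /=.
rewrite lebesgue_window//= /Rintegral fineM//=.
  by rewrite inver gt_eqF//= /step invrK.
- by rewrite inver gt_eqF.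
- apply: (@integrable_fin_num _ _ _ lam (window (step k) t)).
    exact: measurable_window.
  have [mf _ foo] := lf; apply/integrableP; split.
    by apply/measurable_EFinP; exact: measurable_funTS.
  apply: le_lt_trans (foo `[t - step k, t]%classic _ (@segment_compact _ _ _)) => //.
  apply: ge0_subset_integral => //.
  + exact: measurable_window.
  + by apply/measurable_EFinP; apply: measurableT_comp => //; exact: measurable_funTS.
  + by move=> y; rewrite /window/= !in_itv/= => /andP[-> /ltW ->].
Qed.

Lemma sqint_locally_integrable f : sqint lam setT f -> locally_integrable setT f.
Proof.
move=> [mf foo]; split=> //; first exact: openT.
move=> K _ cK.
have mK : measurable K by exact: closed_measurable (compact_closed _ cK).
have sK : sqint lam K f.
  split; first exact: measurable_funTS.
  apply: le_lt_trans foo; apply: ge0_subset_integral => //.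
    by apply/measurable_EFinP; exact: measurable_funX.
  by move=> x _; rewrite lee_fin sqr_ge0.
have iK : lam.-integrable K (EFin \o f).
  by apply: sqint_integrable => //; exact: compact_finite_measure.
by case/integrableP : iK.
Qed.

Lemma sqint_locally_integrable_sqr f : sqint lam setT f ->
  locally_integrable setT (fun s => f s ^+ 2).
Proof.
move=> sf; apply: open_integrable_locally; first exact: openT.
exact: sqint_integrable2.
Qed.

(** The exceptional set does not depend on [c], because the expansion of the square involves
averages of [f] and [f ^+ 2] only. This allows [c] to depend on [t]. *)
Lemma sqint_window_average f : sqint lam setT f ->
  {ae lam, forall t, forall c,
     k.+1%:R * \int[lam]_(s in window k.+1%:R^-1 t) ((f s - c) ^+ 2)
     @[k --> \oo] --> (f t - c) ^+ 2}.
Proof.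
move=> sf; have [mf _] := sf.
have := locally_integrable_window_average (sqint_locally_integrable sf).
have := locally_integrable_window_average (sqint_locally_integrable_sqr sf).
apply: ae_mono2 => t f2t ft c.
have E k : k.+1%:R * \int[lam]_(s in window k.+1%:R^-1 t) ((f s - c) ^+ 2) =
    k.+1%:R * \int[lam]_(s in window k.+1%:R^-1 t) (f s ^+ 2)
    - 2 * c * (k.+1%:R * \int[lam]_(s in window k.+1%:R^-1 t) f s) + c ^+ 2.
  have mw := measurable_window k.+1%:R^-1 t.
  have woo : (lam (window k.+1%:R^-1 t) < +oo)%E by rewrite lebesgue_window ?ltry.
  have sw : sqint lam (window k.+1%:R^-1 t) f.
    split; first exact: measurable_funTS.
    have [_] := sf; apply: le_lt_trans; apply: ge0_subset_integral => //.
      by apply/measurable_EFinP; exact: measurable_funX.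
    by move=> x _; rewrite lee_fin sqr_ge0.
  have i2 := sqint_integrable2 sw; have i1 := sqint_integrable mw woo sw.
  have i1' : lam.-integrable (window k.+1%:R^-1 t) (EFin \o (fun s => (2 * c) * f s)).
    exact: (integrableZl mw (2 * c) i1).
  have i0 : lam.-integrable (window k.+1%:R^-1 t) (EFin \o (fun s => c ^+ 2)).
    apply: measurable_bounded_integrable => //.
    exists (c ^+ 2); split; first exact: num_real.
    by move=> M cM x _ /=; rewrite ger0_norm ?sqr_ge0// ltW.
  have i3 : lam.-integrable (window k.+1%:R^-1 t)
      (EFin \o (fun s => f s ^+ 2 - (2 * c) * f s)).
    exact: (integrableB mw i2 i1').
  under eq_Rintegral => s _.
    rewrite (_ : (f s - c) ^+ 2 = f s ^+ 2 - (2 * c) * f s + c ^+ 2); last by ring.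
    over.
  rewrite RintegralD// RintegralB// RintegralZl// Rintegral_cst//.
  have k0 : 0 < k.+1%:R^-1 :> R by rewrite invr_gt0.
  rewrite (_ : fine _ = k.+1%:R^-1); last exact: (congr1 fine (lebesgue_window t k0)).
  rewrite mulrDr mulrBr; congr (_ - _ + _).
    by rewrite mulrCA.
  by rewrite mulrCA mulfV ?mulr1// gt_eqF.
under eq_fun do rewrite E.
have -> : (f t - c) ^+ 2 = f t ^+ 2 - (2 * c) * f t + c ^+ 2 by ring.
apply: cvgD; last exact: cvg_cst.
by apply: cvgB => //; apply: cvgM => //; exact: cvg_cst.
Qed.

End real_line.

(** * From increments to an integral inequality *)

Lemma limn_einf_le (R : realType) (u : (\bar R)^nat) (B : \bar R) (N : nat) :
  (forall k, (N <= k)%N -> (u k <= B)%E) -> (limn_einf u <= B)%E.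
Proof.
move=> uB; rewrite limn_einf_lim; apply: lime_le; first exact: is_cvg_einfs.
apply: nearW => k; apply: (@le_trans _ _ (u (maxn k N))).
  by apply: ereal_inf_lbound; exists (maxn k N) => //=; exact: leq_maxl.
by apply: uB; exact: leq_maxr.
Qed.

Definition past (R : realType) (b : R) : set (measurableTypeR R) := [set` `]-oo, b]].

Lemma measurable_past (R : realType) (b : R) : measurable (past b).
Proof. exact: measurable_itv. Qed.

Lemma in_past (R : realType) (b t : R) : (t \in past b) = (t <= b).
Proof. by apply/idP/idP; rewrite ?inE /past/= in_itv. Qed.

Section time_averaging.
Context d (X : measurableType d) (R : realType).
Variable m : {sigma_finite_measure set X -> \bar R}.
Local Notation RR := (measurableTypeR R).
Local Notation lam := (@lebesgue_measure R).
Local Notation P := (lam \x m)%E.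
Variables (n : nat) (F W : 'I_n -> RR * X -> R).
Hypothesis sF : forall i, sqint P setT (F i).
Hypothesis sW : forall i, sqint P setT (W i).

Let in_window (h t s : R) : bool := (t - h <= s) && (s < t).

Let p (z : RR * X) : R := \sum_i F i z ^+ 2.
Let q (z : RR * X) : R := \sum_i W i z ^+ 2.
Let r (z : RR * X) (s : RR) : R := \sum_i (F i (s, z.2) - W i z) ^+ 2.

Let mF i : measurable_fun setT (F i). Proof. by case: (sF i). Qed.
Let mW i : measurable_fun setT (W i). Proof. by case: (sW i). Qed.

Let mp : measurable_fun setT p.
Proof. by apply: measurable_sum => i; exact: measurable_funX. Qed.

Let mq : measurable_fun setT q.
Proof. by apply: measurable_sum => i; exact: measurable_funX. Qed.

Let ip : P.-integrable setT (EFin \o p).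
Proof. by apply: integrable_fun_sum => // i; exact: sqint_integrable2. Qed.

Let iq : P.-integrable setT (EFin \o q).
Proof. by apply: integrable_fun_sum => // i; exact: sqint_integrable2. Qed.

Let p0 z : 0 <= p z. Proof. by apply: sumr_ge0 => i _; exact: sqr_ge0. Qed.
Let q0 z : 0 <= q z. Proof. by apply: sumr_ge0 => i _; exact: sqr_ge0. Qed.
Let r0 z s : 0 <= r z s. Proof. by apply: sumr_ge0 => i _; exact: sqr_ge0. Qed.

Let mr : measurable_fun [set: (RR * X) * RR] (fun y => r y.1 y.2).
Proof.
apply: measurable_sum => i; apply: measurable_funX; apply: measurable_funB.
  apply: (measurableT_comp (mF i)); apply: measurable_fun_pair => /=.
    exact: measurable_snd.
  exact: (measurableT_comp measurable_snd measurable_fst).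
exact: (measurableT_comp (mW i) measurable_fst).
Qed.

Let windowed (h : R) (y : (RR * X) * RR) : \bar R :=
  if in_window h y.1.1 y.2 then (r y.1 y.2)%:E else 0%E.

Let m_windowed h : measurable_fun setT (windowed h).
Proof.
apply: measurable_fun_ifT; last exact: measurable_cst.
  apply: measurable_and.
    apply: measurable_fun_ler; last exact: measurable_snd.
    apply: measurable_funB => //.
    exact: (measurableT_comp measurable_fst measurable_fst).
  apply: measurable_fun_ltr; first exact: measurable_snd.
  exact: (measurableT_comp measurable_fst measurable_fst).
exact/measurable_EFinP.
Qed.

Let windowed0 h y : (0 <= windowed h y)%E.
Proof. by rewrite /windowed; case: ifP => // _; rewrite lee_fin. Qed.

(** The error made when [W] at time [t] is replaced by [F] at the times of the window. *)
Let err h (z : RR * X) : \bar R := (\int[lam]_s windowed h (z, s))%E.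

Let m_err h : measurable_fun setT (err h).
Proof. exact: (@measurable_fun_fubini_tonelli_F _ _ _ _ _ lam (windowed h)). Qed.

Let err0 h z : (0 <= err h z)%E.
Proof. by apply: integral_ge0 => s _; exact: windowed0. Qed.

Let errE h z : (err h z = \int[lam]_(s in window h z.1) (r z s)%:E)%E.
Proof.
rewrite /err [RHS]integral_mkcond; apply: eq_integral => s _.
rewrite patchE /windowed /= /in_window.
have [sw|sw] := boolP (s \in window h z.1).
  by move: sw; rewrite inE /window/= in_itv/= => ->.
by rewrite ifF//; apply/negP => h1; move/negP: sw; apply; rewrite inE /window/= in_itv.
Qed.

(** For fixed [x] this is Lebesgue's differentiation theorem on the line, with the constant
[W i (t, x)] depending on the point [t]. *)
Let err_limit : {ae m, forall x, {ae lam, forall t,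
  (k.+1%:R%:E * err k.+1%:R^-1 (t, x))%E @[k --> \oo] --> (r (t, x) t)%:E}}.
Proof.
have sFx : {ae m, forall x, forall i, sqint lam setT (fun s => F i (s, x))}.
  apply: filter_forall => i.
  have := @ae_integrable2 _ _ _ _ _ lam m _ (sqint_integrable2 (sF i)).
  apply: ae_mono => x ix; apply: integrable2_sqint => //.
  by apply: (measurableT_comp (mF i)); exact: measurable_pair2.
apply: ae_mono sFx => x sFx.
have : {ae lam, forall t, forall i, forall c,
     k.+1%:R * \int[lam]_(s in window k.+1%:R^-1 t) ((F i (s, x) - c) ^+ 2)
     @[k --> \oo] --> (F i (t, x) - c) ^+ 2}.
  by apply: filter_forall => i; exact: sqint_window_average.
apply: ae_mono => t Ft.
have := @cvg_fun_sum R n (fun i k => k.+1%:R * \int[lam]_(s in window k.+1%:R^-1 t)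
  ((F i (s, x) - W i (t, x)) ^+ 2)) _ (fun i => Ft i (W i (t, x))).
move=> lim_r.
suff E k : (k.+1%:R%:E * err k.+1%:R^-1 (t, x))%E =
    (\sum_i k.+1%:R * \int[lam]_(s in window k.+1%:R^-1 t)
       ((F i (s, x) - W i (t, x)) ^+ 2))%:E.
  by under eq_fun do rewrite E; apply: cvg_EFin; [exact: nearW|exact: lim_r].
rewrite errE /=.
have mw := measurable_window k.+1%:R^-1 t.
have woo : (lam (window k.+1%:R^-1 t) < +oo)%E by rewrite lebesgue_window ?ltry ?invr_gt0.
have ii i : lam.-integrable (window k.+1%:R^-1 t)
   (EFin \o (fun s => (F i (s, x) - W i (t, x)) ^+ 2)).
  apply: sqint_integrable2; apply: sqintB => //.
    have [mFx Foo] := sFx i; split; first exact: measurable_funTS.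
    apply: le_lt_trans Foo; apply: ge0_subset_integral => //.
      by apply/measurable_EFinP; exact: measurable_funX.
    by move=> y _; rewrite lee_fin sqr_ge0.
  by apply: (@sqint_bounded _ _ _ _ _ mw _ `|W i (t, x)|) => //; exact: measurable_cst.
rewrite -mulr_sumr -Rintegral_sum// EFinM; congr (_ * _)%E.
rewrite /Rintegral fineK//; apply: integrable_fin_num => //.
exact: integrable_fun_sum.
Qed.

Let integral_err_limit :
  (\int[P]_z limn_einf (fun k => k.+1%:R%:E * err k.+1%:R^-1 z) =
   \int[P]_z (r z z.1)%:E)%E.
Proof.
have mL : measurable_fun setT
    (fun z => limn_einf (fun k => k.+1%:R%:E * err k.+1%:R^-1 z))%E.
  apply: (@emeasurable_fun_cvg _ _ _ _
    (fun l z => einfs (fun k => k.+1%:R%:E * err k.+1%:R^-1 z)%E l)).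
    move=> l; apply: measurable_fun_einfs => k.
    by apply: emeasurable_funM => //; exact: measurable_cst.
  by move=> z _; rewrite limn_einf_lim; exact: is_cvg_einfs.
have L0 z : (0 <= limn_einf (fun k => k.+1%:R%:E * err k.+1%:R^-1 z))%E.
  rewrite limn_einf_lim; apply: lime_ge; first exact: is_cvg_einfs.
  by apply: nearW => k; apply: le_ereal_inf_tmp => _ [l _ <-]; rewrite mule_ge0.
have mD : measurable_fun setT (fun z : RR * X => (r z z.1)%:E).
  apply/measurable_EFinP.
  apply: (@measurableT_comp _ _ _ _ _ _ (fun y : (RR * X) * RR => r y.1 y.2) _
    (fun z => (z, z.1))) => //.
  by apply: measurable_fun_pair.
rewrite fubini_tonelli2// fubini_tonelli2//; last by move=> z; rewrite lee_fin.
apply: ae_eq_integral => //.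
- exact: (@measurable_fun_fubini_tonelli_G _ _ _ _ _ lam).
- apply: (@measurable_fun_fubini_tonelli_G _ _ _ _ _ lam _ mD).
  by move=> z; rewrite lee_fin.
apply: ae_mono err_limit => x rx _.
apply: ae_eq_integral => //.
- by apply: (measurableT_comp mL); exact: measurable_pair2.
- by apply: (measurableT_comp mD); exact: measurable_pair2.
by apply: ae_mono rx => t /cvg_limn_einf_sup[-> _] _.
Qed.

Let Q t := (\int[m]_x (q (t, x))%:E)%E.
Let Pw h (t : RR) := (\int[P]_(z in window h t `*` setT) (p z)%:E)%E.

Let mD h t : measurable (window h t `*` [set: X] : set (RR * X)).
Proof. by apply: measurableX => //; exact: measurable_window. Qed.

Let in_windowP h t s : (s \in window h t) = in_window h t s.
Proof.
by apply/idP/idP => [|sw]; rewrite ?inE /window/= in_itv.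
Qed.

Let mem_D h t (z : RR * X) : (z \in window h t `*` [set: X]) = in_window h t z.1.
Proof.
by rewrite -in_windowP; apply/idP/idP; rewrite !inE => -[].
Qed.

Let integral_q_window h t : 0 < h ->
  (\int[P]_(z in window h t `*` setT) (q (t, z.2))%:E = h%:E * Q t)%E.
Proof.
move=> h0; rewrite integral_mkcond.
have mqt : measurable_fun setT (fun z : RR * X => (q (t, z.2))%:E).
  apply/measurable_EFinP; apply: (measurableT_comp mq).
  by apply: measurable_fun_pair => //; exact: measurable_snd.
rewrite fubini_tonelli1//; last 2 first.
- exact/(measurable_restrictT _ (mD h t))/measurable_funTS.
- by move=> z; rewrite patchE; case: ifP => // _; rewrite lee_fin.
transitivity (\int[lam]_(s in window h t) Q t)%E; last first.
  rewrite integral_cst; last exact: measurable_window.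
  by rewrite muleC; congr (_ * _)%E; exact: lebesgue_window.
rewrite [RHS]integral_mkcond; apply: eq_integral => s _.
rewrite patchE in_windowP /fubini_F; case: ifPn => sw.
  by apply: eq_integral => x _; rewrite patchE mem_D sw.
by apply: integral0_eq => x _; rewrite patchE mem_D (negbTE sw).
Qed.

Let integral_r_window h t : 0 < h ->
  (\int[P]_(z in window h t `*` setT) (r (t, z.2) z.1)%:E =
   \int[m]_x err h (t, x))%E.
Proof.
move=> h0; rewrite integral_mkcond.
have mrt : measurable_fun setT (fun z : RR * X => (r (t, z.2) z.1)%:E).
  apply/measurable_EFinP.
  apply: (@measurableT_comp _ _ _ _ _ _ (fun y : (RR * X) * RR => r y.1 y.2) _
    (fun z : RR * X => ((t, z.2), z.1))) => //.
  apply: measurable_fun_pair => //.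
  by apply: measurable_fun_pair => //; exact: measurable_snd.
rewrite fubini_tonelli2//; last 2 first.
- exact/(measurable_restrictT _ (mD h t))/measurable_funTS.
- by move=> z; rewrite patchE; case: ifP => // _; rewrite lee_fin.
apply: eq_integral => x _; rewrite errE /fubini_G [RHS]integral_mkcond.
by apply: eq_integral => s _; rewrite !patchE mem_D in_windowP.
Qed.

(** The square is completed, after which all terms are non-negative and may be integrated in
time by Tonelli's theorem. *)
Let window_identity h t : 0 < h -> (Q t < +oo)%E ->
  ((\int[P]_(z in window h t `*` setT) (\sum_i 2 * (F i z * W i (t, z.2))))%:E
   + \int[m]_x err h (t, x) = Pw h t + h%:E * Q t)%E.
Proof.
move=> h0 Qoo; have mD' := mD h t.
pose D := window h t `*` [set: X].
have Q0 : (0 <= Q t)%E by apply: integral_ge0 => x _; rewrite lee_fin.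
have mq2 : measurable_fun setT (fun z : RR * X => q (t, z.2)).
  apply: (measurableT_comp mq).
  by apply: measurable_fun_pair => //; exact: measurable_snd.
have iqD : P.-integrable D (EFin \o (fun z => q (t, z.2))).
  apply/integrableP; split; first by apply/measurable_EFinP; exact: measurable_funTS.
  under eq_integral do rewrite /= ger0_norm//.
  by rewrite integral_q_window// lte_mul_pinfty// ?lee_fin ltW.
have ipD : P.-integrable D (EFin \o p) by exact: integrableS ip.
have ipq : P.-integrable D (EFin \o (fun z => p z + q (t, z.2))).
  exact: (integrableD mD' ipD iqD).
pose fw (z : RR * X) := \sum_i 2 * (F i z * W i (t, z.2)).
have mW2 i : measurable_fun setT (fun z : RR * X => W i (t, z.2)).
  apply: (measurableT_comp (mW i)).
  by apply: measurable_fun_pair => //; exact: measurable_snd.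
have mfw : measurable_fun setT fw.
  apply: measurable_sum => i; apply: measurable_funM; first exact: measurable_cst.
  exact: measurable_funM.
have id z : fw z + r (t, z.2) z.1 = p z + q (t, z.2).
  rewrite /fw /r /p /q -!big_split /=; apply: eq_bigr => i _.
  by rewrite -surjective_pairing; ring.
have fw_le z : fw z <= p z + q (t, z.2) by rewrite -id lerDl.
have fw_ge z : - (p z + q (t, z.2)) <= fw z.
  rewrite -subr_ge0 opprK /fw /p /q -!big_split /=; apply: sumr_ge0 => i _.
  set A := F i z; set B := W i _.
  have -> : 2 * (A * B) + (A ^+ 2 + B ^+ 2) = (A + B) ^+ 2 by ring.
  exact: sqr_ge0.
have ifw : P.-integrable D (EFin \o fw).
  apply: le_integrable ipq => //.
    by apply/measurable_EFinP; exact: measurable_funTS.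
  move=> z _ /=; rewrite lee_fin ler_norml (le_trans _ (fw_ge z)) /=; last first.
    by rewrite lerN2 ler_norm.
  by rewrite (le_trans (fw_le z))// ler_norm.
have ir : P.-integrable D (EFin \o (fun z => r (t, z.2) z.1)).
  have -> : (fun z : RR * X => r (t, z.2) z.1) =
            (fun z => (p z + q (t, z.2)) - fw z).
    by apply/funext => z; rewrite -id addrC addKr.
  exact: (integrableB mD' ipq ifw).
rewrite -integral_r_window// -integral_q_window//.
rewrite -/fw -/D {1}/Rintegral fineK; last exact: integrable_fin_num.
rewrite -integralD// /Pw -/D -integralD//.
by apply: eq_integral => z _; rewrite -!EFinD id.
Qed.

Let G s := (\int[m]_x (p (s, x))%:E)%E.

Let measurable_G : measurable_fun setT G.
Proof.
apply: (@measurable_fun_fubini_tonelli_F _ _ _ _ _ m (EFin \o p)).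
  exact/measurable_EFinP.
by move=> z; rewrite lee_fin.
Qed.

Let G0 s : (0 <= G s)%E.
Proof. by apply: integral_ge0 => x _; rewrite lee_fin. Qed.

Let wG h (y : RR * RR) : \bar R := if in_window h y.1 y.2 then G y.2 else 0%E.

Let measurable_wG h : measurable_fun setT (wG h).
Proof.
apply: measurable_fun_ifT; last exact: measurable_cst.
  apply: measurable_and.
    by apply: measurable_fun_ler => //; exact: measurable_funB.
  by apply: measurable_fun_ltr.
exact: (measurableT_comp measurable_G measurable_snd).
Qed.

Let wG0 h y : (0 <= wG h y)%E.
Proof. by rewrite /wG; case: ifP. Qed.

Let PwE h t : (Pw h t = \int[lam]_s wG h (t, s))%E.
Proof.
rewrite /Pw integral_mkcond fubini_tonelli1//; last 2 first.
- apply/(measurable_restrictT _ (mD h t))/measurable_funTS.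
  exact/measurable_EFinP.
- by move=> z; rewrite patchE; case: ifP => // _; rewrite lee_fin.
apply: eq_integral => s _; rewrite /fubini_F /wG /=; case: ifPn => sw.
  by apply: eq_integral => x _; rewrite patchE mem_D sw.
by apply: integral0_eq => x _; rewrite patchE mem_D (negbTE sw).
Qed.

Let measurable_Pw h : measurable_fun [set: RR] (Pw h).
Proof.
have -> : Pw h = fubini_F lam (wG h) by apply/funext => t; rewrite PwE.
exact: (@measurable_fun_fubini_tonelli_F _ _ _ _ _ lam (wG h)).
Qed.

Let integral_Pw h : 0 < h -> (\int[lam]_t Pw h t = h%:E * \int[P]_z (p z)%:E)%E.
Proof.
move=> h0; under eq_integral do rewrite PwE.
rewrite (@fubini_tonelli _ _ RR RR R lam lam (wG h))//.
rewrite (@fubini_tonelli1 _ _ _ _ _ lam m (EFin \o p)); last 2 first.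
- exact/measurable_EFinP.
- by move=> z; rewrite lee_fin.
rewrite -[fubini_F _ _]/G -(@ge0_integralZl _ _ _ lam setT measurableT G)//; last first.
  by rewrite lee_fin ltW.
apply: eq_integral => s _.
pose w : set RR := [set` `](s : R), (s : R) + h]].
transitivity (\int[lam]_(t in w) G s)%E.
  rewrite [RHS]integral_mkcond; apply: eq_integral => t _; rewrite patchE.
  have -> : (t \in w) = in_window h t s.
    by apply/idP/idP; rewrite inE /w/= in_itv/= /in_window => /andP[? ?];
      apply/andP; split; lra.
  by [].
rewrite integral_cst//=; last exact: measurable_itv.
rewrite muleC; congr (_ * _)%E; apply: etrans (lebesgue_measure_itv _) _ => /=.
by rewrite lte_fin ltrDl h0 -EFinD addrC addKr.
Qed.

Let measurable_Q : measurable_fun setT Q.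
Proof.
apply: (@measurable_fun_fubini_tonelli_F _ _ _ _ _ m (EFin \o q)).
  exact/measurable_EFinP.
by move=> z; rewrite lee_fin.
Qed.

Let integral_Q : (\int[lam]_t Q t = \int[P]_z (q z)%:E)%E.
Proof.
rewrite (@fubini_tonelli1 _ _ _ _ _ lam m (EFin \o q))//.
  exact/measurable_EFinP.
Qed.

Let Q_lty : {ae lam, forall t, (Q t < +oo)%E}.
Proof.
have := @ae_integrable1 _ _ _ _ _ lam m _ iq.
apply: ae_mono => t /integrableP[_]; apply: le_lt_trans.
apply: ge0_le_integral => //.
- by move=> x _; rewrite lee_fin.
- by apply/measurable_EFinP; apply: (measurableT_comp mq); exact: measurable_pair1.
- apply/measurable_EFinP; apply: measurableT_comp => //.
  by apply: (measurableT_comp mq); exact: measurable_pair1.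
- by move=> x _; rewrite lee_fin ler_norm.
Qed.

Section increments.
Variables (T : R) (a : R -> R).
Hypothesis ma : measurable_fun [set: RR] a.
Hypothesis a0 : forall t, 0 <= a t.
Hypothesis a_out : forall t, t <= 0 -> a t = 0.
Hypothesis a_fin : (\int[lam]_t (a t)%:E < +oo)%E.
Hypothesis a_incr : forall h, 0 < h -> {ae lam, forall t,
  2 * Num.max 0 (T - t) * (a t - a (t - h)) <=
  \int[P]_(z in window h t `*` setT) (\sum_i 2 * (F i z * W i (t, z.2)))}.

Let c t := Num.max 0 (T - t).
Let c0 t : 0 <= c t. Proof. by rewrite le_max lexx. Qed.
Let mc : measurable_fun [set: RR] c.
Proof.
by apply: measurable_maxr; [exact: measurable_cst|exact: measurable_funB].
Qed.

Let ma_shift h : measurable_fun [set: RR] (fun t => a (t - h)).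
Proof. by apply: (measurableT_comp ma); exact: measurable_funB. Qed.

(** The inequality [a_incr] integrated in time, once the products have been replaced by
squares. *)
Let energy_step h : 0 < h ->
  (\int[lam]_t (2 * c t * a t)%:E + \int[P]_z err h z <=
   \int[lam]_t (2 * c t * a (t - h)%R)%:E
   + (h%:E * \int[P]_z (p z)%:E + h%:E * \int[P]_z (q z)%:E))%E.
Proof.
move=> h0.
have h00 : (0 <= h%:E)%E by rewrite lee_fin ltW.
have m1 : measurable_fun [set: RR] (fun t => (2 * c t * a t)%:E).
  apply/measurable_EFinP; apply: measurable_funM => //.
  exact: measurable_funM.
have m2 : measurable_fun [set: RR] (fun t => (2 * c t * a (t - h))%:E).
  apply/measurable_EFinP; apply: measurable_funM => //.
  exact: measurable_funM.
have m3 : measurable_fun [set: RR] (fun t => \int[m]_x err h (t, x))%E.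
  exact: (@measurable_fun_fubini_tonelli_F _ _ _ _ _ m (err h)).
have n1 t : (0 <= (2 * c t * a t)%:E)%E by rewrite lee_fin !mulr_ge0.
have n2 t : (0 <= (2 * c t * a (t - h))%:E)%E by rewrite lee_fin !mulr_ge0.
have n3 t : (0 <= \int[m]_x err h (t, x))%E by exact: integral_ge0.
have n4 t : (0 <= Pw h t)%E by apply: integral_ge0 => z _; rewrite lee_fin.
have n5 t : (0 <= Q t)%E by apply: integral_ge0 => z _; rewrite lee_fin.
have m5 : measurable_fun [set: RR] (fun t => h%:E * Q t)%E.
  by apply: emeasurable_funM => //; exact: measurable_cst.
have n6 t : (0 <= h%:E * Q t)%E by rewrite mule_ge0.
have m6 : measurable_fun [set: RR] (fun t => Pw h t + h%:E * Q t)%E.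
  exact: emeasurable_funD.
have n7 t : (0 <= Pw h t + h%:E * Q t)%E by rewrite adde_ge0.
have E1 : (\int[lam]_t (2 * c t * a t)%:E + \int[P]_z err h z =
           \int[lam]_t ((2 * c t * a t)%:E + \int[m]_x err h (t, x)))%E.
  rewrite fubini_tonelli1//.
  by rewrite (@ge0_integralD _ RR R lam setT measurableT _ _ _ m1 _ m3).
have E2 : (\int[lam]_t (2 * c t * a (t - h)%R)%:E
           + (h%:E * \int[P]_z (p z)%:E + h%:E * \int[P]_z (q z)%:E) =
           \int[lam]_t ((2 * c t * a (t - h)%R)%:E + (Pw h t + h%:E * Q t)))%E.
  rewrite (@ge0_integralD _ RR R lam setT measurableT _ _ _ m2 _ m6)//.
  congr (_ + _)%E.
  rewrite (@ge0_integralD _ RR R lam setT measurableT _ _ _ (measurable_Pw h) _ m5)//.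
  by rewrite integral_Pw// -integral_Q (@ge0_integralZl _ RR R lam setT measurableT).
rewrite E1 E2.
apply: (@ae_ge0_le_integral _ RR R lam setT) => //.
- by move=> t _; rewrite adde_ge0.
- exact: emeasurable_funD.
- by move=> t _; apply: adde_ge0; [exact: n2|exact: n7].
- exact: emeasurable_funD.
apply: ae_mono2 (a_incr h0) Q_lty => t at_incr Qt _.
rewrite -window_identity// [leRHS]addeA; apply: leeD2r; rewrite -EFinD lee_fin.
by rewrite -lerBlDl -mulrBr.
Qed.

(** A change of variables moves the shift from [a] to the weight, whose increment is [h] up to
time [T - h]. *)
Let shift_step h : 0 < h ->
  (\int[lam]_t (2 * c t * a (t - h)%R)%:E
   + (2 * h)%:E * \int[lam]_(t in past (T - h)%R) (a t)%:E
   <= \int[lam]_t (2 * c t * a t)%:E)%E.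
Proof.
move=> h0.
have -> : (\int[lam]_t (2 * c t * a (t - h)%R)%:E =
           \int[lam]_t (2 * c (t + h)%R * a t)%:E)%E.
  rewrite -(@ge0_integral_shift R (fun t => (2 * c (t + h) * a t)%:E) h).
  - by apply: eq_integral => t _; rewrite subrK.
  - apply/measurable_EFinP; apply: measurable_funM => //.
    apply: measurable_funM => //; apply: (measurableT_comp mc).
    exact: measurable_funD.
  - by move=> t; rewrite lee_fin !mulr_ge0.
have mA := measurable_past (T - h).
have m0 : measurable_fun [set: RR] (fun t => (2 * h)%:E * (a t)%:E)%E.
  by apply/measurable_EFinP; exact: measurable_funM.
have m1 : measurable_fun [set: RR] (fun t => (2 * c (t + h)%R * a t)%:E).
  apply/measurable_EFinP; apply: measurable_funM => //.
  apply: measurable_funM => //; apply: (measurableT_comp mc).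
  exact: measurable_funD.
have m2 : measurable_fun [set: RR]
    ((fun t => (2 * h)%:E * (a t)%:E)%E \_ (past (T - h))).
  exact/(measurable_restrictT _ mA)/measurable_funTS.
have n1 t : (0 <= (2 * c (t + h)%R * a t)%:E)%E by rewrite lee_fin !mulr_ge0.
have n2 t : (0 <= ((fun t => (2 * h)%:E * (a t)%:E)%E \_ (past (T - h))) t)%E.
  rewrite patchE; case: ifP => // _.
  by rewrite -EFinM lee_fin !mulr_ge0// ltW.
rewrite -(@ge0_integralZl _ RR R lam _ mA); last 3 first.
- by apply/measurable_EFinP; exact: measurable_funTS.
- by move=> t _; rewrite lee_fin.
- by rewrite lee_fin mulr_ge0// ltW.
rewrite [X in (_ + X)%E]integral_mkcond.
rewrite -(@ge0_integralD _ RR R lam setT measurableT _ _ _ m1 _ m2)//.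
apply: (@ge0_le_integral _ RR R lam setT measurableT) => //.
- by move=> t _; apply: adde_ge0; [exact: n1|exact: n2].
- exact: emeasurable_funD.
- apply/measurable_EFinP; apply: measurable_funM => //.
  exact: measurable_funM.
move=> t _; rewrite patchE in_past; case: ifPn => [tTh|_].
  rewrite -EFinM -EFinD lee_fin -mulrDl ler_wpM2r// /c.
  by rewrite !max_r; lra.
rewrite adde0 lee_fin ler_wpM2r// ler_wpM2l// /c.
by rewrite ge_max c0 /= le_max; apply/orP; right; lra.
Qed.

(** The two steps are combined at [h = 1 / k]. The error is [p + q] minus twice the product, so
that Fatou's lemma, which bounds the limit error from below, bounds the integral of [a] from
above. *)
Lemma time_averaging T' : T' < T ->
  (\int[lam]_(t in past T') (a t)%:E <=
   (\int[P]_z (\sum_i (F i z * W i z)))%:E)%E.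
Proof.
move=> T'T.
set A' := (\int[lam]_(t in past T') (a t)%:E)%E.
pose Ip := (\int[P]_z (p z)%:E)%E; pose Iq := (\int[P]_z (q z)%:E)%E.
have Ipf : Ip \is a fin_num by exact: (integrable_fin_num _ ip).
have Iqf : Iq \is a fin_num by exact: (integrable_fin_num _ iq).
have A'0 : (0 <= A')%E by apply: integral_ge0 => t _; rewrite lee_fin.
have A'f : A' \is a fin_num.
  rewrite ge0_fin_numE//; apply: le_lt_trans a_fin.
  apply: ge0_subset_integral => //.
  - exact: measurable_past.
  - exact/measurable_EFinP.
  - by move=> t _; rewrite lee_fin.
have [N HN] : exists N : nat, forall k, (N <= k)%N -> k.+1%:R^-1 <= T - T'.
  have [N] : exists k, 0 + k.+1%:R^-1 < T - T' by apply: ltr_add_invr; lra.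
  rewrite add0r => HN; exists N => k Nk; apply: le_trans (ltW HN).
  by rewrite lef_pV2 ?posrE// ler_nat.
have step k : (N <= k)%N ->
    (k.+1%:R%:E * \int[P]_z err k.+1%:R^-1 z <= Ip + Iq - 2%:E * A')%E.
  move=> Nk; set h : R := k.+1%:R^-1.
  have h0 : 0 < h by rewrite invr_gt0.
  have hk : k.+1%:R * h = 1 by rewrite mulfV// gt_eqF.
  have A'h : (A' <= \int[lam]_(t in past (T - h)%R) (a t)%:E)%E.
    apply: ge0_subset_integral => //.
    - exact: measurable_past.
    - exact: measurable_past.
    - by apply/measurable_EFinP; exact: measurable_funTS.
    - by move=> t _; rewrite lee_fin.
    - move=> t; rewrite /past/= !in_itv/= => tT'; apply: le_trans tT' _.
      by have := HN k Nk; rewrite -/h; lra.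
  have s1 := energy_step h0; have s2 := shift_step h0.
  set A1 := (\int[lam]_t (2 * c t * a t)%:E)%E in s1 s2.
  set A2 := (\int[lam]_t (2 * c t * a (t - h)%R)%:E)%E in s1 s2.
  set I := (\int[P]_z err h z)%E in s1 *.
  have A20 : (0 <= A2)%E by apply: integral_ge0 => t _; rewrite lee_fin !mulr_ge0.
  have I0 : (0 <= I)%E by exact: integral_ge0.
  have A1f : A1 \is a fin_num.
    rewrite ge0_fin_numE; last by apply: integral_ge0 => t _; rewrite lee_fin !mulr_ge0.
    apply: (@le_lt_trans _ _ (\int[lam]_t ((2 * `|T|)%:E * (a t)%:E))%E).
      apply: ge0_le_integral => //.
      - by move=> t _; rewrite lee_fin !mulr_ge0.
      - apply/measurable_EFinP; apply: measurable_funM => //.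
        exact: measurable_funM.
      - by apply/measurable_EFinP; apply: measurable_funM.
      - move=> t _; rewrite -EFinM lee_fin.
        have [t0|t0] := leP t 0; first by rewrite a_out// !mulr0.
        rewrite ler_wpM2r// ler_wpM2l// /c ge_max normr_ge0 /=.
        by have := ler_norm T; lra.
    rewrite (@ge0_integralZl _ RR R lam setT measurableT); last 3 first.
    - exact/measurable_EFinP.
    - by move=> t _; rewrite lee_fin.
    - by rewrite lee_fin mulr_ge0.
    by rewrite lte_mul_pinfty// lee_fin mulr_ge0.
  have Ah0 : (0 <= \int[lam]_(t in past (T - h)%R) (a t)%:E)%E.
    by apply: integral_ge0 => t _; rewrite lee_fin.
  have s2' : (A2 + (2 * h)%:E * A' <= A1)%E.
    apply: le_trans s2; apply: leeD2l; apply: lee_wpmul2l => //.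
    by rewrite lee_fin mulr_ge0// ltW.
  have A2f : A2 \is a fin_num.
    rewrite ge0_fin_numE//; apply: le_lt_trans (_ : (A1 < +oo)%E).
      by apply: le_trans s2'; rewrite leeDl// mule_ge0// lee_fin mulr_ge0// ltW.
    by move: A1f; rewrite ge0_fin_numE//; apply: integral_ge0 => t _;
      rewrite lee_fin !mulr_ge0.
  have If : I \is a fin_num.
    rewrite ge0_fin_numE//; apply: le_lt_trans (_ : ((A2 + (h%:E * Ip + h%:E * Iq)) < +oo)%E).
      apply: le_trans s1; rewrite leeDr//.
      by apply: integral_ge0 => t _; rewrite lee_fin !mulr_ge0.
    by rewrite -(fineK A2f) -(fineK Ipf) -(fineK Iqf) ltry.
  move: s1 s2'; rewrite -/Ip -/Iq -(fineK A1f) -(fineK A2f) -(fineK If).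
  rewrite -(fineK Ipf) -(fineK Iqf) -(fineK A'f) -!EFinM -!EFinD !lee_fin.
  set x1 := fine A1; set x2 := fine A2; set xI := fine I; set xp := fine Ip.
  set xq := fine Iq; set xA := fine A' => s1 s2''.
  have s3 : xI <= h * (xp + xq - 2 * xA) by nra.
  have : k.+1%:R * xI <= k.+1%:R * (h * (xp + xq - 2 * xA)) by rewrite ler_wpM2l.
  by rewrite mulrA hk mul1r.
have ft := @fatou _ _ _ P setT measurableT
  (fun k z => k.+1%:R%:E * err k.+1%:R^-1 z)%E _ _.
have {}ft : (\int[P]_z (r z z.1)%:E <= Ip + Iq - 2%:E * A')%E.
  rewrite -integral_err_limit; apply: le_trans (ft _ _) _.
  - by move=> k; apply: emeasurable_funM => //; exact: measurable_cst.
  - by move=> k z _; rewrite mule_ge0.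
  apply: (@limn_einf_le _ _ _ N) => k Nk.
  by rewrite ge0_integralZl//; exact: step.
have ipq : P.-integrable setT (EFin \o (fun z => p z + q z)).
  exact: (integrableD measurableT ip iq).
have iFW i : P.-integrable setT (EFin \o (fun z => F i z * W i z)).
  exact: integrableM_sqint.
have isFW : P.-integrable setT (EFin \o (fun z => \sum_i F i z * W i z)).
  exact: integrable_fun_sum.
have i2FW : P.-integrable setT (EFin \o (fun z => 2 * \sum_i F i z * W i z)).
  exact: (integrableZl measurableT 2 isFW).
have rE : (\int[P]_z (r z z.1)%:E =
    Ip + Iq - 2%:E * (\int[P]_z (\sum_i (F i z * W i z)))%:E)%E.
  have -> : (fun z : RR * X => (r z z.1)%:E) =
      (fun z => (p z + q z)%:E - (2 * \sum_i F i z * W i z)%:E)%E.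
    apply/funext => z; rewrite -EFinB; congr (_%:E).
    rewrite /r /p /q -big_split /= mulr_sumr -sumrB; apply: eq_bigr => i _.
    by rewrite -surjective_pairing; ring.
  rewrite integralB//; congr (_ - _)%E.
    by rewrite (integralD _ ip iq).
  rewrite /Rintegral fineK; last exact: (integrable_fin_num _ isFW).
  by rewrite -(integralZl _ isFW)//.
move: ft; rewrite rE -(fineK Ipf) -(fineK Iqf) -(fineK A'f) -!EFinM -!EFinD.
by rewrite !lee_fin lerD2l lerN2 ler_pM2l.
Qed.

End increments.

End time_averaging.

(** * The heat equation tested against functions of space *)

Section heat_equation_in_space.
Context {R : realType} {d : nat}.
Local Notation E := 'rV[R]_d.
Local Notation dx := (lebesgue_rV R d).
Local Notation dtdx := (lebesgue_time_rV R d).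

Let pos2 (s : R) := Num.max 0 s ^+ 2.

Let is_derive_pos2 (s : R) : is_derive s 1 pos2 (2 * Num.max 0 s).
Proof.
apply: (@is_derive_right_extension R (fun r => r ^+ 2) (fun r => 2 * r) 1).
- by rewrite expr0n.
- by rewrite mulr0.
- move=> r _; apply: is_derive_eq (is_derive_funX 2 (is_derive_id r (1 : R))) _.
  by rewrite expr1 mulr1.
- by move=> r _; rewrite mul1r ger0_norm ?sqr_ge0.
Qed.

Let pos2_le0 s : s <= 0 -> pos2 s = 0.
Proof. by move=> s0; rewrite /pos2 max_l// expr0n. Qed.

Let pos2_ge1 s : 1 <= s -> 1 <= pos2 s.
Proof. by move=> s1; rewrite /pos2 max_r; [rewrite expr_ge1//|]; lra. Qed.

Let pos2_ge0 s : 0 <= pos2 s. Proof. exact: sqr_ge0. Qed.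

(** Equal to 1 on [0, T], and non-positive at distance at least 1 from it. *)
Let inner (T s : R) := 1 - pos2 (s - T) - pos2 (- s).

Let cutoff (T s : R) := pos2 (inner T s).

Let cutoff' (T s : R) :=
  2 * Num.max 0 (inner T s) * (2 * Num.max 0 (- s) - 2 * Num.max 0 (s - T)).

Let is_derive_cutoff (T s : R) : is_derive s 1 (cutoff T) (cutoff' T s).
Proof.
apply: is_derive_comp1; first exact: is_derive_pos2.
have d1 : is_derive s 1 (fun t : R => pos2 (t - T)) (2 * Num.max 0 (s - T) * (1 - 0)).
  have h : is_derive s 1 (fun t : R => t - T) (1 - 0).
    exact: is_derive_funB (is_derive_id s (1 : R)) (is_derive_fun_cst s 1 T).
  exact: (@is_derive_comp1 R R^o pos2 (fun t => t - T) s 1 _ _ (is_derive_pos2 (s - T)) h).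
have d2 : is_derive s 1 (fun t : R => pos2 (- t)) (2 * Num.max 0 (- s) * (0 - 1)).
  have -> : (fun t : R => pos2 (- t)) = (fun t => pos2 (0 - t)).
    by apply/funext => t; rewrite sub0r.
  have h : is_derive s 1 (fun t : R => 0 - t) (0 - 1).
    exact: is_derive_funB (is_derive_fun_cst s 1 0) (is_derive_id s (1 : R)).
  have := @is_derive_comp1 R R^o pos2 (fun t => 0 - t) s 1 _ _ (is_derive_pos2 (0 - s)) h.
  by rewrite [X in Num.max 0 X]sub0r.
apply: is_derive_eq (is_derive_funB (is_derive_funB (is_derive_fun_cst s 1 1) d1) d2) _.
by rewrite subr0 mulr1 sub0r sub0r mulrN1 opprK addrC.
Qed.

Let continuous_max0 (f : R -> R) (s : R) :
  {for s, continuous f} -> {for s, continuous (fun t => Num.max 0 (f t))}.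
Proof.
move=> cf; apply: (@continuous_max _ _ (cst 0) f s); last exact: cf.
exact: cvg_cst.
Qed.

Let continuous_cutoff T : continuous (cutoff T).
Proof. by move=> s; exact: is_derive_continuous (is_derive_cutoff T s). Qed.

Let continuous_cutoff' T : continuous (cutoff' T).
Proof.
have cid (s : R) : {for s, continuous (fun t : R => t)} by exact: cvg_id.
have cneg (s : R) : {for s, continuous (fun t : R => - t)}.
  exact: (continuousN (cid s)).
have csub (s : R) : {for s, continuous (fun t : R => t - T)}.
  by apply: continuous_at_funB => //; exact: continuous_at_cst.
have cinner (s : R) : {for s, continuous (inner T)}.
  apply: continuous_at_funB; first apply: continuous_at_funB.
  - exact: continuous_at_cst.
  - exact: continuous_at_sqr (continuous_max0 (csub s)).
  - exact: continuous_at_sqr (continuous_max0 (cneg s)).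
move=> s; apply: (@continuous_at_funM _ _ (fun s => 2 * Num.max 0 (inner T s))
  (fun s => 2 * Num.max 0 (- s) - 2 * Num.max 0 (s - T))).
  apply: continuous_at_funM; first exact: continuous_at_cst.
  exact: continuous_max0.
apply: continuous_at_funB; apply: continuous_at_funM; try exact: continuous_at_cst.
  exact: continuous_max0.
exact: continuous_max0.
Qed.

Let cutoff_eq1 T s : 0 <= s <= T -> cutoff T s = 1.
Proof.
move=> /andP[s0 sT]; rewrite /cutoff /inner (@pos2_le0 (s - T)); last lra.
by rewrite (@pos2_le0 (- s)) ?oppr_le0// !subr0 /pos2 max_r ?expr1n.
Qed.

Let cutoff'_eq0 T s : 0 <= s <= T -> cutoff' T s = 0.
Proof.
move=> /andP[s0 sT]; rewrite /cutoff' (@max_l _ _ 0 (- s)) ?(@max_l _ _ 0 (s - T)); lra.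
Qed.

Let cutoff_eq0 T s : ~ (`[-1, T + 1]%classic s) -> cutoff T s = 0.
Proof.
move=> /= sT; rewrite /cutoff; apply: pos2_le0; rewrite /inner.
have p1 := pos2_ge0 (s - T); have p2 := pos2_ge0 (- s).
have [s1|s1] := leP (-1) s; last by have := @pos2_ge1 (- s); lra.
have [s2|s2] := leP s (T + 1); last by have := @pos2_ge1 (s - T); lra.
by case: sT; rewrite in_itv/= s1 s2.
Qed.

Let test_fun_time_cutoff (Om : set E) T psi : open Om -> C1c Om psi ->
  test_fun_time Om (fun s x => cutoff T s * psi x).
Proof.
move=> oOm [[cpsi dpsi] [K [cK KOm psiK]]].
have c1 (f : R -> R) (z : R * E) : continuous f ->
    {for z, continuous (fun z : R * E => f z.1)}.
  move=> cf; apply: (@continuous_comp _ _ _ fst f z); first exact: cvg_fst.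
  exact: cf.
have c2 (f : E -> R) (z : R * E) : (forall x, {for x, continuous f}) ->
    {for z, continuous (fun z : R * E => f z.2)}.
  move=> cf; apply: (@continuous_comp _ _ _ snd f z); first exact: cvg_snd.
  exact: cf.
have cM (a : R -> R) (b : E -> R) : continuous a -> (forall x, {for x, continuous b}) ->
    continuous (fun z : R * E => a z.1 * b z.2).
  move=> ca cb z.
  exact: (@continuous_at_funM (R * E)%type R (fun z => a z.1) (fun z => b z.2) z
    (c1 a z ca) (c2 b z cb)).
have cpsi' x : {for x, continuous psi} by exact: cpsi.
have dt (s : R) x : is_derive s 1 (fun s : R => cutoff T s * psi x) (psi x * cutoff' T s).
  have -> : (fun s => cutoff T s * psi x) = (fun s => psi x * cutoff T s).
    by apply/funext => r; rewrite mulrC.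
  exact: is_derive_funZ.
have dxi i s x : is_derive x (delta_mx ord0 i : E) (fun y => cutoff T s * psi y)
    (cutoff T s * partial i psi x).
  apply: is_derive_funZ; apply: derivable_is_derive; exact: (dpsi i x Logic.I).1.
split.
- exact: cM.
- split; first by move=> t x; have [] := dt t x.
  have -> : (fun z : R * E => time_derivative (fun s x => cutoff T s * psi x) z.1 z.2) =
            (fun z => cutoff' T z.1 * psi z.2).
    apply/funext => z; rewrite /time_derivative derive1E.
    by rewrite mulrC; have [_] := dt z.1 z.2.
  exact: cM.
- move=> i; split; first by move=> t x; have [] := dxi i t x.
  have -> : (fun z : R * E => partial i (fun x => cutoff T z.1 * psi x) z.2) =
            (fun z => cutoff T z.1 * partial i psi z.2).
    by apply/funext => z; rewrite /partial; have [_] := dxi i z.1 z.2.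
  by apply: cM => // x; exact: (dpsi i x Logic.I).2.
- exists (`[-1, T + 1]%classic `*` K); split.
  + by apply: compact_setX => //; exact: segment_compact.
  + by move=> [t x] [_ /KOm].
  + move=> t x /= tx; have [It|It] := pselect (`[-1, T + 1]%classic t).
      by rewrite psiK ?mulr0// => Kx; apply: tx.
    by rewrite cutoff_eq0 ?mul0r.
Qed.

(** Admissible test functions have compact support in time; a function of space is multiplied
by a cutoff that equals one on the interval of integration. *)
Lemma heat_equation_space_test (Om : set E) kappa u th Dth tau psi : open Om ->
  heat_equation Om kappa u th Dth -> 0 < tau -> C1c Om psi ->
  \int[dx]_(x in Om) (th tau x * psi x) - \int[dx]_(x in Om) (th 0 x * psi x) =
  \int[dtdx]_(z in cylinder tau Om)
    (\sum_i (th z.1 z.2 * u z.1 z.2 ord0 i - kappa * Dth z.1 z.2 ord0 i)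
            * partial i psi z.2).
Proof.
move=> oOm heat tau0 Cpsi.
have := heat tau _ tau0 (test_fun_time_cutoff tau oOm Cpsi).
under eq_Rintegral do rewrite cutoff_eq1 ?lexx ?ltW// mul1r.
under [X in _ - X = _ -> _]eq_Rintegral do rewrite cutoff_eq1 ?lexx ?ltW// mul1r.
move=> ->; apply: eq_Rintegral => -[t x]; rewrite inE => -[/= t_in _].
move: t_in; rewrite in_itv/= => /andP[t0 ttau].
have tI : 0 <= t <= tau by rewrite !ltW.
have -> : time_derivative (fun s y => cutoff tau s * psi y) t x = 0.
  rewrite /time_derivative derive1E.
  have -> : (fun s => cutoff tau s * psi x) = (fun s => psi x * cutoff tau s).
    by apply/funext => r; rewrite mulrC.
  have [_ ->] := is_derive_funZ (psi x) (is_derive_cutoff tau t).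
  by rewrite cutoff'_eq0 ?mulr0.
have pE i : partial i (fun y => cutoff tau t * psi y) x = partial i psi x.
  have -> : (fun y => cutoff tau t * psi y) = psi.
    by apply/funext => y; rewrite cutoff_eq1// mul1r.
  by [].
under eq_bigr do rewrite pE.
under [X in _ - kappa * X]eq_bigr do rewrite pE.
rewrite mulr0 add0r !mulr_sumr -sumrB; apply: eq_bigr => i _.
by rewrite mulrBl !mulrA.
Qed.

End heat_equation_in_space.

(** * Slabs *)

Lemma sqintM_ae_bounded d (X : measurableType d) (R : realType)
    (mu : {measure set X -> \bar R}) (D : set X) (a f : X -> R) C : measurable D ->
  measurable_fun D a -> {ae mu, forall x, D x -> `|a x| <= C} ->
  sqint mu D f -> sqint mu D (fun x => a x * f x).
Proof.
move=> mD ma aC [mf foo]; split; first exact: measurable_funM.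
apply: (@le_lt_trans _ _ (\int[mu]_(x in D) ((C ^+ 2)%:E * (f x ^+ 2)%:E))%E).
  apply: ae_ge0_le_integral => //.
  - by move=> x _; rewrite lee_fin sqr_ge0.
  - by apply/measurable_EFinP; apply: measurable_funX; exact: measurable_funM.
  - by move=> x _; rewrite -EFinM lee_fin mulr_ge0 ?sqr_ge0.
  - by apply/measurable_EFinP; apply: measurable_funM => //; exact: measurable_funX.
  apply: ae_mono aC => x /[apply] aC.
  rewrite -EFinM lee_fin exprMn ler_wpM2r ?sqr_ge0// -real_normK ?num_real//.
  by rewrite lerXn2r ?nnegrE// (le_trans _ aC).
rewrite ge0_integralZl//.
- by rewrite lte_mul_pinfty// lee_fin sqr_ge0.
- by apply/measurable_EFinP; exact: measurable_funX.
- by move=> x _; rewrite lee_fin sqr_ge0.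
- by rewrite lee_fin sqr_ge0.
Qed.

Lemma sqintS d (X : measurableType d) (R : realType)
    (mu : {measure set X -> \bar R}) (A B : set X) (f : X -> R) :
  measurable A -> measurable B -> A `<=` B -> sqint mu B f -> sqint mu A f.
Proof.
move=> mA mB AB sf; apply: integrable2_sqint => //.
  by case: sf => mf _; exact: measurable_funS mf.
exact: integrableS (sqint_integrable2 sf).
Qed.

Lemma sqint_restrict d (X : measurableType d) (R : realType)
    (mu : {measure set X -> \bar R}) (D : set X) (f : X -> R) :
  measurable D -> sqint mu D f -> sqint mu setT (f \_ D).
Proof.
move=> mD [mf foo]; split; first exact/(measurable_restrictT _ mD).
move: foo; rewrite [X in (X < _)%E]integral_mkcond; congr (_ < _)%E.
apply: eq_integral => x _; rewrite !patchE.
by case: ifP => // _; rewrite expr0n.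
Qed.

Section slabs.
Context d (X : measurableType d) (R : realType).
Variable m : {sigma_finite_measure set X -> \bar R}.
Local Notation RR := (measurableTypeR R).
Local Notation lam := (@lebesgue_measure R).
Local Notation P := (lam \x m)%E.
Variables (A : set RR) (D : set X).
Hypotheses (mA : measurable A) (Aoo : (lam A < +oo)%E) (mD : measurable D).

Let mAD : measurable (A `*` D : set (RR * X)).
Proof. exact: measurableX. Qed.

Lemma measurable_fun_slab (f : X -> R) : measurable_fun D f ->
  measurable_fun (A `*` D) (fun z : RR * X => f z.2).
Proof.
move=> mf; apply: (@measurable_comp _ _ _ _ _ _ D) => //.
  by move=> x [z [_ ?] <-].
by apply: measurable_funTS; exact: measurable_snd.
Qed.

Lemma integral_slab (f : X -> R) : measurable_fun D f -> (forall x, D x -> 0 <= f x) ->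
  (\int[P]_(z in A `*` D) (f z.2)%:E = lam A * \int[m]_(x in D) (f x)%:E)%E.
Proof.
move=> mf f0; rewrite integral_mkcond fubini_tonelli1//; last 2 first.
- apply/(measurable_restrictT _ mAD); apply/measurable_EFinP.
  exact: measurable_fun_slab.
- move=> z; rewrite patchE; case: ifPn => // /set_mem[_ ?].
  by rewrite lee_fin f0.
transitivity (\int[lam]_(s in A) (\int[m]_(x in D) (f x)%:E))%E; last first.
  by rewrite integral_cst// muleC.
rewrite [RHS]integral_mkcond; apply: eq_integral => s _; rewrite patchE /fubini_F.
case: ifPn => sA.
  rewrite [RHS]integral_mkcond; apply: eq_integral => x _; rewrite !patchE.
  by rewrite in_setX sA.
by apply: integral0_eq => x _; rewrite patchE in_setX (negbTE sA).
Qed.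

Lemma sqint_slab (f : X -> R) : sqint m D f -> sqint P (A `*` D) (fun z => f z.2).
Proof.
move=> [mf foo]; split; first exact: measurable_fun_slab.
rewrite (@integral_slab (fun x => f x ^+ 2)); last 2 first.
- exact: measurable_funX.
- by move=> x _; exact: sqr_ge0.
rewrite lte_mul_pinfty// ge0_fin_numE//.
Qed.

Lemma cvg2_slab (u : nat -> X -> R) (f : X -> R) : (forall n, sqint m D (u n)) ->
  sqint m D f -> cvg2 m D u f -> cvg2 P (A `*` D) (fun n z => u n z.2) (fun z => f z.2).
Proof.
move=> su sf uf; rewrite /cvg2.
have -> : (fun n => \int[P]_(z in A `*` D) ((u n z.2 - f z.2) ^+ 2)) =
          (fun n => fine (lam A) * \int[m]_(x in D) ((u n x - f x) ^+ 2)).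
  apply/funext => n; have [mg goo] := sqintB mD (su n) sf.
  rewrite /Rintegral (@integral_slab (fun x => (u n x - f x) ^+ 2)); last 2 first.
  - exact: measurable_funX.
  - by move=> x _; exact: sqr_ge0.
  rewrite fineM// ge0_fin_numE//.
  by apply: integral_ge0 => x _; rewrite lee_fin sqr_ge0.
by rewrite -(mulr0 (fine (lam A))); apply: cvgM => //; exact: cvg_cst.
Qed.

End slabs.

(** * The comparison principle *)

Lemma ae_integral_le0 d (X : measurableType d) (R : realType)
    (mu : {measure set X -> \bar R}) (f : X -> \bar R) : measurable_fun setT f ->
  {ae mu, forall x, (f x <= 0)%E} -> (\int[mu]_x f x <= 0)%E.
Proof.
move=> mf f0; rewrite (_ : integral _ _ _ = \int[mu]_x - `|f x|)%E.
  by rewrite integral_ge0N// oppe_le0; exact: integral_ge0.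
apply: ae_eq_integral => //.
  by apply: measurableT_comp => //; exact: measurableT_comp.
by apply: ae_mono f0 => x f0 _; rewrite lee0_abs// oppeK.
Qed.

Section comparison.
Context {R : realType} {d : nat}.
Local Notation E := 'rV[R]_d.
Local Notation RR := (measurableTypeR R).
Local Notation lam := (@lebesgue_measure R).
Local Notation dx := (lebesgue_rV R d).
Local Notation dtdx := (lebesgue_time_rV R d).
Variables (Om : set E) (kappa K S T : R) (u : R -> E -> E) (Du : R -> E -> 'M[R]_d).
Variables (th : R -> E -> R) (Dth : R -> E -> E).
Hypotheses (oOm : open Om) (Omoo : (dx Om < +oo)%E) (kappa0 : 0 <= kappa) (T0 : 0 < T).
Hypothesis heat : heat_equation Om kappa u th Dth.
Let D : set (RR * E) := cylinder T Om.
Hypothesis sth : sqint dtdx D (fun z => th z.1 z.2).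
Hypothesis thS : {ae dtdx, forall z, D z -> `|th z.1 z.2| <= S}.
Hypothesis su : forall i, sqint dtdx D (fun z => u z.1 z.2 ord0 i).
Hypothesis sD : forall i, sqint dtdx D (fun z => Dth z.1 z.2 ord0 i).
Hypothesis sth_t : forall t, 0 <= t -> sqint dx Om (th t).
Hypothesis slice : {ae lam, forall t, 0 < t < T ->
  [/\ forall i, sobolev1_0 2%:E Om (fun x => u t x ord0 i) (fun x => row i (Du t x)),
      {ae dx, forall x, Om x -> \tr (Du t x) = 0},
      forall i, sqint dx Om (fun x => Dth t x ord0 i) &
      nonpos_trace Om (fun x => th t x - K) (Dth t)]}.
Hypothesis th0K : {ae dx, forall x, Om x -> th 0 x <= K}.

Let mOm : measurable Om := open_measurable_rV oOm.
Let I0T : set RR := `]0, T[%classic.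
Let mI : measurable I0T. Proof. exact: measurable_itv. Qed.
Let Ioo : (lam I0T < +oo)%E.
Proof.
apply: (@le_lt_trans _ _ T%:E); last exact: ltry.
by rewrite lebesgue_measure_itv/= lte_fin T0 -EFinD subr0.
Qed.
Let mD : measurable D. Proof. exact: measurableX. Qed.
Let Doo : (dtdx D < +oo)%E.
Proof.
rewrite (_ : dtdx D = lam I0T * dx Om)%E; last exact: product_measure1E.
by rewrite lte_mul_pinfty// ge0_fin_numE.
Qed.

Let c t : R := Num.max 0 (T - t).
Let Fi i (z : RR * E) := th z.1 z.2 * u z.1 z.2 ord0 i - kappa * Dth z.1 z.2 ord0 i.
Let V i (z : RR * E) := ramp2 (th z.1 z.2 - K) * Dth z.1 z.2 ord0 i.
Let F i := Fi i \_ D.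
Let W i := (fun z => c z.1 * V i z) \_ D.
Let g := (fun z : RR * E => ramp (th z.1 z.2 - K)) \_ D.
Let a t := \int[dx]_x g (t, x).

Let cst_sqint (b : R) : sqint dtdx D (fun=> b).
Proof. exact: (@sqint_bounded _ _ _ _ _ mD _ `|b|). Qed.

Let mramp : measurable_fun setT (@ramp R).
Proof.
by apply: continuous_measurable_fun => s; exact: is_derive_continuous (is_derive_ramp s).
Qed.

Let mramp2 : measurable_fun setT (@ramp2 R).
Proof. by apply: continuous_measurable_fun => s; exact: continuous_ramp2. Qed.

Let sFi i : sqint dtdx D (Fi i).
Proof.
apply: sqintB => //; last exact: sqintZ.
by apply: (sqintM_ae_bounded mD _ thS) => //; case: sth.
Qed.

Let sV i : sqint dtdx D (V i).
Proof.
apply: (@sqintM_bounded _ _ _ _ _ mD _ _ 6) => //; last by move=> z _; exact: ramp2_le.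
by apply: (measurableT_comp mramp2); case: (sqintB mD sth (cst_sqint K)).
Qed.

Let sF i : sqint dtdx setT (F i). Proof. exact: sqint_restrict. Qed.

Let mc : measurable_fun [set: RR] c.
Proof.
by apply: measurable_maxr; [exact: measurable_cst|exact: measurable_funB].
Qed.

Let sW i : sqint dtdx setT (W i).
Proof.
apply: sqint_restrict => //.
apply: (@sqintM_bounded _ _ _ _ _ mD (fun z => c z.1) _ T) => //.
  apply: measurable_funTS; apply: (measurableT_comp mc); exact: measurable_fst.
move=> -[t x] [/= + _]; rewrite in_itv/= => /andP[t0 tT].
by rewrite /c max_r ?ger0_norm; lra.
Qed.

Let gE t x : g (t, x) = if (0 < t < T) && (x \in Om) then ramp (th t x - K) else 0.
Proof.
rewrite /g patchE /D /cylinder; congr (if _ then _ else _).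
rewrite in_setX; congr (_ && _).
by apply/idP/idP; rewrite ?inE/= in_itv.
Qed.

Let g0 z : 0 <= g z.
Proof. by case: z => t x; rewrite gE; case: ifP => // _; exact: ramp_ge0. Qed.

Let ig : dtdx.-integrable setT (EFin \o g).
Proof.
have sthK := sqintB mD sth (cst_sqint K).
rewrite /g -restrict_EFin; apply/(integrable_restrict _ _ _ _).1 => //.
rewrite setTI; apply: le_integrable (sqint_integrable mD Doo sthK) => //.
  by apply/measurable_EFinP; apply: (measurableT_comp mramp); case: sthK.
by move=> z _ /=; rewrite lee_fin ger0_norm ?ramp_ge0// ramp_le.
Qed.

Let a0 t : 0 <= a t.
Proof. by apply: Rintegral_ge0 => x _; exact: g0. Qed.

Let a_out t : ~~ (0 < t < T) -> a t = 0.
Proof.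
move=> t0; rewrite /a (_ : (fun x => g (t, x)) = cst 0); last first.
  by apply/funext => x; rewrite gE (negbTE t0).
by rewrite /Rintegral integral0.
Qed.

Let mg : measurable_fun setT (EFin \o g).
Proof. by case/integrableP : ig. Qed.

Let ma : measurable_fun [set: RR] a.
Proof.
apply: (measurableT_comp (@fine_measurable R setT measurableT)).
exact: (@measurable_fun_fubini_tonelli_F _ _ _ _ _ dx (EFin \o g)).
Qed.

Let aE : {ae lam, forall t, (a t)%:E = \int[dx]_x (g (t, x))%:E}%E.
Proof.
have := @ae_integrable1 _ _ _ _ _ lam dx _ ig; apply: ae_mono => t it.
by rewrite /a /Rintegral fineK//; exact: integrable_fin_num.
Qed.

Let int_a : (\int[lam]_t (a t)%:E = \int[dtdx]_z (g z)%:E)%E.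
Proof.
rewrite [RHS](@fubini_tonelli1 _ _ _ _ _ lam dx (EFin \o g))//.
apply: ae_eq_integral => //.
- exact/measurable_EFinP.
- apply: (@measurable_fun_fubini_tonelli_F _ _ _ _ _ dx (EFin \o g)) => //.
by apply: ae_mono aE => t -> _.
Qed.

Let a_fin : (\int[lam]_t (a t)%:E < +oo)%E.
Proof.
rewrite int_a; have /integrableP[_] := ig; apply: le_lt_trans.
apply: ge0_le_integral => //.
- by move=> z _; rewrite lee_fin.
- by apply: measurableT_comp => //.
- by move=> z _; rewrite lee_fin ler_norm.
Qed.

(** The solution is extended to negative times by its initial value, for windows that begin
before time 0. *)
Let thp t x := th (Num.max 0 t) x.

Let A h t : set RR := window h t `&` I0T.

Let mA h t : measurable (A h t).
Proof. by apply: measurableI => //; exact: measurable_window. Qed.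

Let AD h t : A h t `*` Om `<=` D.
Proof. by move=> z [[_ ?] ?]. Qed.

Let mAO h t : measurable (A h t `*` Om : set (RR * E)).
Proof. exact: measurableX. Qed.

Let Aoo h t : (lam (A h t) < +oo)%E.
Proof.
apply: le_lt_trans Ioo; apply: le_measure => //; rewrite ?inE//.
exact: subIsetr.
Qed.

Let flux psi (z : RR * E) := \sum_i Fi i z * partial i psi z.2.

Let flux_integrable psi : C1c Om psi -> dtdx.-integrable D (EFin \o flux psi).
Proof.
move=> Cpsi; apply: integrable_fun_sum => // i; apply: integrableM_sqint => //.
exact: (sqint_slab mI Ioo mOm (C1c_partial_sqint i oOm Cpsi)).
Qed.

Let history t psi : C1c Om psi ->
  \int[dx]_(x in Om) (thp t x * psi x) - \int[dx]_(x in Om) (th 0 x * psi x) =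
  \int[dtdx]_(z in cylinder t Om) flux psi z.
Proof.
move=> Cpsi; have [t0|t0] := leP t 0; last first.
  by rewrite -(heat_equation_space_test oOm heat t0 Cpsi) /thp max_r// ltW.
rewrite /thp max_l// subrr (_ : cylinder t Om = set0) ?Rintegral_set0//.
apply/seteqP; split => // -[s x] [/= + _].
by rewrite in_itv/= => /andP[s0 st]; have := lt_trans s0 (lt_le_trans st t0); rewrite ltxx.
Qed.

Let increment h t psi : C1c Om psi -> 0 < h -> 0 < t < T ->
  \int[dx]_(x in Om) (psi x * (th t x - thp (t - h) x)) =
  \sum_i \int[dtdx]_(z in A h t `*` Om) (partial i psi z.2 * Fi i z).
Proof.
move=> Cpsi h0 /andP[t0 tT].
have spsi := C1c_sqint oOm Cpsi.
have st : sqint dx Om (th t) by apply: sth_t; exact: ltW.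
have sth' : sqint dx Om (thp (t - h)) by apply: sth_t; rewrite le_max lexx.
(* For [t <= h] the first cylinder is empty, in accordance with the extension [thp]. *)
have cylE : cylinder t Om = cylinder (t - h) Om `|` A h t `*` Om.
  rewrite /cylinder /A /window /I0T; apply/seteqP; split => -[s x] /=.
    rewrite !in_itv/= => -[/andP[s0 st'] Ox].
    have [sh|sh] := ltP s (t - h); [left|right].
      by split => //; rewrite s0.
    by split => //; split; apply/andP; split; lra.
  rewrite !in_itv/= => -[[/andP[s0 sh] Ox]|[[/andP[s1 s2] /andP[s0 s3]] Ox]].
    by rewrite s0; split => //=; lra.
  by rewrite s0 s2.
have disj : [disjoint cylinder (t - h) Om & A h t `*` Om].
  apply/disj_setPS; rewrite /cylinder /A /window => -[s x] [] [/= + _] [[/= + _] _].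
  by rewrite !in_itv/= => /andP[_ s1] /andP[s2 _]; lra.
have := history t Cpsi; have := history (t - h) Cpsi.
have -> : thp t = th t by apply/funext => x; rewrite /thp max_r// ltW.
have if_cyl : dtdx.-integrable (cylinder t Om) (EFin \o flux psi).
  apply: (integrableS mD) (flux_integrable Cpsi) => //.
    by apply: measurableX => //; exact: measurable_itv.
  move=> -[s x] [/= + Ox]; rewrite in_itv/= => /andP[s0 st'].
  by split => //=; rewrite in_itv/= s0 (lt_trans st').
rewrite [in X in _ -> X -> _]cylE Rintegral_setU//; last 2 first.
- by apply: measurableX => //; exact: measurable_itv.
- by rewrite -cylE.
move=> <- hist.
have -> : \sum_i \int[dtdx]_(z in A h t `*` Om) (partial i psi z.2 * Fi i z) =
    \int[dtdx]_(z in A h t `*` Om) flux psi z.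
  rewrite -Rintegral_sum//.
    by apply: eq_Rintegral => z _; apply: eq_bigr => i _; rewrite mulrC.
  move=> i; apply: integrableM_sqint => //.
    exact: (sqint_slab (mA h t) (Aoo h t) mOm (C1c_partial_sqint i oOm Cpsi)).
  exact: sqintS (sFi i).
have i1 : dx.-integrable Om (EFin \o (fun x => th t x * psi x)).
  exact: integrableM_sqint.
have i2 : dx.-integrable Om (EFin \o (fun x => thp (t - h) x * psi x)).
  exact: integrableM_sqint.
have -> : \int[dx]_(x in Om) (psi x * (th t x - thp (t - h) x)) =
    \int[dx]_(x in Om) (th t x * psi x) - \int[dx]_(x in Om) (thp (t - h) x * psi x).
  rewrite -RintegralB//; apply: eq_Rintegral => x _.
  by rewrite mulrBr ![psi x * _]mulrC.
by move: hist; set p1 := Rintegral _ _ _; set p2 := Rintegral _ _ _;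
  set p3 := Rintegral _ _ _; set p4 := Rintegral _ _ _ => hist; lra.
Qed.

Let sthK t : 0 <= t -> sqint dx Om (fun x => th t x - K).
Proof.
move=> t0; apply: sqintB => //; first exact: sth_t.
exact: (@sqint_bounded _ _ _ _ _ mOm _ `|K|).
Qed.

Let iramp t : 0 <= t -> dx.-integrable Om (EFin \o (fun x => ramp (th t x - K))).
Proof.
move=> t0; have stK := sthK t0.
apply: le_integrable (sqint_integrable mOm Omoo stK) => //.
  by apply/measurable_EFinP; apply: (measurableT_comp mramp); case: stK.
by move=> z _ /=; rewrite lee_fin ger0_norm ?ramp_ge0// ramp_le.
Qed.

Let a_thp t : t < T -> a t = \int[dx]_(x in Om) ramp (thp t x - K).
Proof.
move=> tT; have [t0|t0] := leP t 0; last first.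
  rewrite Rintegral_mkcond; apply: eq_Rintegral => x _.
  by rewrite gE t0 tT patchE /thp max_r// ltW.
rewrite a_out; last by rewrite ltNge t0.
rewrite /Rintegral (_ : integral _ _ _ = \int[dx]_(x in Om) (cst 0%E x))%E.
  by rewrite integral0.
apply: ae_eq_integral => //.
  have m0 : 0 <= Num.max 0 t by rewrite le_max lexx.
  by have /integrableP[] := iramp m0.
apply: ae_mono th0K => x + Ox => /(_ Ox) thK.
by rewrite /thp max_l// ramp_le0// subr_le0.
Qed.

Let slice_V t : (forall i, sqint dx Om (fun x => Dth t x ord0 i)) -> 0 <= t ->
  forall i, sqint dx Om (fun x => V i (t, x)).
Proof.
move=> sDt t0 i.
apply: (@sqintM_bounded _ _ _ _ _ mOm (fun x => ramp2 (th t x - K)) _ 6) => //.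
  by apply: (measurableT_comp mramp2); case: (sthK t0).
by move=> x _; exact: ramp2_le.
Qed.

(** The equation is tested with truncations that approximate [ramp1 (th t - K)], and the
convexity of [ramp] bounds the resulting left-hand side from below. *)
Let energy_increment h t : 0 < h -> 0 < t < T ->
  (forall i, sqint dx Om (fun x => Dth t x ord0 i)) ->
  nonpos_trace Om (fun x => th t x - K) (Dth t) ->
  a t - a (t - h) <=
  \sum_i \int[dtdx]_(z in A h t `*` Om) (V i (t, z.2) * Fi i z).
Proof.
move=> h0 tT sDt trt; have /andP[t0 tT'] := tT.
have t0' := ltW t0; have mh0 : 0 <= Num.max 0 (t - h) by rewrite le_max lexx.
have stK := sthK t0'.
have [psi [Cpsi psi_lim Dpsi]] := truncation_limit oOm is_derive_ramp1
  (@continuous_ramp2 R) (@ramp1_le0 R) (@ramp2_le R) stK sDt trt.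
have sdiff : sqint dx Om (fun x => th t x - thp (t - h) x).
  by apply: sqintB => //; exact: sth_t.
have sr1 : sqint dx Om (fun x => ramp1 (th t x - K)).
  have mr1 : measurable_fun setT (@ramp1 R).
    apply: continuous_measurable_fun => s.
    exact: is_derive_continuous (is_derive_ramp1 s).
  have mr1t : measurable_fun Om (fun x => ramp1 (th t x - K)).
    by apply: (measurableT_comp mr1); case: stK.
  apply: integrable2_sqint => //.
  (* [ramp1] vanishes at 0 and is 6-Lipschitz; its square is at most [36 * s ^+ 2]. *)
  have i6 := integrableZl mOm 36 (sqint_integrable2 stK).
  apply: le_integrable i6 => //.
    by apply/measurable_EFinP; exact: measurable_funX.
  move=> x _ /=; rewrite lee_fin ger0_norm ?sqr_ge0// ger0_norm; last first.
    by rewrite mulr_ge0// sqr_ge0.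
  have := ramp1_lipschitz (th t x - K) 0; rewrite (@ramp1_le0 _ 0)// !subr0 => r6.
  rewrite -real_normK ?num_real// -[X in _ <= _ * X]real_normK ?num_real//.
  have -> : 36 * `|th t x - K| ^+ 2 = (6 * `|th t x - K|) ^+ 2 by ring.
  by rewrite lerXn2r ?nnegrE ?mulr_ge0.
have sVt := slice_V sDt t0'.
have lim1 := cvg2_pairing mOm (fun m => C1c_sqint oOm (Cpsi m)) sr1 sdiff psi_lim.
have lim2 i : \int[dtdx]_(z in A h t `*` Om) (partial i (psi m) z.2 * Fi i z)
    @[m --> \oo] --> \int[dtdx]_(z in A h t `*` Om) (V i (t, z.2) * Fi i z).
  apply: (cvg2_pairing (mAO h t)).
  - move=> m.
    exact: (sqint_slab (mA h t) (Aoo h t) mOm (C1c_partial_sqint i oOm (Cpsi m))).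
  - exact: (sqint_slab (mA h t) (Aoo h t) mOm (sVt i)).
  - exact: sqintS (sFi i).
  - apply: (cvg2_slab (mA h t) (Aoo h t) mOm _ (sVt i) (Dpsi i)).
    by move=> m; exact: (C1c_partial_sqint i oOm (Cpsi m)).
have := cvg_fun_sum lim2.
under eq_fun do rewrite -(increment (Cpsi _) h0 tT).
move=> /(cvg_unique _ lim1) <- //.
rewrite (a_thp tT') a_thp; last by lra.
have mt0 : 0 <= Num.max 0 t by rewrite le_max lexx.
have i1 : dx.-integrable Om (EFin \o (fun x => ramp (thp t x - K))) by exact: iramp.
have i2 : dx.-integrable Om (EFin \o (fun x => ramp (thp (t - h) x - K))).
  exact: iramp.
rewrite -(RintegralB mOm i1 i2).
have thpt x : thp t x = th t x by rewrite /thp max_r.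
apply: le_Rintegral => //.
- exact: (integrableB mOm i1 i2).
- exact: integrableM_sqint.
move=> x _; rewrite thpt; apply: le_trans (ramp_convex _ _) _.
by rewrite opprB addrA subrK.
Qed.

(** Outside the interval from 0 to [T] both sides vanish. *)
Let increments h : 0 < h -> {ae lam, forall t,
  2 * Num.max 0 (T - t) * (a t - a (t - h)) <=
  \int[dtdx]_(z in window h t `*` setT) (\sum_i 2 * (F i z * W i (t, z.2)))}.
Proof.
move=> h0; apply: ae_mono slice => t slice_t.
have FW z : ~~ (0 < t < T) -> \sum_i 2 * (F i z * W i (t, z.2)) = 0.
  move=> tT; rewrite big1// => i _; rewrite /W patchE ifF ?mulr0//.
  apply: contraNF tT; rewrite inE => -[/= + _].
  by rewrite in_itv.
have [tT|tT] := boolP (0 < t < T); last first.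
  under eq_Rintegral do rewrite FW//.
  rewrite Rintegral_cst; last first.
    by apply: measurableX => //; exact: measurable_window.
  rewrite mul0r; have [t0|t0] := leP t 0.
    rewrite a_out// a_out ?subrr ?mulr0//.
    by apply/negP => /andP[s0 _]; lra.
  move: tT; rewrite t0/= -leNgt => Tt.
  by rewrite max_l ?mulr0 ?mul0r// subr_le0.
have [_ _ sDt trt] := slice_t tT; have /andP[t0 tT'] := tT.
rewrite max_r; last lra.
have sVt := slice_V sDt (ltW t0).
have -> : \int[dtdx]_(z in window h t `*` setT) (\sum_i 2 * (F i z * W i (t, z.2))) =
    \int[dtdx]_(z in A h t `*` Om) ((2 * (T - t)) * \sum_i V i (t, z.2) * Fi i z).
  rewrite Rintegral_mkcond [RHS]Rintegral_mkcond; apply: eq_Rintegral => -[s x] _.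
  rewrite !patchE !in_setX in_setT andbT in_setI.
  case: (boolP (s \in window h t)) => //= sw.
  rewrite mulr_sumr; case: (boolP ((s \in I0T) && (x \in Om))) => sI; last first.
    rewrite big1// => i _; rewrite /F patchE /D /cylinder in_setX.
    by rewrite (negbTE sI) mul0r mulr0.
  apply: eq_bigr => i _; rewrite /F /W !patchE /D /cylinder !in_setX sI.
  have -> : t \in I0T by rewrite inE /I0T/= in_itv.
  have /andP[_ ->] := sI; rewrite /= /c max_r; last lra.
  by rewrite /Fi /V /=; ring.
have iVF i : dtdx.-integrable (A h t `*` Om) (EFin \o (fun z => V i (t, z.2) * Fi i z)).
  apply: integrableM_sqint => //.
    exact: (sqint_slab (mA h t) (Aoo h t) mOm (sVt i)).
  exact: sqintS (sFi i).
rewrite RintegralZl//; last exact: integrable_fun_sum.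
rewrite Rintegral_sum// ler_wpM2l//; last exact: energy_increment.
by rewrite mulr_ge0//; lra.
Qed.

(** At almost every time the transport term is zero and the diffusion term has a sign. *)
Let dissipation : \int[dtdx]_z (\sum_i F i z * W i z) <= 0.
Proof.
have iFW : dtdx.-integrable setT (EFin \o (fun z => \sum_i F i z * W i z)).
  by apply: integrable_fun_sum => // i; exact: integrableM_sqint.
apply: fine_le0.
rewrite -(@integral12_prod_meas1 _ _ _ _ _ lam dx _ iFW).
apply: ae_integral_le0; first exact: (@measurable_fubini_F _ _ _ _ _ lam dx _ iFW).
apply: ae_mono slice => t slice_t; rewrite /fubini_F /=.
have [tT|tT] := boolP (0 < t < T); last first.
  rewrite integral0_eq// => x _; rewrite big1// => i _; rewrite /F patchE ifF ?mul0r//.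
  apply: contraNF tT; rewrite inE => -[/= + _].
  by rewrite in_itv.
have [sut trt sDt tr_t] := slice_t tT; have /andP[t0 tT'] := tT.
have t0' := ltW t0.
have ct : 0 <= T - t by lra.
have sui i : sqint dx Om (fun x => u t x ord0 i).
  by have [[+ _ _] _] := sut i; exact: Lp_on_sqint.
have sVt := slice_V sDt t0'.
pose X i x := u t x ord0 i * (th t x * ramp2 (th t x - K) * Dth t x ord0 i).
pose Y i x := Dth t x ord0 i * V i (t, x).
have iX i : dx.-integrable Om (EFin \o X i).
  apply: integrableM_sqint => //.
  apply: (@sqintM_bounded _ _ _ _ _ mOm (fun x => th t x * ramp2 (th t x - K)) _
    (6 + `|K| * 6)) => //.
    apply: measurable_funM; first by case: (sth_t t0').
    by apply: (measurableT_comp mramp2); case: (sthK t0').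
  by move=> x _; have := ramp_flux_bound K (th t x - K); rewrite subrK.
have iY i : dx.-integrable Om (EFin \o Y i) by exact: integrableM_sqint.
have transport := transport_term_eq0 oOm sut trt (sthK t0') sDt tr_t.
have Y0 : 0 <= \sum_i \int[dx]_(x in Om) Y i x.
  apply: sumr_ge0 => i _; apply: Rintegral_ge0 => x _.
  by rewrite /Y /V /= mulrCA mulr_ge0 ?ramp2_ge0// -expr2 sqr_ge0.
have iSX := integrable_fun_sum mOm iX; have iSY := integrable_fun_sum mOm iY.
have iKY : dx.-integrable Om (EFin \o (fun x => kappa * \sum_i Y i x)).
  exact: (integrableZl mOm kappa iSY).
have iXY : dx.-integrable Om (EFin \o (fun x => \sum_i X i x - kappa * \sum_i Y i x)).
  exact: (integrableB mOm iSX iKY).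
have -> : (\int[dx]_x (\sum_i F i (t, x) * W i (t, x))%:E =
    \int[dx]_(x in Om) ((T - t)%:E * (\sum_i X i x - kappa * \sum_i Y i x)%:E))%E.
  rewrite [RHS]integral_mkcond; apply: eq_integral => x _.
  rewrite patchE; case: ifPn => Ox; last first.
    rewrite big1// => i _; rewrite /F patchE /D /cylinder in_setX.
    by rewrite (negbTE Ox) andbF mul0r.
  rewrite -EFinM; congr (_%:E); rewrite mulr_sumr -sumrB mulr_sumr.
  apply: eq_bigr => i _; rewrite /F /W !patchE /D /cylinder !in_setX Ox.
  have -> : t \in I0T by rewrite inE /I0T/= in_itv.
  by rewrite /= /c max_r// /Fi /X /Y /V /=; ring.
rewrite integralZl// -[X in (_ * X)%E]fineK; last exact: integrable_fin_num.
rewrite -EFinM lee_fin mulr_ge0_le0//.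
rewrite -[fine _]/(\int[dx]_(x in Om) (\sum_i X i x - kappa * \sum_i Y i x)).
rewrite (RintegralB mOm iSX iKY)
  (RintegralZl kappa mOm iSY) !Rintegral_sum// transport sub0r oppr_le0.
exact: mulr_ge0.
Qed.

(** The energy [a] vanishes almost everywhere before every [T' < T], and its density
[ramp (th - K)] vanishes only where [th <= K]. *)
Lemma comparison_principle : {ae dtdx, forall z, cylinder T Om z -> th z.1 z.2 <= K}.
Proof.
have a_past T' : T' < T -> (\int[lam]_(t in past T') (a t)%:E = 0)%E.
  move=> T'T; apply/eqP; rewrite eq_le; apply/andP; split; last first.
    by apply: integral_ge0 => t _; rewrite lee_fin.
  have a_le0 t : t <= 0 -> a t = 0.
    by move=> t0; rewrite a_out// ltNge t0.
  apply: le_trans (time_averaging sF sW ma a0 a_le0 a_fin increments T'T) _.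
  by rewrite lee_fin dissipation.
have ae_a T' : T' < T -> {ae lam, forall t, past T' t -> a t = 0}.
  move=> T'T; have mp := measurable_past T'.
  have := @ae_eq_integral_abs _ _ _ lam (past T') mp (EFin \o a).
  move=> [|/(_ _) + _]; first by apply/measurable_EFinP; exact: measurable_funTS.
  have e : (\int[lam]_(x in past T') `|(EFin \o a) x| = 0)%E.
    rewrite -(a_past T' T'T); apply: eq_integral => t _ /=.
    by rewrite ger0_norm.
  by move=> /(_ e); apply: ae_mono => t /[apply] [] [].
have {}ae_a : {ae lam, forall t, a t = 0}.
  have := @ae_foralln _ _ _ lam (fun k t => past (T - k.+1%:R^-1) t -> a t = 0).
  move=> /(_ (fun k => ae_a _ _)) H.
  have {}H := H _; apply: ae_mono (H _) => [t ht|k]; last first.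
    by rewrite ltrBlDr ltrDl invr_gt0.
  have [tT|tT] := ltP t T; last by rewrite a_out// negb_and -!leNgt tT orbT.
  have [k] : exists k, t + k.+1%:R^-1 < T by exact: ltr_add_invr.
  by move=> tk; apply: (ht k); rewrite /past/= in_itv/= lerBrDr ltW.
have int_g : (\int[dtdx]_z `|(EFin \o g) z| = 0)%E.
  transitivity (\int[lam]_t (a t)%:E)%E.
    rewrite int_a; apply: eq_integral => z _ /=; by rewrite ger0_norm.
  transitivity (\int[lam]_t (cst 0%E t))%E; last by rewrite integral0.
  apply: ae_eq_integral => //; first exact/measurable_EFinP.
  by apply: ae_mono ae_a => t /= -> _.
have [+ _] := @ae_eq_integral_abs _ _ _ dtdx setT measurableT (EFin \o g) mg.
move=> /(_ int_g); apply: ae_mono => -[t x] /(_ Logic.I) /= [] + [+ Ox].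
rewrite /= in_itv/= => + tT; rewrite gE tT mem_set//= => /ramp_eq0.
by rewrite subr_le0.
Qed.

End comparison.

(** * From the boundary condition to a non-positive trace *)

Section product_slices.
Context d1 d2 (X : measurableType d1) (Y : measurableType d2) (R : realType).
Variables (m1 : {sigma_finite_measure set X -> \bar R}).
Variables (m2 : {sigma_finite_measure set Y -> \bar R}).

Lemma ae_product_slices (Q : X * Y -> Prop) : {ae (m1 \x m2)%E, forall z, Q z} ->
  {ae m1, forall x, {ae m2, forall y, Q (x, y)}}.
Proof.
move=> [N [mN N0 QN]].
have mx : measurable_fun setT (fun x => m2 (xsection N x)).
  exact: measurable_fun_xsection.
have int0 : (\int[m1]_x `|m2 (xsection N x)| = 0)%E.
  rewrite -[RHS]N0; apply: eq_integral => x _ /=.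
  by rewrite gee0_abs ?measure_ge0.
have [+ _] := @ae_eq_integral_abs _ _ _ m1 setT measurableT _ mx.
move=> /(_ int0); apply: ae_mono => x /(_ Logic.I) /= N0x.
exists (xsection N x); split => //; first exact: measurable_xsection.
by move=> y Qy; rewrite /xsection/= inE; exact: QN.
Qed.

End product_slices.

Section boundary_condition.
Context {R : realType} {d : nat}.
Local Notation E := 'rV[R]_d.
Local Notation dx := (lebesgue_rV R d).
Implicit Types (Om : set E) (th thB : E -> R) (Dth Dv : E -> E).

Lemma lebesgue_bounded_lty Om : open Om -> bounded_set Om -> (dx Om < +oo)%E.
Proof.
move=> oOm [M [Mr HM]].
pose v c : E := const_mx c.
apply: le_lt_trans (lebesgue_cbox_lty (v (- (M + 1))) (v (M + 1))).
apply: le_measure; rewrite ?inE; first exact: open_measurable_rV.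
  by apply: compact_measurable_rV; exact: compact_cbox.
move=> x Ox i; rewrite !mxE -ler_norml; apply: le_trans (coord_norm_le x i) _.
by apply: HM => //; rewrite ltrDl.
Qed.

Lemma Ck_closure1_sqint Om thB : open Om -> bounded_set Om -> Ck_closure 1 Om thB ->
  sqint dx Om thB /\ forall i, sqint dx Om (partial i thB).
Proof.
move=> oOm bOm C1; have [cB [_ dB]] := C1.
have mOm := open_measurable_rV oOm; have Omoo := lebesgue_bounded_lty oOm bOm.
have [cOm dOm] := Ck_closure_C1_on oOm C1.
split=> [|i].
  have [M HM] := bounded_on_closure bOm cB.
  apply: (@sqint_bounded _ _ _ _ _ mOm _ M) => //.
    exact: continuous_measurable_rV.
  by move=> x Ox; apply: HM; exact: subset_closure.
have [_ [[g [cg fg]] _]] := dB i; have [M HM] := bounded_on_closure bOm cg.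
apply: (@sqint_bounded _ _ _ _ _ mOm _ M) => //.
  by apply: continuous_measurable_rV => // x Ox; have [] := dOm i x Ox.
by move=> x Ox; rewrite fg ?inE//; apply: HM; exact: subset_closure.
Qed.

(** By uniqueness of weak gradients, that of [th] is the sum of those of [th + c - thB] and
of [thB]. *)
Lemma gradient_boundary_lift Om th Dth thB c Dv : open Om -> bounded_set Om ->
  Ck_closure 1 Om thB -> sobolev1 2%:E Om th Dth ->
  sobolev1 2%:E Om (fun x => th x + c - thB x) Dv ->
  forall i, {ae dx, forall x, Om x -> Dth x ord0 i = Dv x ord0 i + partial i thB x}.
Proof.
move=> oOm bOm CB [Lth LDth wth] [Lv LDv wv] i.
have mOm := open_measurable_rV oOm; have Omoo := lebesgue_bounded_lty oOm bOm.
have [sB sdB] := Ck_closure1_sqint oOm bOm CB.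
have sth := Lp_on_sqint Lth; have sv := Lp_on_sqint Lv.
have sDth := Lp_on_sqint (LDth i); have sDv := Lp_on_sqint (LDv i).
have sw : sqint dx Om (fun x => Dth x ord0 i - Dv x ord0 i - partial i thB x).
  by apply: sqintB => //; exact: sqintB.
have : {ae dx, forall x, Om x -> Dth x ord0 i - Dv x ord0 i - partial i thB x = 0}.
  apply: fundamental_lemma => //; first exact: sqint_integrable.
  move=> phi Tphi; have Cphi := test_fun_C1c Tphi.
  have sphi := C1c_sqint oOm Cphi; have sdphi := C1c_partial_sqint i oOm Cphi.
  have e1 := wth i phi Tphi; have e2 := wv i phi Tphi.
  have e3 := integration_by_parts_C1c i oOm (Ck_closure_C1_on oOm CB) Cphi.
  have e4 := integral_partial_eq0 i oOm Cphi.
  have i1 := integrableM_sqint mOm sDth sphi; have i2 := integrableM_sqint mOm sDv sphi.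
  have i3 := integrableM_sqint mOm (sdB i) sphi.
  have j1 := integrableM_sqint mOm sth sdphi; have j3 := integrableM_sqint mOm sB sdphi.
  have j4 := sqint_integrable mOm Omoo sdphi.
  have i12 : dx.-integrable Om (EFin \o (fun x => Dth x ord0 i * phi x - Dv x ord0 i * phi x)).
    exact: (integrableB mOm i1 i2).
  have j4c : dx.-integrable Om (EFin \o (fun x => c * partial i phi x)).
    exact: (integrableZl mOm c j4).
  have j14 : dx.-integrable Om
      (EFin \o (fun x => th x * partial i phi x + c * partial i phi x)).
    exact: (integrableD mOm j1 j4c).
  transitivity (\int[dx]_(x in Om)
      (Dth x ord0 i * phi x - Dv x ord0 i * phi x - partial i thB x * phi x)).
    by apply: eq_Rintegral => x _; rewrite !mulrBl.
  rewrite (RintegralB mOm i12 i3) (RintegralB mOm i1 i2).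
  have : \int[dx]_(x in Om) ((th x + c - thB x) * partial i phi x) =
      \int[dx]_(x in Om) (th x * partial i phi x) + c * 0
      - \int[dx]_(x in Om) (thB x * partial i phi x).
    rewrite -e4 -(RintegralZl c mOm j4) -(RintegralD mOm j1 j4c) -(RintegralB mOm j14 j3).
    by apply: eq_Rintegral => x _; rewrite mulrBl mulrDl.
  by rewrite e2 e1 e3 mulr0 addr0; set p := Rintegral _ _ _; set q := Rintegral _ _ _;
    set r := Rintegral _ _ _ => e; lra.
by apply: ae_mono => x + Ox => /(_ Ox) e; lra.
Qed.

(** If [phi m] are test functions approximating [th + c - thB], then
[sg * (phi m + thB - c) - K] approximates [sg * th - K]; where [phi m] vanishes it is
non-positive by the hypothesis on [thB]. *)
Lemma boundary_condition_trace Om th Dth thB c Dv sg K : open Om -> bounded_set Om ->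
  Ck_closure 1 Om thB -> sobolev1 2%:E Om th Dth ->
  sobolev1_0 2%:E Om (fun x => th x + c - thB x) Dv -> sg ^+ 2 = 1 ->
  (forall x, Om x -> sg * (thB x - c) <= K) ->
  nonpos_trace Om (fun x => sg * th x - K) (fun x => sg *: Dth x).
Proof.
move=> oOm bOm CB Sth Sv sg1 BK.
have mOm := open_measurable_rV oOm; have Omoo := lebesgue_bounded_lty oOm bOm.
have [sB sdB] := Ck_closure1_sqint oOm bOm CB.
have CB1 := Ck_closure_C1_on oOm CB.
have [[_ LDv _] [phi [Tphi phiv Dphiv]]] := Sv.
have grad := gradient_boundary_lift oOm bOm CB Sth Sv.1.
have Cphi m := test_fun_C1c (Tphi m).
have Cphi' m : C1_on Om (phi m) by apply: C1_onS (Cphi m).1.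
have scst (b : R) : sqint dx Om (fun=> b).
  exact: (@sqint_bounded _ _ _ _ _ mOm _ `|b|).
(* As [sg ^+ 2 = 1], the approximation [sg * (phi m + thB - c) - K] is [sg * (b + phi m)]. *)
pose b x := thB x - (c + sg * K).
have Cb : C1_on Om b := C1_onB oOm CB1 (C1_on_cst _ oOm).
have pb i x : Om x -> partial i b x = partial i thB x.
  move=> Ox; rewrite (partialB i CB1 (C1_on_cst _ oOm) Ox).
  have -> : partial i (fun _ : E => c + sg * K) x = 0 by exact: derive_cst.
  by rewrite subr0.
pose w m x := sg * (b x - (-1) * phi m x).
have Cw m : C1_on Om (w m).
  exact: (C1_onZ _ oOm (C1_onB oOm Cb (C1_onZ _ oOm (Cphi' m)))).
have sgsg : sg * sg = 1 by rewrite -expr2.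
have wE m x : w m x = sg * phi m x + (sg * (thB x - c) - K).
  have e : sg * (sg * K) = K by rewrite mulrA sgsg mul1r.
  by rewrite /w /b -[in RHS]e; ring.
have pw i m x : Om x -> partial i (w m) x = sg * (partial i thB x + partial i (phi m) x).
  move=> Ox; rewrite -pb//.
  have h1 := is_derive_funZ (-1) (C1_on_derive i (Cphi' m) Ox).
  have h2 := is_derive_funZ sg (is_derive_funB (C1_on_derive i Cb Ox) h1).
  by rewrite {1}/partial; have [_ ->] := h2; rewrite mulN1r opprK.
exists w; split; first exact: Cw.
- move=> m; have [_ [K0 [cK KOm phiK]]] := Cphi m; exists K0; split => // x Ox Kx.
  by rewrite wE phiK// mulr0 add0r subr_le0 BK.
- move=> m; split.
    have -> : w m = (fun x => sg * (thB x - (c + sg * K) - (-1) * phi m x)) by [].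
    apply: sqintZ => //; apply: sqintB => //; first exact: sqintB.
    by apply: sqintZ => //; exact: C1c_sqint.
  move=> i; have s2 : sqint dx Om (fun x => sg * (partial i thB x + partial i (phi m) x)).
    by apply: sqintZ => //; apply: sqintD => //; exact: C1c_partial_sqint.
  split.
    by apply: eq_measurable_fun s2.1 => x; rewrite inE => Ox; rewrite pw.
  move: s2.2; congr (_ < _)%E; apply: eq_integral => x; rewrite inE => Ox.
  by rewrite pw.
- move: (Lnorm_cvg2 phiv); rewrite /cvg2.
  suff -> : (fun m => \int[dx]_(x in Om) ((w m x - (sg * th x - K)) ^+ 2)) =
    (fun m => \int[dx]_(x in Om) ((phi m x - (th x + c - thB x)) ^+ 2)) by [].
  apply/funext => m; apply: eq_Rintegral => x _.
  rewrite wE -[RHS]mul1r -sg1; ring.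
- move=> i; move: (Lnorm_cvg2 (Dphiv i)); rewrite /cvg2.
  suff -> : (fun m => \int[dx]_(x in Om)
       ((partial i (w m) x - (sg *: Dth x) ord0 i) ^+ 2)) =
    (fun m => \int[dx]_(x in Om) ((partial i (phi m) x - Dv x ord0 i) ^+ 2)) by [].
  apply/funext => m; rewrite /Rintegral; congr (fine _).
  have sDv := Lp_on_sqint (LDv i).
  have sDth : sqint dx Om (fun x => Dth x ord0 i).
    by case: Sth => _ /(_ i) + _; exact: Lp_on_sqint.
  have m1 : measurable_fun Om (partial i (w m)).
    by apply: continuous_measurable_rV => // x Ox; have [_ /(_ i x Ox)[]] := Cw m.
  have m2 : measurable_fun Om (partial i (phi m)).
    by case: (C1c_partial_sqint i oOm (Cphi m)).
  apply: ae_eq_integral => //.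
  + apply/measurable_EFinP; apply: measurable_funX; apply: measurable_funB => //.
    have -> : (fun x => (sg *: Dth x) ord0 i) = (fun x => sg * Dth x ord0 i).
      by apply/funext => x; rewrite mxE.
    by apply: measurable_funM => //; case: sDth.
  + apply/measurable_EFinP; apply: measurable_funX; apply: measurable_funB => //.
    by case: sDv.
  apply: ae_mono (grad i) => x + Ox => /(_ Ox) e.
  rewrite pw// mxE e -[in RHS](mul1r (_ ^+ 2)) -sg1; congr (_%:E); ring.
Qed.

End boundary_condition.

(** * Signs, means and boundary values *)

(** An integral that is not finite has real value 0, on both sides of this identity. *)
Lemma RintegralN_total d (X : measurableType d) (R : realType)
    (mu : {measure set X -> \bar R}) (D : set X) (f : X -> R) :
  \int[mu]_(x in D) (- f x) = - \int[mu]_(x in D) f x.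
Proof.
rewrite /Rintegral.
have -> : (fun x => (- f x)%:E) = (\- (EFin \o f))%E by [].
rewrite integralE [in RHS]integralE funeposN funenegN.
set p := (\int[mu]_(x in D) _^\+ x)%E; set q := (\int[mu]_(x in D) _^\- x)%E.
have : (0 <= p)%E by exact: integral_ge0.
have : (0 <= q)%E by exact: integral_ge0.
move: p q => [p| |] [q| |] //= _ _; rewrite ?oppr0//.
by rewrite opprB.
Qed.

Lemma Rintegral_sign d (X : measurableType d) (R : realType)
    (mu : {measure set X -> \bar R}) (D : set X) (f : X -> R) sg : sg ^+ 2 = 1 ->
  \int[mu]_(x in D) (sg * f x) = sg * \int[mu]_(x in D) f x.
Proof.
move=> /eqP; rewrite sqrf_eq1 => /orP[|] /eqP ->.
  by rewrite mul1r; apply: eq_Rintegral => x _; rewrite mul1r.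
by rewrite mulN1r -RintegralN_total; apply: eq_Rintegral => x _; rewrite mulN1r.
Qed.

Lemma heat_equation_sign (R : realType) d (Om : set 'rV[R]_d) kappa u th Dth sg :
  sg ^+ 2 = 1 -> heat_equation Om kappa u th Dth ->
  heat_equation Om kappa u (fun t x => sg * th t x) (fun t x => sg *: Dth t x).
Proof.
move=> sg1 heat tau phi tau0 Tphi; have := heat tau phi tau0 Tphi.
move=> /(congr1 ( *%R sg)); rewrite mulrBr -!Rintegral_sign// => E.
transitivity (\int[lebesgue_rV R d]_(x in Om) (sg * (th tau x * phi tau x)) -
    \int[lebesgue_rV R d]_(x in Om) (sg * (th 0 x * phi 0 x))).
  by congr (_ - _); apply: eq_Rintegral => x _; rewrite mulrA.
rewrite E; apply: eq_Rintegral => -[t x] _.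
have -> : \sum_i (sg *: Dth t x) ord0 i * partial i (phi t) x =
    sg * \sum_i Dth t x ord0 i * partial i (phi t) x.
  by rewrite mulr_sumr; apply: eq_bigr => i _; rewrite mxE mulrA.
set s1 := \sum_i _; set s2 := \sum_i _; set td := time_derivative _ _ _; ring.
Qed.

Lemma ess_bounded d (X : measurableType d) (R : realType)
    (mu : {measure set X -> \bar R}) (D : set X) (f : X -> R) :
  Lp_on mu +oo%E D f -> exists S : R, {ae mu, forall x, D x -> `|f x| <= S}.
Proof.
move=> [mf]; rewrite /finite_norm unlock; case: ifPn => [mu0 foo|]; last first.
  rewrite -leNgt => mu0 _; exists 0.
  exists setT; split => //.
  by apply/eqP; rewrite eq_le mu0 measure_ge0.
have := @ess_sup_ge _ _ _ mu (abse \o (EFin \o (f \_ D))).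
case: (ess_sup _ _) foo => [S| |]// _ fS.
  exists S; apply: ae_mono fS => x /= + Dx.
  by rewrite patchE mem_set// lee_fin.
by exists 0; apply: ae_mono fS => x /=; rewrite leNgt ltNyr.
Qed.

(** The measure of the whole space is positive, so the essential supremum is not minus infinity. *)
Lemma ess_sup_norm_ge0 (R : realType) n (Om : set 'rV[R]_n) (f : 'rV[R]_n -> R) :
  (0 <= ess_sup_norm (lebesgue_rV R n) Om f)%E.
Proof.
apply: ess_sup_gee; last by apply: aeW => x; rewrite lee_fin.
have := @lebesgue_rV_box R n (fun=> [set` `[0, 1]]) (fun=> measurable_itv _).
rewrite big1; last first.
  by move=> i _; rewrite lebesgue_measure_itv/= lte_fin ltr01 -EFinB subr0.
move=> b1; apply: (@lt_le_trans _ _ 1%E); first exact: lte01.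
rewrite -b1; apply: le_measure; rewrite ?inE//.
suff : measurable (\bigcap_(i in [set: 'I_n])
    ((fun x : 'rV[R]_n => x ord0 i) @^-1` [set` `[0, 1]])).
  by congr measurable; apply/seteqP; split => x /= h i; [exact: h|move=> _; exact: h].
apply: fin_bigcap_measurable => // i _; rewrite -[X in measurable X]setTI.
by apply: measurable_coord => //; exact: measurable_itv.
Qed.

Lemma norm_mean_le (R : realType) n (Om : set 'rV[R]_n) (f : 'rV[R]_n -> R) S :
  measurable Om -> (lebesgue_rV R n Om < +oo)%E -> 0 <= S ->
  sqint (lebesgue_rV R n) Om f ->
  {ae lebesgue_rV R n, forall x, Om x -> `|f x| <= S} -> `|mean Om f| <= S.
Proof.
set dx := lebesgue_rV R n => mOm Omoo S0 sf fS.
have i_f := sqint_integrable mOm Omoo sf.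
have v0 : 0 <= fine (dx Om) by exact: fine_ge0.
have If : `|\int[dx]_(x in Om) f x| <= S * fine (dx Om).
  apply: le_trans (le_normr_Rintegral mOm i_f) _.
  rewrite -lee_fin /Rintegral fineK; last first.
    exact: (integrable_fin_num mOm (integrable_norm i_f)).
  rewrite EFinM fineK ?ge0_fin_numE// -integral_cst//.
  apply: ae_ge0_le_integral => //.
  by apply/measurable_EFinP; apply: measurableT_comp => //; case: sf.
by rewrite /mean normrM ger0_norm ?invr_ge0//; have [->|vn0] := eqVneq (fine (dx Om)) 0;
  rewrite ?invr0 ?mul0r// mulrC ler_pdivrMr// lt_neqAle eq_sym vn0.
Qed.

Section harmonic_boundary_bound.
Context {R : realType} {d : nat}.
Local Notation E := 'rV[R]_d.
Variables (Om : set E) (thetaB : E -> R) (i0 : 'I_d).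
Hypotheses (oOm : open Om) (bOm : bounded_set Om) (Om0 : Om !=set0).
Hypotheses (hB : Ck_closure 2 Om thetaB) (lapB : forall x, Om x -> laplacian thetaB x = 0).

Let B := sup [set `|thetaB x| | x in boundary Om].

Let le_B y : boundary Om y -> `|thetaB y| <= B.
Proof.
have [M HM] := bounded_on_closure bOm hB.1.
move=> By; apply: ub_le_sup; last by exists y.
by exists M => _ [x [Cx _] <-]; exact: HM.
Qed.

Lemma boundary_sup_ge0 : 0 <= B.
Proof.
have [x Ox] := Om0; have [y By _] := weak_maximum_principle 1 i0 oOm bOm hB lapB Ox.
exact: le_trans (le_B By).
Qed.

Lemma harmonic_sign_le sg x : sg ^+ 2 = 1 -> Om x -> sg * thetaB x <= B.
Proof.
move=> sg1 Ox; have [y By xy] := weak_maximum_principle sg i0 oOm bOm hB lapB Ox.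
apply: le_trans xy _; apply: le_trans (le_B By); apply: le_trans (ler_norm _) _.
move: sg1 => /eqP; rewrite sqrf_eq1 => /orP[|] /eqP ->.
  by rewrite mul1r.
by rewrite mulN1r normrN.
Qed.

End harmonic_boundary_bound.

(** * Iteration of the bound *)

Section a_priori_bound.
Context {R : realType} {d : nat}.
Local Notation E := 'rV[R]_d.
Local Notation lam := (@lebesgue_measure R).
Local Notation dx := (lebesgue_rV R d).
Local Notation dtdx := (lebesgue_time_rV R d).
Variables (Om : set E) (kappa alpha : R) (thetaB : E -> R) (i0 : 'I_d).
Variables (u : R -> E -> E) (Du : R -> E -> 'M[R]_d).
Variables (Theta : R -> E -> R) (DTheta Dv : R -> E -> E).
Hypotheses (oOm : open Om) (bOm : bounded_set Om) (Om0 : Om !=set0).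
Hypotheses (hB : Ck_closure 2 Om thetaB) (lapB : forall x, Om x -> laplacian thetaB x = 0).
Hypotheses (kappa0 : 0 <= kappa) (alpha0 : 0 < alpha) (alpha1 : alpha < 1).
Hypothesis hu : forall i, L2_loc_sobolev1_0 Om (fun t x => u t x ord0 i)
  (fun t x => row i (Du t x)).
Hypothesis trDu : {ae dtdx, forall z, 0 < z.1 -> Om z.2 -> \tr (Du z.1 z.2) = 0}.
Hypothesis wTheta : weakly_continuous_L2 Om Theta.
Hypothesis bTheta : Lp_loc_cylinder +oo%E Om Theta.
Hypothesis sTheta : L2_loc_sobolev1 Om Theta DTheta.
Hypothesis hv : L2_loc_sobolev1_0 Om
  (fun t x => Theta t x + alpha * mean Om (Theta t) - thetaB x) Dv.
Hypothesis heat : heat_equation Om kappa u Theta DTheta.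

Let B := sup [set `|thetaB x| | x in boundary Om].
Let mOm : measurable Om := open_measurable_rV oOm.
Let Omoo : (dx Om < +oo)%E := lebesgue_bounded_lty oOm bOm.

Let bounded_by (T K : R) := {ae dtdx, forall z, cylinder T Om z -> `|Theta z.1 z.2| <= K}.

Let Theta_slice t : 0 <= t -> sqint dx Om (Theta t).
Proof. by move=> t0; apply: Lp_on_sqint; exact: wTheta.1. Qed.

Let Ck1 : Ck_closure 1 Om thetaB.
Proof.
have [cB [eB dB]] := hB; split => //; split => // i.
by have [di [ei _]] := dB i; split => //; split.
Qed.

Let one_sided T S K sg : 0 < T -> 0 <= S -> sg ^+ 2 = 1 -> bounded_by T S ->
  {ae dx, forall x, Om x -> `|Theta 0 x| <= K} -> B + alpha * S <= K ->
  {ae dtdx, forall z, cylinder T Om z -> sg * Theta z.1 z.2 <= K}.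
Proof.
move=> T0 S0 sg1 TS TK BK.
have mcyl : measurable (cylinder T Om).
  by apply: measurableX => //; exact: measurable_itv.
have sgn : `|sg| = 1.
  by move: sg1 => /eqP; rewrite sqrf_eq1 => /orP[|] /eqP ->; rewrite ?normrN normr1.
apply: (@comparison_principle R d Om kappa K S T u Du (fun t x => sg * Theta t x)
  (fun t x => sg *: DTheta t x) oOm Omoo kappa0 T0).
- exact: heat_equation_sign.
- apply: sqintZ => //; apply: Lp_on_sqint; case: sTheta => + _ _; exact.
- by apply: ae_mono TS => z + Dz => /(_ Dz); rewrite normrM sgn mul1r.
- by move=> i; apply: Lp_on_sqint; case: (hu i) => -[+ _ _] _; exact.
- move=> i; have -> : (fun z : measurableTypeR R * E => (sg *: DTheta z.1 z.2) ord0 i) =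
      (fun z => sg * DTheta z.1 z.2 ord0 i) by apply/funext => z; rewrite mxE.
  by apply: sqintZ => //; apply: Lp_on_sqint; case: sTheta => _ /(_ i) + _; exact.
- by move=> t t0; apply: sqintZ => //; exact: Theta_slice.
- have ae_u : {ae lam, forall t, forall i, 0 < t ->
      sobolev1_0 2%:E Om (fun x => u t x ord0 i) (fun x => row i (Du t x))}.
    by apply: filter_forall => i; have [_] := hu i.
  have ae_tr := @ae_product_slices _ _ _ _ R lam dx _ trDu.
  have ae_S := @ae_product_slices _ _ _ _ R lam dx _ TS.
  have ae_Theta : {ae lam, forall t, 0 < t ->
      sobolev1 2%:E Om (Theta t) (DTheta t)} by case: sTheta.
  have ae_v : {ae lam, forall t, 0 < t -> sobolev1_0 2%:E Om
     (fun x => Theta t x + alpha * mean Om (Theta t) - thetaB x) (Dv t)} by case: hv.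
  have ae1 := ae_mono2 (fun t a b => conj a b) ae_u ae_tr.
  have ae2 := ae_mono2 (fun t a b => conj a b) ae_S ae_Theta.
  have ae3 := ae_mono2 (fun t a b => conj a b) ae1 ae2.
  apply: ae_mono2 ae3 ae_v => t [[u_t tr_t] [S_t Theta_t]] v_t /andP[t0 tT].
  split.
  + by move=> i; exact: u_t.
  + by apply: ae_mono tr_t => x + Ox; exact.
  + move=> i; have -> : (fun x => (sg *: DTheta t x) ord0 i) =
        (fun x => sg * DTheta t x ord0 i) by apply/funext => x; rewrite mxE.
    apply: sqintZ => //; apply: Lp_on_sqint.
    by have [_ + _] := Theta_t t0; exact.
  + apply: (boundary_condition_trace oOm bOm Ck1 (Theta_t t0) (v_t t0) sg1) => x Ox.
    have mS : `|mean Om (Theta t)| <= S.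
      apply: norm_mean_le => //; first by apply: Theta_slice; exact: ltW.
      apply: ae_mono S_t => y + Oy; apply; split => //=.
      by rewrite in_itv/= t0.
    rewrite mulrBr; apply: le_trans BK; apply: lerD.
      exact: (harmonic_sign_le i0).
    apply: le_trans (ler_norm _) _.
    by rewrite normrN normrM sgn mul1r normrM (gtr0_norm alpha0) ler_wpM2l// ltW.
- apply: ae_mono TK => x + Ox => /(_ Ox); apply: le_trans.
  by apply: le_trans (ler_norm _) _; rewrite normrM sgn mul1r.
Qed.

(** The mean of [Theta] is at most [S] in modulus, so boundary values of [Theta] and of
[- Theta] are at most [B + alpha * S]. *)
Let improve T S K : 0 < T -> 0 <= S -> bounded_by T S ->
  {ae dx, forall x, Om x -> `|Theta 0 x| <= K} -> B + alpha * S <= K -> bounded_by T K.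
Proof.
move=> T0 S0 TS TK BK.
have h1 := one_sided T0 S0 (expr1n _ 2) TS TK BK.
have sqN1 : (-1) ^+ 2 = 1 :> R by rewrite sqrrN expr1n.
have h2 := one_sided T0 S0 sqN1 TS TK BK.
apply: ae_mono2 h1 h2 => z z1 z2 Dz.
have := z1 Dz; have := z2 Dz; rewrite mul1r mulN1r => e1 e2.
by rewrite ler_norml e2 andbT lerNl.
Qed.

(** The bounds [C + alpha ^+ n * `|S0|] hold for all [n] by induction, [C] being a bound that
the improvement does not worsen. *)
Lemma a_priori_bound T M : 0 < T -> 0 <= M ->
  {ae dx, forall x, Om x -> `|Theta 0 x| <= M} ->
  bounded_by T (M + 2 / (1 - alpha ^+ 2) * B).
Proof.
move=> T0 M0 TM; have B0 : 0 <= B := boundary_sup_ge0 i0 oOm bOm Om0 hB lapB.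
set C := M + _.
have a2 : 0 < 1 - alpha ^+ 2 by rewrite subr_gt0 expr_lt1// ltW.
have MC : M <= C by rewrite lerDl mulr_ge0// divr_ge0// ltW.
have C0 : 0 <= C := le_trans M0 MC.
have BC : B + alpha * C <= C.
  (* Since [1 - alpha ^+ 2 = (1 - alpha) * (1 + alpha)] and [1 + alpha <= 2]. *)
  have e : (1 - alpha) * (2 / (1 - alpha ^+ 2) * B) = 2 / (1 + alpha) * B.
    by field; apply/andP; split; nra.
  have h : B <= 2 / (1 + alpha) * B.
    have a1 : 0 < 1 + alpha by rewrite addr_gt0.
    by rewrite ler_peMl// ler_pdivlMr// mul1r lerD2l ltW.
  have Ma : 0 <= (1 - alpha) * M by rewrite mulr_ge0// subr_ge0 ltW.
  rewrite -subr_ge0 (_ : _ - _ = (1 - alpha) * M + (2 / (1 + alpha) * B - B)).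
    by rewrite addr_ge0// subr_ge0.
  by rewrite -e /C; ring.
have [S0 TS0] := ess_bounded (bTheta T0).
pose S n := C + alpha ^+ n * `|S0|.
have Sn n : bounded_by T (S n).
  elim: n => [|n IH].
    apply: ae_mono TS0 => z + Dz => /(_ Dz) zS; apply: le_trans zS _.
    by rewrite /S expr0 mul1r (le_trans (ler_norm _))// lerDr.
  apply: (improve T0 _ IH).
  - by rewrite addr_ge0// mulr_ge0// exprn_ge0// ltW.
  - apply: ae_mono TM => x + Ox => /(_ Ox) xM; apply: le_trans xM _.
    by apply: le_trans MC _; rewrite lerDl mulr_ge0// exprn_ge0// ltW.
  - by rewrite /S exprS mulrDr addrA mulrA lerD2r.
apply: ae_mono (ae_foralln Sn) => z zS Dz.
have limS : S n @[n --> \oo] --> C.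
  rewrite -[X in _ --> X]addr0; apply: cvgD; first exact: cvg_cst.
  rewrite -(mul0r `|S0|); apply: cvgM; last exact: cvg_cst.
  by apply: cvg_expr; rewrite gtr0_norm.
by apply: (cvgr_to_ge limS); apply: nearW => n; exact: zS.
Qed.

End a_priori_bound.

Theorem theorem3p1 (R : realType) (d : nat) (hd : d = 2%N \/ d = 3%N)
  (Om : set 'rV[R]_d) (hOm : bounded_lipschitz_domain Om)
  (mu kappa : R) (hmu : 0 < mu) (hkappa : 0 < kappa)
  (G : 'rV[R]_d -> R) (DG : 'rV[R]_d -> 'rV[R]_d)
  (hG : sobolev1 +oo%E Om G DG)
  (hGharm : distributionally_harmonic Om G)
  (hGmean : \int[lebesgue_rV R d]_(x in Om) G x = 0)
  (thetaB : 'rV[R]_d -> R)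
  (hB : Ck_closure 2 Om thetaB)
  (hBharm : forall x, Om x -> laplacian thetaB x = 0)
  (alpha : R) (halpha : 0 < alpha < 1)
  (u0 : 'rV[R]_d -> 'rV[R]_d) (Theta0 : 'rV[R]_d -> R)
  (hinit : initial_data Om alpha thetaB u0 Theta0)
  (u : R -> 'rV[R]_d -> 'rV[R]_d) (Theta : R -> 'rV[R]_d -> R)
  (hsol : weak_solution Om mu kappa alpha DG thetaB u Theta)
  (hu0 : {ae lebesgue_rV R d, forall x, Om x -> u 0 x = u0 x})
  (hTheta0 : {ae lebesgue_rV R d, forall x, Om x -> Theta 0 x = Theta0 x}) :
  {ae lebesgue_time_rV R d, forall z : R * 'rV[R]_d, 0 < z.1 -> Om z.2 ->
    (`|Theta z.1 z.2|%:E <=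
     ess_sup_norm (lebesgue_rV R d) Om (Theta 0%R)
     + (2 / (1 - alpha ^+ 2)
        * sup [set `|thetaB x| | x in boundary Om])%:E)%E}.
Proof.
have [oOm _ Om0 bOm _] := hOm; have /andP[alpha0 alpha1] := halpha.
have d0 : (0 < d)%N by case: hd => ->.
pose i0 := Ordinal d0.
have [Du [DTheta [[_ _ hu trDu _] [wTheta bTheta sTheta [Dv hv] heat]]]] := hsol.
have := ess_sup_norm_ge0 Om (Theta 0).
have := @ess_sup_ge _ _ _ (lebesgue_rV R d) (fun x => `|((Theta 0) \_ Om) x|%:E).
rewrite -/(ess_sup_norm _ _ _); case: (ess_sup_norm _ _ _) => [M| |]//; last first.
  by move=> _ _; apply: aeW => z _ _; rewrite addye// leey.
move=> TM; rewrite lee_fin => M0.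
have {}TM : {ae lebesgue_rV R d, forall x, Om x -> `|Theta 0 x| <= M}.
  by apply: ae_mono TM => x + Ox; rewrite patchE mem_set// lee_fin.
have bound n := a_priori_bound i0 oOm bOm Om0 hB hBharm (ltW hkappa) alpha0 alpha1
  hu trDu wTheta bTheta sTheta hv heat (ltr0Sn R n) M0 TM.
apply: ae_mono (ae_foralln bound) => -[t x] zb /= t0 Ox.
rewrite -EFinD lee_fin; apply: (zb (Num.trunc t)); split => //=.
by rewrite in_itv/= t0 truncnS_gt.
Qed.
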